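(* Let $n\ge 1$, $N=2n$, let $\lambda$ be a diagram with $m\ge 1$ boxes such that $\lambda_1\le n$, let $T$ be a standard tableau of shape $\lambda$, let $U$ be the tableau obtained from $T$ by removing the box occupied by $m$, and let $\mu$ be the shape of $U$. Regarding the idempotents $E_T\in\mathcal{B}_m(-N)$ and $E_U\in\mathcal{B}_{m-1}(-N)$ as operators on $(\mathbb{C}^N)^{\otimes m}$ and $(\mathbb{C}^N)^{\otimes(m-1)}$, we have $$\mathrm{tr}_m E_T=E_U\,\frac{D(\lambda')}{D(\mu')}.$$ Moreover, for any diagram $\rho$ with at most $n$ rows, the dimension of the irreducible representation $L(\rho)$ of $\mathrm{Sp}_N$ equals $D(\rho)$.
   Context: Partitions are identified with Young diagrams; $(i,j)$ is the box in row $i$, column $j$; $\rho_i$ is the length of row $i$, $\rho'$ is the conjugate diagram, so $\rho'_j$ is the length of column $j$. $H(\rho)$ is the product of the hook lengths of $\rho$. For a diagram $\rho$ with at most $n$ rows set $$D(\rho)=\frac{1}{H(\rho)}\prod_{(i,j)\in\rho}\big(N+1+d(i,j)\big),\qquad d(i,j)=\begin{cases}\rho_i+\rho_j-i-j+1&\text{if } i>j,\\ -\rho'_i-\rho'_j+i+j-1&\text{if } i\le j.\end{cases}$$ Brauer algebra. $\mathcal{B}_m(\omega)$ is spanned by the $m$-diagrams ($2m$ dots in two rows of $m$ dots, connected by $m$ edges, each dot in exactly one edge); the product $d_1d_2$ is obtained by placing $d_1$ above $d_2$, identifying the bottom row of $d_1$ with the top row of $d_2$, and multiplying the resulting diagram,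 with closed loops removed, by $\omega^s$, where $s$ is the number of closed loops. For $a<b$, $s_{ab}$ is the diagram of the transposition $(a\,b)$, and $\epsilon_{ab}$ is the diagram with an edge joining dots $a,b$ of the top row, an edge joining dots $a,b$ of the bottom row, and vertical edges elsewhere. The Jucys–Murphy elements are $x_b=\frac{\omega-1}{2}+\sum_{a=1}^{b-1}(s_{ab}-\epsilon_{ab})$. A standard tableau $T$ of shape $\lambda\vdash m$ is a sequence $(\Lambda_1,\dots,\Lambda_m=\lambda)$ of diagrams with $\Lambda_r$ obtained from $\Lambda_{r-1}$ by adding one box (the box occupied by $r$), $\Lambda_0=\varnothing$; its contents are $c_a=\frac{\omega-1}{2}+j-i$ if $\Lambda_a$ is obtained by adding the box $(i,j)$ to $\Lambda_{a-1}$. The primitive idempotents are defined recursively by $E_T=1$ for $m=1$ and $E_T=E_U\,\frac{u-c_m}{u-x_m}\big|_{u=c_m}$, where $U=(\Lambda_1,\dots,\Lambda_{m-1})$ (the right hand side is a rational function of $u$ regular at $u=c_m$). For $m=1$, $E_U=1$ and $D(\varnothing)=1$. Here $\omega$ is specialized to $-N$ and $\mathcal{B}_m(-N)$ acts on $(\mathbb{C}^N)^{\otimes m}$ by $s_{ab}\mapsto -P_{ab}$, $\epsilon_{ab}\mapsto -Q_{ab}$, where $P_{ab}=\sum_{i,j}e_{ij}\otimes e_{ji}$ and $Q_{ab}=\sum_{i,j}\varepsilon_i\varepsilon_j\,e_{ij}\otimes e_{i'j'}$, the two tensor factors being in positions $a$ and $b$ (identity elsewhere); $e_{ij}$ are the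 matrix units, $i'=N-i+1$, $\varepsilon_i=1$ for $i\le n$ and $\varepsilon_i=-1$ for $i>n$. This action commutes with that of $\mathrm{Sp}_N=\{Z : Z^tGZ=G\}$, $G=[\varepsilon_i\delta_{ij'}]$. $\mathrm{tr}_m:(\mathrm{End}\,\mathbb{C}^N)^{\otimes m}\to(\mathrm{End}\,\mathbb{C}^N)^{\otimes(m-1)}$ is the partial trace over the $m$-th copy. $L(\rho)$ is the irreducible representation of $\mathrm{Sp}_N$ associated with $\rho$ in the decomposition of $(\mathbb{C}^N)^{\otimes m}$ under $\mathcal{B}_m(-N)\times\mathrm{Sp}_N$, where $L(\lambda')$ is paired with the irreducible representation $V_\lambda$ of $\mathcal{B}_m(-N)$; $L(\lambda')$ is isomorphic to $E_T(\mathbb{C}^N)^{\otimes m}$ for any standard tableau $T$ of shape $\lambda$. *)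

(* Defs.v *)
From HB Require Import structures.
From mathcomp Require Import all_boot all_order all_algebra.
From mathcomp Require Import perm classical_sets.

Set Implicit Arguments.
Unset Strict Implicit.
Unset Printing Implicit Defensive.

Import GRing.Theory.
Local Open Scope ring_scope.

(** * Young diagrams *)

(* A diagram is the list of its nonzero row lengths.  Rows, columns and boxes
   are numbered from 1. *)
Definition is_diagram (rho : seq nat) : bool := sorted geq rho && (0%N \notin rho).

Definition rowlen (rho : seq nat) (i : nat) : nat := nth 0%N rho i.-1.

Definition collen (rho : seq nat) (j : nat) : nat := count (leq j) rho.

Definition conj_diagram (rho : seq nat) : seq nat :=
  [seq collen rho j | j <- iota 1 (rowlen rho 1)].

Definition hook (rho : seq nat) (i j : nat) : nat :=
  ((rowlen rho i - j) + (collen rho j - i) + 1)%N.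

Definition hook_product (rho : seq nat) : nat :=
  (\prod_(1 <= i < (size rho).+1) \prod_(1 <= j < (rowlen rho i).+1) hook rho i j)%N.

Definition dbox (rho : seq nat) (i j : nat) : int :=
  if (j < i)%N then (rowlen rho i)%:Z + (rowlen rho j)%:Z - i%:Z - j%:Z + 1
  else - (collen rho i)%:Z - (collen rho j)%:Z + i%:Z + j%:Z - 1.

Definition D (F : fieldType) (n : nat) (rho : seq nat) : F :=
  (hook_product rho)%:R^-1 *
  \prod_(1 <= i < (size rho).+1) \prod_(1 <= j < (rowlen rho i).+1)
     ((2 * n)%:Z + 1 + dbox rho i j)%:~R.

(* [incr_nth mu k] lengthens row [k + 1] of [mu]; for [k = size mu] it creates
   a new row of length 1. *)
Definition added_row (mu lam : seq nat) : nat :=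
  (find (fun k => lam == incr_nth mu k) (iota 0 (size mu).+1)).+1.

Definition adds_box (mu lam : seq nat) : bool :=
  has (fun k => lam == incr_nth mu k) (iota 0 (size mu).+1).

(* [T = [:: Lambda_1; ...; Lambda_m]]; the empty diagram Lambda_0 is implicit. *)
Definition tableau := seq (seq nat).

Definition Lambda (T : tableau) (r : nat) : seq nat := nth [::] ([::] :: T) r.

Definition std_tableau (lam : seq nat) (T : tableau) : bool :=
  [&& all is_diagram T, path adds_box [::] T & last [::] T == lam].

Definition content (F : fieldType) (omega : F) (T : tableau) (r : nat) : F :=
  let i := added_row (Lambda T r.-1) (Lambda T r) in
  let j := rowlen (Lambda T r) i in
  (omega - 1) / 2 + j%:R - i%:R.

(** * The Brauer algebra *)

(* [inl a] is dot [a] of the top row, [inr a] dot [a] of the bottom row. *)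
Definition dot (m : nat) : finType := ('I_m + 'I_m)%type.

(* The edges are given by the map sending each dot to the dot it is joined to. *)
Record diagram (m : nat) := Diagram {
  mate :> {ffun dot m -> dot m};
  _ : [forall p, (mate (mate p) == p) && (mate p != p)] }.

HB.instance Definition _ (m : nat) := [isSub for @mate m].
HB.instance Definition _ (m : nat) := [Finite of diagram m by <:].

Definition brauer (F : fieldType) (m : nat) := {ffun diagram m -> F^o}.

(* The sum of the diagrams satisfying [P]; below there is always just one. *)
Definition diag_elt (F : fieldType) m (P : pred (diagram m)) : brauer F m :=
  [ffun d => (P d)%:R].

Definition bone (F : fieldType) m : brauer F m :=
  diag_elt F (fun d => [forall i, d (inl i) == inr i]).

Definition bs (F : fieldType) m (a b : 'I_m) : brauer F m :=
  diag_elt F (fun d => [forall i, d (inl i) == inr (tperm a b i)]).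

Definition beps (F : fieldType) m (a b : 'I_m) : brauer F m :=
  diag_elt F (fun d => [&& d (inl a) == inl b, d (inr a) == inr b &
    [forall i, (i != a) && (i != b) ==> (d (inl i) == inr i)]]).

(* Three rows of dots: top, middle and bottom.  [d1] occupies the first two
   rows and [d2] the last two. *)
Definition dot3 (m : nat) : finType := ('I_m + 'I_m + 'I_m)%type.

Definition upper m (p : dot m) : dot3 m :=
  match p with inl i => inl (inl i) | inr i => inl (inr i) end.

Definition lower m (p : dot m) : dot3 m :=
  match p with inl i => inl (inr i) | inr i => inr i end.

Definition outer m (p : dot m) : dot3 m :=
  match p with inl i => inl (inl i) | inr i => inr i end.

Definition stack m (d1 d2 : diagram m) : rel (dot3 m) := fun x y =>
  [exists p, (x == upper p) && (y == upper (d1 p))] ||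
  [exists p, (x == lower p) && (y == lower (d2 p))].

(* [d] is the stacking of [d1] on [d2] with the closed loops removed. *)
Definition stacks_to m (d1 d2 d : diagram m) : bool :=
  [forall p, connect (stack d1 d2) (outer p) (outer (d p))].

Definition loops m (d1 d2 : diagram m) : nat :=
  n_comp (stack d1 d2)
    [pred x | [forall p, ~~ connect (stack d1 d2) x (outer p)]].

Definition bmul (F : fieldType) (omega : F) m (x y : brauer F m) : brauer F m :=
  [ffun d => \sum_(d1 : diagram m) \sum_(d2 : diagram m | stacks_to d1 d2 d)
     x d1 * y d2 * omega ^+ loops d1 d2].

(* The inclusion of B_m in B_(m+1): a vertical edge is added on the right. *)
Definition dot_widen m (p : dot m) : dot m.+1 :=
  match p with inl i => inl (widen_ord (leqnSn m) i)
             | inr i => inr (widen_ord (leqnSn m) i) end.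

Definition bwiden (F : fieldType) m (x : brauer F m) : brauer F m.+1 :=
  [ffun d' : diagram m.+1 =>
     \sum_(d : diagram m | [forall p, d' (dot_widen p) == dot_widen (d p)]) x d].

Definition jm (F : fieldType) (omega : F) m (b : 'I_m) : brauer F m :=
  ((omega - 1) / 2) *: bone F m + \sum_(a < m | (a < b)%N) (bs F a b - beps F a b).

(** * The idempotents *)

(* [f], a rational function of the indeterminate, is regular at [c] with value
   [v] there. *)
Definition frac_value (F : fieldType) (f : {fraction {poly F}}) (c v : F) : Prop :=
  exists p q : {poly F},
    [/\ q.[c] != 0, f = tofrac p / tofrac q & v = p.[c] / q.[c]].

Definition const_frac (F : fieldType) (z : F) : {fraction {poly F}} := tofrac z%:P.

Definition bext (F : fieldType) m (x : brauer F m) :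
    brauer {fraction {poly F}} m := [ffun d => const_frac (x d)].

(* [E] is the value at [u = c] of [e (u - c) / (u - x)], an element of the
   Brauer algebra over the field of rational functions in [u]. *)
Definition resolvent_value (F : fieldType) (omega : F) m (e x : brauer F m)
    (c : F) (E : brauer F m) : Prop :=
  let u : {fraction {poly F}} := tofrac 'X in
  let mul := @bmul _ (const_frac omega) m in
  let one := bone {fraction {poly F}} m in
  exists y : brauer {fraction {poly F}} m,
    [/\ mul (u *: one - bext x) y = one,
        mul y (u *: one - bext x) = one
      & forall d, frac_value (((u - const_frac c) *: mul (bext e) y) d) c (E d)].

(* E_T for the tableau formed by the first [m] diagrams of [T].  The default
   value 0 is for tableaux whose resolvent is not regular. *)
Fixpoint idem (F : fieldType) (omega : F) (T : tableau) (m : nat) : brauer F m :=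
  match m return brauer F m with
  | 0 => bone F 0
  | m'.+1 =>
      if m' is 0 then bone F m'.+1 else
      xget 0 [set E | resolvent_value omega (bwiden (idem omega T m'))
                        (jm omega ord_max) (content omega T m'.+1) E]%classic
  end.

(** * Representations of the Brauer algebra *)

Definition brauer_rep (F : fieldType) (omega : F) m (V : vectType F)
    (beta : {linear brauer F m -> 'End(V)}) : Prop :=
  beta (bone F m) = \1%VF /\
  forall x y, beta (bmul omega x y) = (beta x \o beta y)%VF.

Definition brauer_irreducible (F : fieldType) m (V : vectType F)
    (beta : {linear brauer F m -> 'End(V)}) : Prop :=
  {:V}%VS != 0%VS /\
  forall A : {vspace V}, (forall x, (beta x @: A <= A)%VS) ->
    A = 0%VS \/ A = {:V}%VS.

(* V_lam, for a diagram [lam] with [m] boxes: the irreducible representation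
   with a basis v_T, T running over the standard tableaux of shape [lam], such
   that x_r v_T = c_r(T) v_T for all r. *)
Definition is_V (F : fieldType) (omega : F) (lam : seq nat) m (V : vectType F)
    (beta : {linear brauer F m -> 'End(V)}) : Prop :=
  [/\ brauer_rep omega beta, brauer_irreducible beta &
      exists (tabs : seq tableau) (v : tableau -> V),
        [/\ uniq tabs, (forall T, (T \in tabs) = std_tableau lam T),
            basis_of {:V}%VS [seq v T | T <- tabs] &
            forall T, T \in tabs -> forall b : 'I_m,
              beta (jm omega b) (v T) = content omega T b.+1 *: v T]].

(** * The tensor space and the symplectic group *)

Definition mindex (n m : nat) : finType := {ffun 'I_m -> 'I_(2 * n)}.

(* The m-th tensor power of F^N, N = 2n: a tensor is the family of its
   coordinates in the basis e_J = e_(J 0) (x) ... (x) e_(J (m - 1)). *)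
Definition tensor (F : fieldType) (n m : nat) : vectType F :=
  {ffun mindex n m -> F^o}.

Definition tbasis (F : fieldType) n m (J : mindex n m) : tensor F n m :=
  [ffun I => (I == J)%:R].

Definition entry (F : fieldType) n m (A : 'End(tensor F n m))
    (I J : mindex n m) : F := A (tbasis F J) I.

(* The operator with matrix entries [K I J]. *)
Definition operator (F : fieldType) n m (K : mindex n m -> mindex n m -> F) :
    'End(tensor F n m) :=
  linfun (fun t : tensor F n m =>
            [ffun I => \sum_J K I J * t J] : tensor F n m).

(* With indices starting from 0, [rev_ord i] is i'. *)
Definition eps (F : fieldType) n (i : 'I_(2 * n)) : F := if (i < n)%N then 1 else -1.

(* The matrix unit e_ij. *)
Definition munit (F : fieldType) n (i j : 'I_(2 * n)) : 'M[F]_(2 * n) :=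
  delta_mx i j.

(* Z in position [a], Z' in position [b], the identity elsewhere. *)
Definition two_factors (F : fieldType) n m (a b : 'I_m) (Z Z' : 'M[F]_(2 * n)) :
    'End(tensor F n m) :=
  operator (fun I J => Z (I a) (J a) * Z' (I b) (J b) *
    \prod_(c < m | (c != a) && (c != b)) (I c == J c)%:R).

Definition P_op (F : fieldType) n m (a b : 'I_m) : 'End(tensor F n m) :=
  \sum_i \sum_j two_factors a b (munit F i j) (munit F j i).

Definition Q_op (F : fieldType) n m (a b : 'I_m) : 'End(tensor F n m) :=
  \sum_i \sum_j
    (eps F i * eps F j) *: two_factors a b
      (munit F i j) (munit F (rev_ord i) (rev_ord j)).

Definition brauer_omega (F : fieldType) (n : nat) : F := - (2 * n)%:R.

(* The action of B_m(-N) on the tensor space; the elements s_ab and eps_ab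
   generate B_m(-N), so there is only one. *)
Definition tensor_action (F : fieldType) n m
    (act : {linear brauer F m -> 'End(tensor F n m)}) : Prop :=
  brauer_rep (brauer_omega F n) act /\
  forall a b : 'I_m, (a < b)%N ->
    act (bs F a b) = - P_op F n a b /\ act (beps F a b) = - Q_op F n a b.

Definition mextend n m (I : mindex n m) (k : 'I_(2 * n)) : mindex n m.+1 :=
  [ffun c : 'I_m.+1 => if unlift ord_max c is Some c' then I c' else k].

Definition ptrace (F : fieldType) n m (A : 'End(tensor F n m.+1)) :
    'End(tensor F n m) :=
  operator (fun I J => \sum_k entry A (mextend I k) (mextend J k)).

Definition Gform (F : fieldType) n : 'M[F]_(2 * n) :=
  \matrix_(i, j) (eps F i * (i == rev_ord j)%:R).

Definition Sp (F : fieldType) n (Z : 'M[F]_(2 * n)) : Prop :=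
  Z^T *m Gform F n *m Z = Gform F n.

Definition tensor_pow (F : fieldType) n m (Z : 'M[F]_(2 * n)) :
    'End(tensor F n m) :=
  operator (fun I J => \prod_(c < m) Z (I c) (J c)).

(** * Representations of the symplectic group *)

(* Only the values of [r] on Sp_N matter. *)
Definition Sp_rep (F : fieldType) n (X : vectType F)
    (r : 'M[F]_(2 * n) -> 'End(X)) : Prop :=
  r 1%:M = \1%VF /\
  forall Z Z', Sp Z -> Sp Z' -> r (Z *m Z') = (r Z \o r Z')%VF.

Definition Sp_irreducible (F : fieldType) n (X : vectType F)
    (r : 'M[F]_(2 * n) -> 'End(X)) : Prop :=
  {:X}%VS != 0%VS /\
  forall A : {vspace X}, (forall Z, Sp Z -> (r Z @: A <= A)%VS) ->
    A = 0%VS \/ A = {:X}%VS.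

Definition intertwiner (F : fieldType) m (V W : vectType F)
    (beta : {linear brauer F m -> 'End(V)}) (act : {linear brauer F m -> 'End(W)})
    (f : 'Hom(V, W)) : Prop :=
  forall x, (f \o beta x)%VF = (act x \o f)%VF.

(* L(rho): the irreducible representation of Sp_N paired with V_(rho') in the
   decomposition of the m-th tensor power W, m = |rho|, under B_m(-N) x Sp_N,
   that is, the multiplicity space Hom_(B_m(-N)) (V_(rho'), W) on which Sp_N acts
   through W. *)
Definition is_L (F : fieldType) n
    (act : forall m, {linear brauer F m -> 'End(tensor F n m)})
    (rho : seq nat) (X : vectType F) (r : 'M[F]_(2 * n) -> 'End(X)) : Prop :=
  [/\ Sp_rep r, Sp_irreducible r &
      exists (V : vectType F) (beta : {linear brauer F (sumn rho) -> 'End(V)})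
             (phi : {linear X -> 'Hom(V, tensor F n (sumn rho))}),
        [/\ is_V (brauer_omega F n) (conj_diagram rho) beta,
            injective phi,
            forall f, intertwiner beta (act (sumn rho)) f <-> exists x, phi x = f &
            forall Z x, Sp Z ->
              phi (r Z x) = (tensor_pow (sumn rho) Z \o phi x)%VF]].

(* Main.v *)
Require Import Defs.
From HB Require Import structures.
From mathcomp Require Import all_boot all_order all_algebra.
From mathcomp Require Import perm zify ring.
Set Implicit Arguments.
Unset Strict Implicit.
Unset Printing Implicit Defensive.
Import Order.TTheory GRing.Theory Num.Theory.
Local Open Scope ring_scope.

(** Write [N = 2 n], [om = - N] and [kappa = (om - 1) / 2].

    Diagrams.  A diagram is handled through the colourings of its two rows in which
    both ends of every edge get the same colour.  Summing over the colourings of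
    the middle row of two stacked diagrams counts one power of the number of
    colours for each closed loop ([count_labelings]), and with enough colours a
    diagram is determined by its colourings ([coh_faithful]).  The associativity of
    the Brauer algebra and all its relations are thus verified by counting.

    Idempotents.  Let [E_U] be the idempotent of the first [m - 1] steps of a
    tableau, [x] the last Jucys-Murphy element and [c_m] the last content.  The
    invariants carried along are in [tab_idem]; the main one is that [E_U] kills the
    diagrams with horizontal edges.  Modulo these diagrams [x] is [kappa] plus a sum
    of transpositions, which is diagonalizable because it acts on the diagrams by a
    real symmetric matrix ([JMs_semisimple]).  On a diagram with a horizontal edge
    at its last dot, [x] can be moved to the other end of the edge with the opposite
    sign, so that, next to [E_U], it is annihilated by the product of the [x + c_i]
    ([crossing_annihilated]).  Together this yields a polynomial that annihilates
    [E_U x] and has [c_m] as a simple root, provided that [c_i + c_m] never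
    vanishes.  This follows from the bound on the first row, since all contents are
    then at most [- 3 / 2].  Hence the resolvent has a simple pole, and [E_T] is the
    spectral projection of [x] inside [E_U] ([idem_spec]).

    Traces.  Up to sign the partial trace is the closure of the last strand.  The
    closure of [E_U / (u - x)] is a scalar multiple of [E_U]; sliding the last
    transposition and the last elementary diagram through the resolvent gives a
    recursion for this scalar ([resolvent_closure_step]), solved by the product
    [Ggen] over the contents.  The partial trace of [E_T] is its residue at [c_m]
    ([closure_residue]).  Over the boxes of a diagram this product telescopes along
    rows and columns and leaves one factor for each row above and each column to the
    left of the new box ([Ggen_residue]).  The same factors make up the ratio of the
    two dimension formulas ([D_ratio]): the hook lengths give the factors at the
    content, and the numerators those at its reflection [N + 1 + r - s].

    Dimensions.  Iterating the first part, the trace of [E_T], hence the dimension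
    of its image, is [D (lam')].  The multiplicity space consists of the
    intertwiners from [V_lam] to the tensor space, and evaluation at the basis vector
    [v_T] maps it injectively to the image of [E_T].  Conversely a vector [w] of this
    image extends to an intertwiner as soon as every [b] that kills [v_T] kills [w].
    This holds because [E_T] is primitive ([idem_primitive]) and because the group
    algebra of the symmetric group carries a positive definite form
    ([star_mul_eq0]): unless [b E_T = 0], the product [E_T b^* b E_T] is a nonzero
    multiple of [E_T], so that [b] does not kill [v_T]. *)

(** * Stacking of diagrams *)

Section Dihedral.
Variables (T : finType) (a b : T -> T).
Hypotheses (aK : involutive a) (bK : involutive b).

(** The orbits of two involutions are paths and cycles.  With [f = b \o a], the
    connected component of [p] is the [f]-orbit of [p], on which [a] and [b] act
    as the reflections [i |-> - i - 1] and [i |-> - i] modulo its length; together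
    they have two fixed points, one of which is [p]. *)
Lemma dihedral_ends (p : T) : b p = p -> a p != p ->
  exists q, [/\ q != p, connect [rel x y | (y == a x) || (y == b x)] p q,
    (a q == q) || (b q == q) &
    forall x, connect [rel x y | (y == a x) || (y == b x)] p x ->
      (a x == x) || (b x == x) -> x = p \/ x = q].
Proof.
move=> bp ap; set e := [rel x y | _]; pose f x := b (a x).
have injf : injective f by move=> x y /(inv_inj bK) /(inv_inj aK).
set L := order f p.
have L0 : (0 < L)%N by apply: order_gt0.
have fL : iter L f p = p by apply: iter_order.
have inj_it i j : (i < L)%N -> (j < L)%N -> iter i f p = iter j f p -> i = j.
  by move=> iL jL eij; rewrite -(findex_iter iL) -(findex_iter jL) eij.
have bit i : (i <= L)%N -> b (iter i f p) = iter (L - i) f p.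
  elim: i => [_|i IH iL]; first by rewrite subn0 fL.
  rewrite iterS /f bK; apply: injf; rewrite {1}/f aK IH 1?ltnW //.
  by rewrite -iterS subnSK.
have ait i : (i < L)%N -> a (iter i f p) = iter (L - i.+1) f p.
  by move=> iL; rewrite -bit // iterS /f bK.
have ex : forall x, connect e p x -> exists2 i, (i < L)%N & x = iter i f p.
  move=> x /connectP[s]; elim/last_ind: s x => [|s y IH] x /=.
    by move=> _ ->; exists 0%N.
  rewrite rcons_path last_rcons => /andP[ps es] ->.
  have [i iL li] := IH _ ps erefl.
  move: es; rewrite li /= => /orP[/eqP->|/eqP->].
    by exists (L - i.+1)%N; [lia | rewrite ait].
  case: i iL {li} => [|i] iL; first by exists 0%N.
  by exists (L - i.+1)%N; [lia | rewrite bit // ltnW].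
have cn i : connect e p (iter i f p).
  elim: i => [|i IH]; first exact: connect0.
  apply: (connect_trans IH); apply: (@connect_trans _ _ (a (iter i f p))).
    by apply: connect1; rewrite /= eqxx.
  by apply: connect1; rewrite /= eqxx orbT.
have L1 : (1 < L)%N.
  rewrite ltnNge; apply/negP => Lle; have L1 : L = 1%N by apply/eqP; rewrite eqn_leq Lle.
  by move: (ait 0%N L0); rewrite L1 /= => h; rewrite h eqxx in ap.
have hL : (L./2 < L)%N by lia.
exists (iter L./2 f p); split=> //.
- apply/eqP => h; have := inj_it _ 0%N hL L0 h => /eqP; rewrite -leqn0.
  by rewrite leqNgt half_gt0 L1.
- case: (boolP (odd L)) => oL; apply/orP; [left|right].
    by rewrite ait //; apply/eqP; congr (iter _ f p); lia.
  by rewrite bit 1?ltnW //; apply/eqP; congr (iter _ f p); lia.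
move=> x /ex[i iL ->] /orP[/eqP|/eqP].
  rewrite ait // => /inj_it h; right; congr (iter _ f p).
  have e2 : (L - i.+1)%N = i by apply: h => //; lia.
  lia.
case: i iL => [|i] iL; first by left.
rewrite bit 1?ltnW // => /inj_it h; right; congr (iter _ f p).
have e2 : (L - i.+1)%N = i.+1 by apply: h => //; lia.
lia.
Qed.
End Dihedral.

Section Stacking.
Variable m : nat.
Implicit Types (d : diagram m) (p q : dot m) (x y : dot3 m).

Lemma mateK d : involutive d.
Proof. by case: d => f /= fP p; have /forallP/(_ p)/andP[/eqP] := fP. Qed.

Lemma mate_neq d p : d p != p.
Proof. by case: d => f /= fP; have /forallP/(_ p)/andP[] := fP. Qed.

Lemma diagramP d d' : (forall p, d p = d' p) -> d = d'.
Proof. by move=> h; apply/val_inj/ffunP. Qed.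

Variables d1 d2 : diagram m.

(** The stacked diagram is generated by two involutions of the three rows of dots,
    one for each of the two diagrams; a dot of the row that a diagram does not
    reach is fixed. *)
Definition up_step x : dot3 m :=
  match x with inl p => inl (d1 p) | inr j => inr j end.

Definition low_step x : dot3 m :=
  match x with
  | inl (inl i) => inl (inl i)
  | inl (inr i) => lower (d2 (inl i))
  | inr j => lower (d2 (inr j)) end.

Lemma upperE p : upper p = inl p. Proof. by case: p. Qed.

Lemma low_stepE p : low_step (lower p) = lower (d2 p).
Proof. by case: p. Qed.

Lemma up_stepK : involutive up_step.
Proof. by case=> [p|j] //=; rewrite mateK. Qed.

Lemma low_stepK : involutive low_step.
Proof. by case=> [[i|i]|j] //=; rewrite low_stepE mateK. Qed.

Lemma stack_connect :
  connect (stack d1 d2) =2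
  connect [rel x y | (y == up_step x) || (y == low_step x)].
Proof.
move=> x y; apply/idP/idP; apply: connect_sub => {x y} x y /=.
  case/orP => /existsP[p /andP[/eqP-> /eqP->]]; apply: connect1 => /=.
    by rewrite !upperE /= eqxx.
  by rewrite low_stepE eqxx orbT.
case/orP => /eqP->.
  case: x => [p|j] /=; last exact: connect0.
  by apply/connect1/orP; left; apply/existsP; exists p; rewrite !upperE !eqxx.
case: x => [[i|i]|j] /=; first exact: connect0.
  by apply/connect1/orP; right; apply/existsP; exists (inl i); rewrite !eqxx.
by apply/connect1/orP; right; apply/existsP; exists (inr j); rewrite !eqxx.
Qed.

Lemma stack_sym : connect_sym (stack d1 d2).
Proof.
suff h x y : stack d1 d2 x y -> stack d1 d2 y x.
  by apply: sym_connect_sym => x y; apply/idP/idP; apply: h.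
case/orP=> /existsP[p /andP[/eqP-> /eqP->]]; apply/orP.
  by left; apply/existsP; exists (d1 p); rewrite mateK !eqxx.
by right; apply/existsP; exists (d2 p); rewrite mateK !eqxx.
Qed.

Lemma outer_fixed x :
  (up_step x == x) || (low_step x == x) -> exists q, x = outer q.
Proof.
case: x => [[i|i]|j] /=; [by exists (inl i) | | by exists (inr j)].
case/orP => [/eqP[h]|]; first by have := mate_neq d1 (inr i); rewrite h eqxx.
have := mate_neq d2 (inl i); case: (d2 (inl i)) => // k /= kN /eqP[ki].
by rewrite ki eqxx in kN.
Qed.

(** An outer dot is the end of an open path of the stacked diagram, whose only
    other end is again an outer dot: this is why diagrams can be multiplied. *)
Lemma stack_ends p :
  exists q, [/\ q != p, connect (stack d1 d2) (outer p) (outer q) &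
    forall q', connect (stack d1 d2) (outer p) (outer q') -> q' = p \/ q' = q].
Proof.
have outer_inj : injective (@outer m) by move=> [i|i] [j|j] // [->].
have fixo q : (up_step (outer q) == outer q) || (low_step (outer q) == outer q).
  by case: q => i /=; rewrite !eqxx // orbT.
suff [x [xp cx fx ux]] : exists x, [/\ x != outer p,
    connect [rel x y | (y == up_step x) || (y == low_step x)] (outer p) x,
    (up_step x == x) || (low_step x == x) &
    forall y, connect [rel x y | (y == up_step x) || (y == low_step x)]
      (outer p) y -> (up_step y == y) || (low_step y == y) ->
      y = outer p \/ y = x].
  have [q xq] := outer_fixed fx; subst x; exists q; split.
  - by apply: contra xp => /eqP->.
  - by rewrite stack_connect.
  - by move=> q'; rewrite stack_connect => /ux /(_ (fixo _)) [] /outer_inj; auto.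
case: p => i /=.
  apply: (dihedral_ends up_stepK low_stepK) => //=.
  apply/eqP => -[h]; have := mate_neq d1 (inl i).
  by rewrite h eqxx.
have hb : low_step (inr i) != inr i.
  rewrite /=; have := mate_neq d2 (inr i); case: (d2 (inr i)) => [k|k] kN //.
have [x [xp cx fx ux]] := dihedral_ends low_stepK up_stepK (erefl : up_step (inr i) = inr i) hb.
have eqc : connect [rel x y | (y == low_step x) || (y == up_step x)]
    =2 connect [rel x y | (y == up_step x) || (y == low_step x)].
  by apply: eq_connect => u v /=; rewrite orbC.
exists x; split=> //; first by rewrite -eqc.
  by rewrite orbC.
by move=> y; rewrite -eqc orbC; apply: ux.
Qed.

Definition comp_fun : {ffun dot m -> dot m} :=
  [ffun p => odflt p [pick q | (q != p) && connect (stack d1 d2) (outer p) (outer q)]].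

Lemma comp_funP p : [/\ comp_fun p != p,
  connect (stack d1 d2) (outer p) (outer (comp_fun p)) &
  forall q, connect (stack d1 d2) (outer p) (outer q) -> q = p \/ q = comp_fun p].
Proof.
have [q [qp cq uq]] := stack_ends p.
suff -> : comp_fun p = q by [].
rewrite ffunE; case: pickP => [q' /andP[q'p /uq[] // e]|/(_ q)].
  by rewrite e eqxx in q'p.
by rewrite qp cq.
Qed.

Lemma comp_subproof : [forall p, (comp_fun (comp_fun p) == p) && (comp_fun p != p)].
Proof.
apply/forallP => p; have [np cp _] := comp_funP p; rewrite np andbT.
have [_ _ u] := comp_funP (comp_fun p).
have: connect (stack d1 d2) (outer (comp_fun p)) (outer p) by rewrite stack_sym.
by move/u => [h|<-] //; rewrite -h eqxx in np.
Qed.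

Definition dcomp : diagram m := Diagram comp_subproof.

Lemma dcomp_connect p q :
  connect (stack d1 d2) (outer p) (outer q) = (q == p) || (q == dcomp p).
Proof.
have [_ c u] := comp_funP p; apply/idP/orP => [/u[->|->]|[/eqP->|/eqP->]] //.
  by left.
by right.
Qed.

Lemma stacks_toE d : stacks_to d1 d2 d = (d == dcomp).
Proof.
apply/forallP/eqP => [h|-> p]; last by rewrite dcomp_connect eqxx orbT.
apply: diagramP => p; have := h p; rewrite dcomp_connect => /orP[/eqP e|/eqP//].
by have := mate_neq d p; rewrite e eqxx.
Qed.

End Stacking.

(** * Colourings of diagrams *)

Section Labelings.
Variables (m N : nat).
Implicit Types (d : diagram m) (p q : dot m) (I J K : {ffun 'I_m -> 'I_N.+1}).

Definition lab I J p : 'I_N.+1 := match p with inl i => I i | inr i => J i end.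

(** The edges of [d] join dots of the same colour when its rows are coloured by
    [I] and [J].  These are the matrix entries of [d] acting on the tensors over
    a space with an orthonormal basis of colours. *)
Definition coh d I J : bool := [forall p, lab I J p == lab I J (d p)].

Definition glue I K J (x : dot3 m) : 'I_N.+1 :=
  match x with inl (inl i) => I i | inl (inr i) => K i | inr i => J i end.

Lemma glue_outer I K J p : glue I K J (outer p) = lab I J p.
Proof. by case: p. Qed.

Lemma glue_upper I K J p : glue I K J (upper p) = lab I K p.
Proof. by case: p. Qed.

Lemma glue_lower I K J p : glue I K J (lower p) = lab K J p.
Proof. by case: p. Qed.

Variables d1 d2 : diagram m.
Local Notation S := (stack d1 d2).

Lemma coh_glue I K J : reflect (forall x y, connect S x y -> glue I K J x = glue I K J y)
   (coh d1 I K && coh d2 K J).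
Proof.
apply: (iffP andP) => [[/forallP c1 /forallP c2] x y|h].
  case/connectP => s ps ->; elim: s x ps => //= z s IH x /andP[xz /IH <-].
  case/orP: xz => /existsP[p /andP[/eqP-> /eqP->]].
    by rewrite !glue_upper; apply/eqP.
  by rewrite !glue_lower; apply/eqP.
split; apply/forallP => p; apply/eqP.
  rewrite -!(glue_upper _ _ J); apply/h/connect1/orP; left.
  by apply/existsP; exists p; rewrite !eqxx.
rewrite -!(glue_lower I); apply/h/connect1/orP; right.
by apply/existsP; exists p; rewrite !eqxx.
Qed.

Let A := [pred x | [forall p, ~~ connect S x (outer p)]].

Let A_connect x y : connect S x y -> A x = A y.
Proof.
move=> xy; apply: eq_forallb => p; congr negb; apply/idP/idP.
  by apply: connect_trans; rewrite (stack_sym d1 d2).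
exact: connect_trans.
Qed.

Let loop := {x : dot3 m | x \in predI (roots S) A}.

Let gen I J (h : {ffun loop -> 'I_N.+1}) (x : dot3 m) : 'I_N.+1 :=
  if insub (fingraph.root S x) is Some r then h r
  else if [pick p | connect S x (outer p)] is Some p then lab I J p else ord0.

Let Kof I J (h : {ffun loop -> 'I_N.+1}) : {ffun 'I_m -> 'I_N.+1} :=
  [ffun i => gen I J h (inl (inr i))].

Let lab_connect I J p q : coh (dcomp d1 d2) I J -> connect S (outer p) (outer q) ->
  lab I J p = lab I J q.
Proof.
move=> /forallP co; rewrite dcomp_connect => /orP[/eqP->//|/eqP->].
exact/eqP.
Qed.

Let gen_connect I J h x y : coh (dcomp d1 d2) I J -> connect S x y ->
  gen I J h x = gen I J h y.
Proof.
move=> co xy; have sym := @stack_sym _ d1 d2.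
rewrite /gen (fingraph.rootP sym xy); case: insubP => // _.
case: pickP => [p px|nx]; case: pickP => [q qy|ny] //.
- apply: lab_connect => //; rewrite sym in px; apply: connect_trans px _.
  exact: connect_trans xy qy.
- by have := ny p; rewrite sym in xy; rewrite (connect_trans xy px).
- by have := nx q; rewrite (connect_trans xy qy).
Qed.

Let gen_outer I J h p : coh (dcomp d1 d2) I J -> gen I J h (outer p) = lab I J p.
Proof.
move=> co; rewrite /gen; case: insubP => [r|_].
  rewrite /= inE /= => /andP[_ /forallP/(_ p)].
  by rewrite stack_sym connect_root.
case: pickP => [q pq|/(_ p)]; last by rewrite connect0.
by apply/esym/lab_connect.
Qed.

Let glue_gen I J h x : coh (dcomp d1 d2) I J -> glue I (Kof I J h) J x = gen I J h x.
Proof.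
move=> co; case: x => [[i|i]|i] /=; rewrite ?ffunE //.
  by rewrite (@gen_outer I J h (inl i)).
by rewrite (@gen_outer I J h (inr i)).
Qed.

(** A compatible colouring of the middle row is forced on the open paths of the
    stacked diagram and is free on each closed loop. *)
Lemma count_labelings I J :
  (\sum_K (coh d1 I K : nat) * (coh d2 K J : nat) =
   N.+1 ^ loops d1 d2 * coh (dcomp d1 d2) I J)%N.
Proof.
have sym := @stack_sym _ d1 d2.
under eq_bigr do rewrite mulnb.
rewrite -big_mkcond /= sum1dep_card.
case: (boolP (coh (dcomp d1 d2) I J)) => co; last first.
  rewrite muln0; apply/eqP; rewrite cards_eq0; apply/eqP/setP => K; rewrite !inE.
  apply: contraNF co => /coh_glue h; apply/forallP => p; apply/eqP.
  rewrite -!(glue_outer I K J); apply: h.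
  by rewrite dcomp_connect eqxx orbT.
rewrite muln1.
have -> : [set K | coh d1 I K && coh d2 K J] = [set Kof I J h | h in setT].
  apply/setP => K; rewrite inE; apply/idP/imsetP => [/coh_glue h|[h _ ->]].
    exists [ffun r : loop => glue I K J (val r)] => //.
    apply/ffunP => i; rewrite ffunE /gen; case: insubP => [r rP rE|nr].
      by rewrite ffunE rE; apply: (h (inl (inr i))); exact: connect_root.
    case: pickP => [p ip|nP].
      by rewrite -(glue_outer I K J); exact: (h (inl (inr i)) _ ip).
    have Ar : A (fingraph.root S (inl (inr i))).
      rewrite -(A_connect (connect_root _ _)).
      by apply/forallP => p; rewrite nP.
    by case/negP: nr; apply/andP; split; [apply: roots_root|].
  apply/coh_glue => x y xy; rewrite !glue_gen //; exact: gen_connect.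
rewrite card_imset; last first.
  move=> h h' /ffunP e; apply/ffunP => r.
  have rr : h r = gen I J h (val r).
    have := valP r; rewrite inE /= => /andP[/eqP ro _].
    by rewrite /gen ro valK.
  have rr' : h' r = gen I J h' (val r).
    have := valP r; rewrite inE /= => /andP[/eqP ro _].
    by rewrite /gen ro valK.
  rewrite rr rr'; case: (val r) (valP r) => [[i|i]|i].
  - rewrite inE /= => /andP[_ /forallP/(_ (inl i))]; by rewrite connect0.
  - by move=> _; have := e i; rewrite !ffunE.
  - rewrite inE /= => /andP[_ /forallP/(_ (inr i))]; by rewrite connect0.
rewrite cardsT card_ffun card_ord card_sig.
by congr (_ ^ _)%N; rewrite /loops /n_comp_mem; apply: eq_card => x.
Qed.

End Labelings.

Section Faithful.
Variable m : nat.
Implicit Types (d : diagram m) (p q : dot m).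

(** Enough colours for the edges of a diagram to get distinct colours. *)
Definition Ncol := (m + m).+1.
Definition coloring := {ffun 'I_m -> 'I_Ncol.+1}.

Definition edge_color d p : 'I_Ncol.+1 := inord (minn (enum_rank p) (enum_rank (d p))).

Lemma edge_colorP d p q : edge_color d p = edge_color d q -> q = p \/ q = d p.
Proof.
have b r : (minn (enum_rank r) (enum_rank (d r)) < Ncol.+1)%N.
  apply: (leq_ltn_trans (geq_minl _ _)); apply: (leq_trans (ltn_ord _)).
  by rewrite card_sum !card_ord /Ncol; lia.
move/(congr1 (@nat_of_ord _)); rewrite !inordK //=.
rewrite /minn; case: ifP => _; case: ifP => _ /val_inj /enum_rank_inj.
- by left.
- by move=> ->; right; rewrite mateK.
- by move=> <-; right.
- by move/(can_inj (mateK d)) => ->; left.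
Qed.

(** Colour each edge of [d] with its own colour: a diagram compatible with this
    colouring has the edges of [d]. *)
Lemma coh_faithful d d' a b :
  (forall I J : coloring, Ncol.+1 ^ a * coh d I J = Ncol.+1 ^ b * coh d' I J)%N ->
  d = d' /\ a = b.
Proof.
move=> h.
(* The two ends of an edge share the smaller of their ranks as a colour. *)
pose I : coloring := [ffun i => edge_color d (inl i)].
pose J : coloring := [ffun i => edge_color d (inr i)].
have labE p : lab I J p = edge_color d p by case: p => i; rewrite /= ffunE.
have ci : coh d I J.
  apply/forallP => p; rewrite !labE /edge_color; apply/eqP; congr inord.
  by rewrite mateK minnC.
have := h I J; rewrite ci muln1; case: (boolP (coh d' I J)) => c'; last first.
  by rewrite muln0 => /eqP; rewrite expn_eq0.
rewrite muln1 => /eqP; rewrite eqn_exp2l // => /eqP; split=> //.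
apply: diagramP => p; have := forallP c' p; rewrite !labE => /eqP /edge_colorP.
by case=> // e; have := mate_neq d' p; rewrite e eqxx.
Qed.

(** Both sides count the colourings of the two inner rows of three stacked
    diagrams. *)
Lemma dcompA d1 d2 d3 :
  dcomp (dcomp d1 d2) d3 = dcomp d1 (dcomp d2 d3) /\
  (loops d1 d2 + loops (dcomp d1 d2) d3 =
   loops d2 d3 + loops d1 (dcomp d2 d3))%N.
Proof.
apply: coh_faithful => I J.
transitivity (\sum_(K : coloring) \sum_(L : coloring)
    coh d1 I K * (coh d2 K L * coh d3 L J))%N.
  rewrite expnD -mulnA -count_labelings big_distrr /= exchange_big.
  apply: eq_bigr => L _; rewrite mulnA -count_labelings big_distrl /=.
  by apply: eq_bigr => K _; rewrite mulnA.
rewrite expnD -mulnA -count_labelings big_distrr /=; apply: eq_bigr => K _.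
by rewrite -big_distrr /= count_labelings mulnCA mulnA.
Qed.

(** Counting colourings reduces identities between products of diagrams, loops
    included, to identities between sums over the colourings of a row. *)
Lemma dcomp_eq d1 d2 d1' d2' :
  (forall I J : coloring, \sum_(K : coloring) coh d1 I K * coh d2 K J =
    \sum_(K : coloring) coh d1' I K * coh d2' K J)%N ->
  dcomp d1 d2 = dcomp d1' d2' /\ loops d1 d2 = loops d1' d2'.
Proof. by move=> h; apply: coh_faithful => I J; rewrite -!count_labelings. Qed.

Lemma dcomp_spec d1 d2 d l :
  (forall I J : coloring, \sum_(K : coloring) coh d1 I K * coh d2 K J =
     Ncol.+1 ^ l * coh d I J)%N ->
  dcomp d1 d2 = d /\ loops d1 d2 = l.
Proof. by move=> h; apply: coh_faithful => I J; rewrite -count_labelings. Qed.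

End Faithful.

(** * Permutation diagrams, elementary diagrams, the flip *)

Section PermDiagrams.
Variable m : nat.

Definition permd_fun (s : {perm 'I_m}) : {ffun dot m -> dot m} :=
  [ffun p => match p with inl i => inr (s i) | inr j => inl ((s^-1)%g j) end].

Lemma permd_subproof s : [forall p, (permd_fun s (permd_fun s p) == p) && (permd_fun s p != p)].
Proof.
by apply/forallP => -[i|i]; rewrite !ffunE /= ?permK ?permKV eqxx.
Qed.

Definition permd s : diagram m := Diagram (permd_subproof s).

Lemma coh_permd s N (I J : {ffun 'I_m -> 'I_N.+1}) :
  coh (permd s) I J = [forall i, I i == J (s i)].
Proof.
apply/forallP/forallP => h.
  by move=> i; have := h (inl i); rewrite /= ffunE.
by case=> i; rewrite /= ffunE //=; have := h ((s^-1)%g i); rewrite permKV eq_sym.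
Qed.

Definition eps_fun (a b : 'I_m) : {ffun dot m -> dot m} :=
  [ffun p => match p with
   | inl i => if i == a then inl b else if i == b then inl a else inr i
   | inr i => if i == a then inr b else if i == b then inr a else inl i end].

Lemma eps_subproof a b : a != b -> [forall p, (eps_fun a b (eps_fun a b p) == p) && (eps_fun a b p != p)].
Proof.
move=> ab; have ba : b != a by rewrite eq_sym.
have inlN (x y : 'I_m) : x != y -> (inl x : dot m) != inl y.
  by apply: contra => /eqP[->].
have inrN (x y : 'I_m) : x != y -> (inr x : dot m) != inr y.
  by apply: contra => /eqP[->].
apply/forallP => -[i|i]; rewrite !ffunE.
  case: (eqVneq i a) => [->|ia]; first by rewrite (negPf ba) !eqxx inlN.
  case: (eqVneq i b) => [->|ib]; first by rewrite !eqxx inlN.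
  by rewrite (negPf ia) (negPf ib) eqxx.
case: (eqVneq i a) => [->|ia]; first by rewrite (negPf ba) !eqxx inrN.
case: (eqVneq i b) => [->|ib]; first by rewrite !eqxx inrN.
by rewrite (negPf ia) (negPf ib) eqxx.
Qed.

Definition epsd a b (ab : a != b) : diagram m := Diagram (eps_subproof ab).

Lemma coh_epsd a b (ab : a != b) N (I J : {ffun 'I_m -> 'I_N.+1}) :
  coh (epsd ab) I J = [&& I a == I b, J a == J b &
    [forall i, (i != a) && (i != b) ==> (I i == J i)]].
Proof.
apply/forallP/and3P => [h|[/eqP ha /eqP hb /forallP h]].
  split; first by have := h (inl a); rewrite /= ffunE eqxx.
    by have := h (inr a); rewrite /= ffunE eqxx.
  apply/forallP => i; apply/implyP => /andP[/negPf ia /negPf ib].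
  by have := h (inl i); rewrite /= ffunE ia ib.
case=> i; rewrite /= ffunE; (case: (eqVneq i a) => [->|ia] /=; first by rewrite ?ha ?hb);
  (case: (eqVneq i b) => [->|ib] /=; first by rewrite ?ha ?hb).
  by have := h i; rewrite ia ib.
by have := h i; rewrite ia ib eq_sym.
Qed.

Definition dflip_dot (p : dot m) : dot m :=
  match p with inl i => inr i | inr i => inl i end.

Lemma dflip_dotK : involutive dflip_dot. Proof. by case. Qed.

Definition flip_fun (d : diagram m) : {ffun dot m -> dot m} :=
  [ffun p => dflip_dot (d (dflip_dot p))].

Lemma flip_subproof d : [forall p, (flip_fun d (flip_fun d p) == p) && (flip_fun d p != p)].
Proof.
apply/forallP => p; rewrite !ffunE !dflip_dotK mateK dflip_dotK eqxx /=.
by rewrite (inv_eq dflip_dotK) mate_neq.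
Qed.

Definition dflip d : diagram m := Diagram (flip_subproof d).

Lemma dflipK : involutive dflip.
Proof. by move=> d; apply: diagramP => p; rewrite !ffunE !dflip_dotK. Qed.

Lemma coh_dflip d N (I J : {ffun 'I_m -> 'I_N.+1}) :
  coh (dflip d) I J = coh d J I.
Proof.
have e p : lab J I p = lab I J (dflip_dot p) by case: p.
apply/forallP/forallP => h p; have := h (dflip_dot p).
  by rewrite ffunE !e !dflip_dotK.
by rewrite ffunE !e !dflip_dotK.
Qed.

Lemma dcomp_flip d1 d2 : dcomp (dflip d2) (dflip d1) = dflip (dcomp d1 d2) /\
  loops (dflip d2) (dflip d1) = loops d1 d2.
Proof.
apply: dcomp_spec => I J; rewrite coh_dflip -count_labelings.
by apply: eq_bigr => K _; rewrite !coh_dflip mulnC.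
Qed.

End PermDiagrams.

(** * The Brauer algebra as a ring *)

(** A copy of [brauer F m] that remembers the parameter, so that it can carry the
    multiplication. *)
Definition Br (F : fieldType) (om : F) (m : nat) := brauer F m.

HB.instance Definition _ (F : fieldType) (om : F) (m : nat) :=
  GRing.Lmodule.copy (Br om m) (brauer F m).

Section BrauerRing.
Variables (F : fieldType) (om : F) (m : nat).
Local Notation B := (Br om m).
Implicit Types (x y z : B) (d : diagram m).

Definition bd d : B := [ffun d' => (d' == d)%:R].

Definition bprod x y : B := bmul om x y.

Lemma bprodE x y : bprod x y =
  \sum_d1 \sum_d2 ((x d1 : F) * y d2 * om ^+ loops d1 d2) *: bd (dcomp d1 d2).
Proof.
apply/ffunP => d; rewrite ffunE sum_ffunE; apply: eq_bigr => d1 _.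
rewrite sum_ffunE big_mkcond; apply: eq_bigr => d2 _.
rewrite !ffunE stacks_toE; case: (_ == _); first by rewrite /GRing.scale /= mulr1.
by rewrite /GRing.scale /= mulr0.
Qed.

Lemma bd_sum x : x = \sum_d (x d : F) *: bd d.
Proof.
apply/ffunP => d; rewrite sum_ffunE (bigD1 d) //= !ffunE eqxx big1 ?addr0.
  by rewrite /GRing.scale /= mulr1.
by move=> d' /negPf dd'; rewrite !ffunE eq_sym dd' /GRing.scale /= mulr0.
Qed.

Lemma bprodDl : left_distributive bprod +%R.
Proof.
move=> x y z; apply/ffunP => d; rewrite !ffunE -big_split; apply: eq_bigr => d1 _.
by rewrite -big_split; apply: eq_bigr => d2 _ /=; rewrite ffunE !mulrDl.
Qed.

Lemma bprodDr : right_distributive bprod +%R.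
Proof.
move=> x y z; apply/ffunP => d; rewrite !ffunE -big_split; apply: eq_bigr => d1 _.
by rewrite -big_split; apply: eq_bigr => d2 _ /=; rewrite ffunE mulrDr mulrDl.
Qed.

Lemma bprodZl a x y : bprod (a *: x) y = a *: bprod x y.
Proof.
apply/ffunP => d; rewrite !ffunE /GRing.scale /= mulr_sumr; apply: eq_bigr => d1 _.
by rewrite mulr_sumr; apply: eq_bigr => d2 _; rewrite ffunE /GRing.scale /= !mulrA.
Qed.

Lemma bprodZr a x y : bprod x (a *: y) = a *: bprod x y.
Proof.
apply/ffunP => d; rewrite !ffunE /GRing.scale /= mulr_sumr; apply: eq_bigr => d1 _.
rewrite mulr_sumr; apply: eq_bigr => d2 _; rewrite ffunE /GRing.scale /= !mulrA.
by rewrite [a * _]mulrC.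
Qed.

Lemma bd_ind (P : B -> Prop) : P 0 -> (forall d, P (bd d)) ->
  (forall (a : F) x y, P x -> P y -> P (a *: x + y)) -> forall x, P x.
Proof.
move=> P0 Pd PD x; rewrite (bd_sum x).
elim: (index_enum _) => [|d s IH]; first by rewrite big_nil.
by rewrite big_cons; apply: PD.
Qed.

Lemma bprod0l x : bprod 0 x = 0.
Proof. by rewrite -[X in bprod X](scale0r 0) bprodZl scale0r. Qed.

Lemma bprod0r x : bprod x 0 = 0.
Proof. by rewrite -[X in bprod _ X](scale0r 0) bprodZr scale0r. Qed.

Lemma bprod_bd d1 d2 : bprod (bd d1) (bd d2) = om ^+ loops d1 d2 *: bd (dcomp d1 d2).
Proof.
rewrite bprodE (bigD1 d1) //= [X in _ + X]big1 ?addr0; last first.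
  move=> d /negPf dd; rewrite big1 // => d' _.
  by rewrite /bd ffunE dd !mul0r scale0r.
rewrite (bigD1 d2) //= [X in _ + X]big1 ?addr0; last first.
  by move=> d /negPf dd; rewrite /bd !ffunE dd mulr0 !mul0r scale0r.
by rewrite /bd !ffunE !eqxx !mul1r.
Qed.

Lemma bprodA : associative bprod.
Proof.
move=> x y z; elim/bd_ind: x => [|d1|a x x' ex ex']; rewrite ?bprod0l //; last first.
  by rewrite !(bprodDl, bprodZl) ex ex'.
elim/bd_ind: y => [|d2|a y y' ey ey']; rewrite ?(bprod0l, bprod0r) //; last first.
  by rewrite !(bprodDl, bprodZl, bprodDr, bprodZr) ey ey'.
elim/bd_ind: z => [|d3|a z z' ez ez']; rewrite ?bprod0r //; last first.
  by rewrite !(bprodDr, bprodZr) ez ez'.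
rewrite !bprod_bd bprodZl bprodZr !bprod_bd !scalerA -!exprD.
by have [-> ->] := dcompA d1 d2 d3.
Qed.

End BrauerRing.

Section BrauerUnit.
Variables (F : fieldType) (om : F) (m : nat).
Local Notation B := (Br om m).

Lemma boneE : bone F m = bd om (permd 1).
Proof.
apply/ffunP => d; rewrite !ffunE; congr (_ %:R); congr nat_of_bool.
apply/forallP/eqP => [h|-> i]; last by rewrite ffunE perm1.
apply: diagramP => -[i|i]; rewrite ffunE ?invg1 perm1; first exact/eqP.
by rewrite -(eqP (h i)) mateK.
Qed.

Lemma sum_permd1 N (I J : {ffun 'I_m -> 'I_N.+1}) : coh (permd 1) I J = (I == J).
Proof.
rewrite coh_permd; apply/forallP/eqP => [h|-> i]; last by rewrite perm1.
by apply/ffunP => i; apply/eqP; have := h i; rewrite perm1.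
Qed.

Lemma dcomp1d (d : diagram m) : dcomp (permd 1) d = d /\ loops (permd 1) d = 0%N.
Proof.
apply: dcomp_spec => I J; rewrite (bigD1 I) //= big1 ?addn0 ?sum_permd1 ?eqxx ?mul1n //.
by move=> K /negPf KI; rewrite sum_permd1 eq_sym KI.
Qed.

Lemma dcompd1 (d : diagram m) : dcomp d (permd 1) = d /\ loops d (permd 1) = 0%N.
Proof.
apply: dcomp_spec => I J; rewrite (bigD1 J) //= big1 ?addn0 ?sum_permd1 ?eqxx ?mul1n ?muln1 //.
by move=> K /negPf KI; rewrite sum_permd1 KI muln0.
Qed.

Let B1 : B := bone F m.

Lemma bprod1l : left_id B1 (@bprod F om m).
Proof.
move=> x; rewrite /B1 boneE; elim/bd_ind: x => [|d|a x y ex ey].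
- by rewrite bprod0r.
- by rewrite bprod_bd; have [-> ->] := dcomp1d d; rewrite scale1r.
by rewrite bprodDr bprodZr ex ey.
Qed.

Lemma bprod1r : right_id B1 (@bprod F om m).
Proof.
move=> x; rewrite /B1 boneE; elim/bd_ind: x => [|d|a x y ex ey].
- by rewrite bprod0l.
- by rewrite bprod_bd; have [-> ->] := dcompd1 d; rewrite scale1r.
by rewrite bprodDl bprodZl ex ey.
Qed.

Lemma bone_neq0 : B1 != 0.
Proof.
rewrite /B1 boneE; apply/eqP => /ffunP/(_ (permd 1)); rewrite !ffunE eqxx => /eqP.
by rewrite oner_eq0.
Qed.

HB.instance Definition _ := GRing.Zmodule_isNzRing.Build B (@bprodA F om m)
  bprod1l bprod1r (@bprodDl F om m) (@bprodDr F om m) bone_neq0.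

Lemma bscaleAl (a : F) (x y : B) : a *: (x * y) = a *: x * y.
Proof. by rewrite /GRing.mul /= bprodZl. Qed.

Lemma bscaleAr (a : F) (x y : B) : a *: (x * y) = x * (a *: y).
Proof. by rewrite /GRing.mul /= bprodZr. Qed.

HB.instance Definition _ := GRing.Lmodule_isLalgebra.Build F B bscaleAl.
HB.instance Definition _ := GRing.Lalgebra_isAlgebra.Build F B bscaleAr.

Lemma bmulE (x y : B) : bmul om x y = x * y. Proof. by []. Qed.

Lemma one_bd : 1 = bd om (permd 1) :> B. Proof. by rewrite -boneE. Qed.

Lemma bd_mul d1 d2 : bd om d1 * bd om d2 = om ^+ loops d1 d2 *: bd om (dcomp d1 d2).
Proof. exact: bprod_bd. Qed.

Lemma bd_mul_eq d1 d2 d1' d2' :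
  (forall I J : coloring m, \sum_(K : coloring m) coh d1 I K * coh d2 K J =
    \sum_(K : coloring m) coh d1' I K * coh d2' K J)%N ->
  bd om d1 * bd om d2 = bd om d1' * bd om d2'.
Proof. by move=> h; rewrite !bd_mul; have [-> ->] := dcomp_eq h. Qed.

Lemma bd_mul_spec d1 d2 d l :
  (forall I J : coloring m, \sum_(K : coloring m) coh d1 I K * coh d2 K J =
     (Ncol m).+1 ^ l * coh d I J)%N ->
  bd om d1 * bd om d2 = om ^+ l *: bd om d.
Proof. by move=> h; rewrite bd_mul; have [-> ->] := dcomp_spec h. Qed.

End BrauerUnit.

(** * Relations between diagrams *)

Section Relations.
Variables (F : fieldType) (om : F) (m : nat).
Local Notation B := (Br om m).
Implicit Types (s t : {perm 'I_m}) (d : diagram m) (a b c : 'I_m).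

Definition bperm s : B := bd om (permd s).
Definition beps' a b : B := beps F a b.

Definition permute_col s (I : coloring m) : coloring m := [ffun i => I (s i)].

Lemma coh_permd_l s d (I J : coloring m) :
  (\sum_(K : coloring m) coh (permd s) I K * coh d K J = coh d (permute_col s^-1 I) J)%N.
Proof.
rewrite (bigD1 (permute_col s^-1 I)) //= big1 ?addn0.
  rewrite coh_permd; case: forallP => [_|[]]; first by rewrite mul1n.
  by move=> i; rewrite ffunE permK.
move=> K /eqP nK; rewrite coh_permd; case: forallP => //= h; case: nK.
by apply/ffunP => i; rewrite ffunE; have := h (s^-1 i)%g; rewrite permKV => /eqP.
Qed.

Lemma coh_permd_r s d (I J : coloring m) :
  (\sum_(K : coloring m) coh d I K * coh (permd s) K J = coh d I (permute_col s J))%N.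
Proof.
rewrite (bigD1 (permute_col s J)) //= big1 ?addn0.
  rewrite coh_permd; case: forallP => [_|[]]; first by rewrite muln1.
  by move=> i; rewrite ffunE.
move=> K /eqP nK; rewrite coh_permd; case: forallP => //= h; last by rewrite muln0.
by case: nK; apply/ffunP => i; rewrite ffunE; apply/eqP.
Qed.

Lemma bpermM s t : bperm s * bperm t = bperm (s * t)%g.
Proof.
rewrite /bperm (@bd_mul_spec _ _ _ _ _ (permd (s * t)) 0) ?expr0 ?scale1r // => I J.
rewrite coh_permd_l mul1n !coh_permd; congr nat_of_bool.
apply/forallP/forallP => h i; last by have := h (s^-1 i)%g; rewrite !ffunE permM permKV.
by have := h (s i); rewrite ffunE permK permM.
Qed.

Lemma bperm1 : bperm 1 = 1. Proof. by rewrite one_bd. Qed.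

Lemma bsE a b : bs F a b = bperm (tperm a b).
Proof.
apply/ffunP => d; rewrite !ffunE; congr (_ %:R); congr nat_of_bool.
apply/forallP/eqP => [h|-> i]; last by rewrite ffunE.
apply: diagramP => -[i|i]; rewrite ffunE; first exact/eqP.
rewrite -{1}(permKV (tperm a b) i).
by rewrite -(eqP (h _)) mateK.
Qed.

Lemma bepsE a b (ab : a != b) : beps' a b = bd om (epsd ab).
Proof.
apply/ffunP => d; rewrite !ffunE; congr (_ %:R); congr nat_of_bool.
apply/and3P/eqP => [[/eqP h1 /eqP h2 /forallP h3]|->]; last first.
  rewrite !ffunE eqxx; split=> //; apply/forallP => i; apply/implyP.
  by move=> /andP[/negPf ia /negPf ib]; rewrite ffunE ia ib.
apply: diagramP => -[i|i]; rewrite ffunE;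
  case: (eqVneq i a) => [->|ia] //; case: (eqVneq i b) => [->|ib].
- by rewrite -h1 mateK.
- by have := h3 i; rewrite ia ib => /eqP.
- by rewrite -h2 mateK.
by have := h3 i; rewrite ia ib => /eqP <-; rewrite mateK.
Qed.

Lemma bepsC a b : beps' a b = beps' b a.
Proof.
case: (eqVneq a b) => [->//|ab]; have ba : b != a by rewrite eq_sym.
rewrite !bepsE; congr bd; apply: diagramP => -[i|i]; rewrite !ffunE.
  by case: (eqVneq i a) => // ->; rewrite (negPf ab).
by case: (eqVneq i a) => // ->; rewrite (negPf ab).
Qed.

Lemma beps_perm a b s : a != b ->
  beps' a b * bperm s = bperm s * beps' (s a) (s b).
Proof.
move=> ab; have sab : s a != s b by rewrite (inj_eq perm_inj).
rewrite !bepsE; apply: bd_mul_eq => I J; rewrite coh_permd_l coh_permd_r.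
congr nat_of_bool; rewrite !coh_epsd !ffunE !permK; congr [&& _, _ & _].
apply/forallP/forallP => h i.
  have := h (s^-1 i)%g; rewrite !ffunE permKV.
  by rewrite !(can2_eq (permKV s) (permK s)).
by have := h (s i); rewrite !ffunE permK !(inj_eq perm_inj).
Qed.

End Relations.

Section Edges.
Variable m : nat.
Implicit Types (d : diagram m) (a b c : 'I_m).

Definition recolor a b k (I : coloring m) : coloring m :=
  [ffun i => if (i == a) || (i == b) then k else I i].

(** The horizontal edge of the elementary diagram forces [I a = I b], and the
    opposite edge may get any colour. *)
Lemma sum_coh_epsd a b (ab : a != b) (I : coloring m) (f : coloring m -> nat) :
  (\sum_(K : coloring m) coh (epsd ab) I K * f K =
   (I a == I b) * \sum_k f (recolor a b k I))%N.
Proof.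
rewrite (partition_big (fun K : coloring m => K a) predT) //= big_distrr /=.
apply: eq_bigr => k _; rewrite (bigD1 (recolor a b k I)) /=; last by rewrite ffunE eqxx.
rewrite coh_epsd !ffunE !eqxx orbT /= eqxx.
have -> : [forall i, (i != a) && (i != b) ==> (I i == recolor a b k I i)].
  by apply/forallP => i; rewrite ffunE; case: eqP => //= _; case: eqP => /=.
rewrite !andbT big1 ?addn0 // => K /andP[/eqP Ka /eqP nK].
rewrite coh_epsd; case: (I a == I b) => //=; case: eqP => //= Kab.
case: forallP => //= h; case: nK; apply/ffunP => i; rewrite ffunE.
case: eqVneq => [->|ia] //=; case: eqVneq => [->|ib] /=; first by rewrite -Kab.
by have := h i; rewrite ia ib => /eqP.
Qed.

Lemma coh_recolor d a b k (I J : coloring m) : d (inl a) = inl b -> I a = I b ->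
  coh d (recolor a b k I) J = coh d I J.
Proof.
move=> dab Iab; have dba : d (inl b) = inl a by rewrite -dab mateK.
have e p : p != inl a -> p != inl b -> lab (recolor a b k I) J p = lab I J p.
  case: p => i //= ia ib; rewrite ffunE ifF //.
  by apply/negbTE; rewrite negb_or; apply/andP; split; [move: ia|move: ib]; apply: contra => /eqP->.
apply: eq_forallb => p; case: (eqVneq p (inl a)) => [->|pa].
  by rewrite dab /= !ffunE !eqxx orbT Iab !eqxx.
case: (eqVneq p (inl b)) => [->|pb]; first by rewrite dba /= !ffunE !eqxx orbT Iab !eqxx.
rewrite !e //; [apply: contra pb | apply: contra pa] => /eqP h.
  by rewrite -(mateK d p) h dab.
by rewrite -(mateK d p) h dba.
Qed.

Definition is_permd d : bool := [forall i, if d (inl i) is inr _ then true else false].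

Lemma is_permdP d : reflect (exists s, d = permd s) (is_permd d).
Proof.
apply: (iffP forallP) => [h|[s ->] i]; last by rewrite ffunE.
pose f i : 'I_m := if d (inl i) is inr j then j else i.
have fE i : d (inl i) = inr (f i) by have := h i; rewrite /f; case: (d (inl i)).
have fI : injective f.
  move=> i j ij; have /(can_inj (mateK d))[//] : d (inl i) = d (inl j).
  by rewrite !fE ij.
exists (perm fI); apply: diagramP => -[i|i]; rewrite ffunE; first by rewrite permE.
have {1}<- : f ((perm fI)^-1 i)%g = i by rewrite -(permE fI) permKV.
by rewrite -fE mateK.
Qed.

Lemma is_permd_permd s : is_permd (permd s).
Proof. by apply/is_permdP; exists s. Qed.

Lemma top_edge d : ~~ is_permd d -> exists a b, a != b /\ d (inl a) = inl b.
Proof.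
case/forallPn => a; case e: (d (inl a)) => [b|//] _; exists a, b; split=> //.
by apply/eqP => ab; have := mate_neq d (inl a); rewrite e ab eqxx.
Qed.

Lemma not_permd d a b : d (inl a) = inl b -> ~~ is_permd d.
Proof. by move=> e; apply/forallPn; exists a; rewrite e. Qed.

Lemma dflip_permd s : dflip (permd s) = permd (s^-1 : {perm 'I_m})%g.
Proof. by apply: diagramP => -[i|i]; rewrite !ffunE //= invgK. Qed.

Lemma is_permd_flip d : is_permd (dflip d) = is_permd d.
Proof.
apply/is_permdP/is_permdP => -[s e]; exists (s^-1)%g; rewrite -dflip_permd -e //.
by rewrite dflipK.
Qed.

Lemma dcomp_top d1 d2 a b : d1 (inl a) = inl b -> dcomp d1 d2 (inl a) = inl b.
Proof.
move=> e; have : connect (stack d1 d2) (outer (inl a)) (outer (inl b)).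
  apply/connect1/orP; left; apply/existsP; exists (inl a).
  by rewrite e !eqxx.
rewrite dcomp_connect => /orP[/eqP h|/eqP -> //].
by have := mate_neq d1 (inl a); rewrite e h eqxx.
Qed.

Lemma not_permd_compl d1 d2 : ~~ is_permd d1 -> ~~ is_permd (dcomp d1 d2).
Proof. by case/top_edge => a [b [_ /dcomp_top/not_permd]]; apply. Qed.

Lemma not_permd_compr d1 d2 : ~~ is_permd d2 -> ~~ is_permd (dcomp d1 d2).
Proof.
rewrite -is_permd_flip => /not_permd_compl h.
by rewrite -is_permd_flip -(dcomp_flip d1 d2).1 h.
Qed.

End Edges.

Section EdgeRelations.
Variables (F : fieldType) (om : F) (m : nat).
Local Notation B := (Br om m).
Local Notation bd := (@bd F om m).
Local Notation bperm := (@bperm F om m).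
Local Notation eps := (@beps' F om m).
Implicit Types (s t : {perm 'I_m}) (d : diagram m) (a b c : 'I_m) (x y : B).

(** The lower edge of the elementary diagram closes a loop with the edge of [d]. *)
Lemma eps_absorb d a b : a != b -> d (inl a) = inl b -> eps a b * bd d = om *: bd d.
Proof.
move=> ab dab; rewrite bepsE -[om]expr1; apply: bd_mul_spec => I J.
rewrite sum_coh_epsd expn1; case: eqP => Iab.
  rewrite mul1n; under eq_bigr do rewrite coh_recolor //.
  by rewrite sum_nat_const card_ord.
rewrite mul0n; case: (boolP (coh d I J)); last by rewrite muln0.
by move/forallP/(_ (inl a)); rewrite dab => /eqP.
Qed.

Lemma transp_absorb d a b : d (inl a) = inl b -> bperm (tperm a b) * bd d = bd d.
Proof.
move=> dab; have dba : d (inl b) = inl a by rewrite -dab mateK.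
rewrite -[RHS]scale1r -[1 in RHS](expr0 om); apply: bd_mul_spec => I J.
rewrite coh_permd_l tpermV mul1n; congr nat_of_bool.
case: (boolP (I a == I b)) => [/eqP Iab|Iab].
  have -> : permute_col (tperm a b) I = I => //.
  by apply/ffunP => i; rewrite ffunE; case: tpermP => [->|->|].
have -> : coh d I J = false.
  by apply: contraNF Iab => /forallP/(_ (inl a)); rewrite dab.
apply: contraNF Iab => /forallP/(_ (inl a)); rewrite dab /= !ffunE tpermL tpermR.
by rewrite eq_sym.
Qed.

(** Moving the end [c] of the top edge to [b] by a transposition or by connecting
    it through an elementary diagram gives the same diagram. *)
Lemma transp_eps d a b c : d (inl a) = inl c -> b != a -> b != c ->
  bperm (tperm b c) * bd d = eps a b * bd d.
Proof.
move=> dac ba bc; have ab : a != b by rewrite eq_sym.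
have ac : a != c.
  by apply/eqP => h; have := mate_neq d (inl a); rewrite dac h eqxx.
have ca : c != a by rewrite eq_sym.
have cb : c != b by rewrite eq_sym.
rewrite (bepsE _ ab); apply: bd_mul_eq => I J.
rewrite coh_permd_l tpermV sum_coh_epsd; case: eqP => Iab; last first.
  case: (boolP (coh _ _ _)) => // /forallP/(_ (inl a)).
  by rewrite dac /= !ffunE tpermR tpermD // => /eqP.
rewrite mul1n (bigD1 (I c)) //= big1 ?addn0.
  congr nat_of_bool; rewrite -(@coh_recolor _ d a c (I c)) //.
    congr coh; apply/ffunP => i; rewrite !ffunE.
    case: (eqVneq i a) => [->|ia] //=; case: (eqVneq i c) => [->|ic] /=.
      by rewrite (negPf cb).
    by case: (eqVneq i b) => [->|ib]; rewrite ?tpermL // tpermD // eq_sym.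
  by rewrite !ffunE tpermR tpermD // eq_sym.
move=> k kI; case: (boolP (coh _ _ _)) => // /forallP/(_ (inl a)).
by rewrite dac /= !ffunE eqxx /= (negPf ca) (negPf cb) (negPf kI).
Qed.

(** The anti-automorphism that exchanges the two rows of each diagram; it turns
    statements about left multiplication into statements about right
    multiplication. *)
Definition bflip x : B := [ffun d => x (dflip d)].

Lemma bflip_linear : linear bflip.
Proof. by move=> a x y; apply/ffunP => d; rewrite !ffunE. Qed.

HB.instance Definition _ := GRing.isLinear.Build F B B _ bflip bflip_linear.

Lemma bflip_bd d : bflip (bd d) = bd (dflip d).
Proof. by apply/ffunP => d'; rewrite !ffunE (inv_eq (@dflipK m)). Qed.

Lemma bflipM x y : bflip (x * y) = bflip y * bflip x.
Proof.
elim/bd_ind: x => [|d1|a x x' ex ex']; first by rewrite mul0r raddf0 mulr0.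
  elim/bd_ind: y => [|d2|a y y' ey ey']; first by rewrite mulr0 raddf0 mul0r.
    rewrite bd_mul linearZ /= !bflip_bd bd_mul.
    by have [-> ->] := dcomp_flip d1 d2.
  by rewrite mulrDr -scalerAr linearP /= ey ey' linearP /= mulrDl -scalerAl.
by rewrite mulrDl -scalerAl linearP /= ex ex' linearP /= mulrDr -scalerAr.
Qed.

Lemma bflipK : involutive bflip.
Proof. by move=> x; apply/ffunP => d; rewrite !ffunE dflipK. Qed.

Lemma bflip_perm s : bflip (bperm s) = bperm s^-1.
Proof. by rewrite bflip_bd dflip_permd. Qed.

Lemma bflip1 : bflip 1 = 1.
Proof. by rewrite -bperm1 bflip_perm invg1. Qed.

Lemma bflip_eps a b : bflip (eps a b) = eps a b.
Proof.
apply/ffunP => d; rewrite !ffunE; congr (_ %:R); congr nat_of_bool.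
rewrite andbCA; congr [&& _, _ & _].
- by rewrite (inv_eq (@dflip_dotK m)).
- by rewrite (inv_eq (@dflip_dotK m)).
apply: eq_forallb => i; congr (_ ==> _); rewrite ffunE.
by rewrite (inv_eq (@dflip_dotK m)) (inv_eq (mateK d)) eq_sym.
Qed.

End EdgeRelations.

(** * Jucys-Murphy elements *)

(** Locked: unification would otherwise unfold the sums. *)
HB.lock Definition JM (F : fieldType) (om : F) (m : nat) (b : 'I_m) : Br om m :=
  jm om b.

(** The Jucys-Murphy elements of the symmetric group. *)
HB.lock Definition JMs (F : fieldType) (om : F) (m : nat) (b : 'I_m) : Br om m :=
  \sum_(a < m | (a < b)%N) bperm om (tperm a b).

Section JucysMurphy.
Variables (F : fieldType) (om : F) (m : nat).
Local Notation B := (Br om m).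
Local Notation bd := (@bd F om m).
Local Notation bperm := (@bperm F om m).
Local Notation eps := (@beps' F om m).
Local Notation tr a b := (bperm (tperm a b)).
Implicit Types (s t : {perm 'I_m}) (d : diagram m) (a b c e : 'I_m) (x y : B).

Definition kappa : F := (om - 1) / 2.
Local Notation JM b := (@JM F om m b).
Local Notation JMs b := (@JMs F om m b).

Lemma JMsE b : JMs b = \sum_(a < m | (a < b)%N) tr a b.
Proof. by rewrite unlock. Qed.

Lemma JME b : JM b = kappa%:A + \sum_(a < m | (a < b)%N) (tr a b - eps a b).
Proof.
rewrite unlock /jm; congr (_ + _); apply: eq_bigr => a _.
by rewrite (bsE om).
Qed.

Lemma JM_JMs b : JM b = kappa%:A + JMs b - \sum_(a < m | (a < b)%N) eps a b.
Proof. by rewrite JME JMsE sumrB addrA. Qed.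

Lemma tr_conj a b s : tr a b * bperm s = bperm s * tr (s a) (s b).
Proof. by rewrite !bpermM -tpermJ /conjg !mulgA mulgV mul1g. Qed.

Lemma tr2 a b : tr a b * tr a b = 1.
Proof. by rewrite bpermM tperm2 bperm1. Qed.

Lemma trC a b : tr a b = tr b a. Proof. by rewrite tpermC. Qed.

Lemma bperm_eps a b s : a != b -> eps a b * bperm s = bperm s * eps (s a) (s b).
Proof. exact: beps_perm. Qed.

Lemma tr_eps a b : a != b -> tr a b * eps a b = eps a b.
Proof. by move=> ab; rewrite bepsE transp_absorb // ffunE eqxx. Qed.

Lemma eps_tr a b : a != b -> eps a b * tr a b = eps a b.
Proof.
by move=> ab; rewrite bperm_eps // tpermL tpermR bepsC tr_eps.
Qed.

Lemma tr_eps_eps a b c : a != c -> b != a -> b != c -> tr b c * eps a c = eps a b * eps a c.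
Proof. by move=> ac ba bc; rewrite [eps a c]bepsE (@transp_eps _ _ _ _ a b c) // ffunE eqxx. Qed.

(** Both products are the diagram with the four edges inside the rows. *)
Lemma eps_disjoint a b c e : a != b -> c != e -> a != c -> a != e -> b != c -> b != e ->
  eps a b * eps c e = eps c e * eps a b.
Proof.
move=> ab ce ac ae bc be; rewrite !bepsE; apply: bd_mul_eq => I J.
suff h (a' b' c' e' : 'I_m) (ab' : a' != b') (ce' : c' != e') : a' != c' -> a' != e' -> b' != c' -> b' != e' ->
    (\sum_(K : coloring m) coh (epsd ab') I K * coh (epsd ce') K J)%N =
    [&& I a' == I b', J a' == J b', I c' == I e', J c' == J e' &
      [forall i, [&& i != a', i != b', i != c' & i != e'] ==> (I i == J i)]].
  rewrite h // h; do ?[by rewrite eq_sym]; congr nat_of_bool.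
  have -> : [forall i, [&& i != c, i != e, i != a & i != b] ==> (I i == J i)] =
    [forall i, [&& i != a, i != b, i != c & i != e] ==> (I i == J i)].
    apply: eq_forallb => i; congr (_ ==> _).
    by case: (i != a); case: (i != b); case: (i != c); case: (i != e).
  by case: (I a == I b); case: (J a == J b); case: (I c == I e); case: (J c == J e).
move=> ac' ae' bc' be'; rewrite sum_coh_epsd; case: (I a' == I b'); last by rewrite mul0n.
rewrite mul1n (bigD1 (J a')) //= big1 ?addn0.
  congr nat_of_bool; rewrite coh_epsd !ffunE ![c' == _]eq_sym ![e' == _]eq_sym.
  rewrite (negPf ac') (negPf ae') (negPf bc') (negPf be') /=.
  apply/and3P/and4P => [[-> -> /forallP h]|[Jab -> -> /forallP h]].
    split=> //.
      by have := h b'; rewrite bc' be' ffunE eqxx orbT.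
    apply/forallP => i; apply/implyP => /and4P[ia ib ic ie].
    by have := h i; rewrite ic ie ffunE (negPf ia) (negPf ib).
  split=> //; apply/forallP => i; apply/implyP => /andP[ic ie]; rewrite ffunE.
  case: (eqVneq i a') => [->|ia] /=; last case: (eqVneq i b') => [->|ib] /=; rewrite ?(eqP Jab) //.
  by have := h i; rewrite ia ib ic ie.
move=> k kJ; rewrite coh_epsd; case: forallP => [h|]; last by rewrite !andbF.
by have := h a'; rewrite ac' ae' ffunE eqxx (negPf kJ).
Qed.

(** Conjugation by [s] permutes the terms of the sum. *)
Lemma JM_perm b s : s b = b -> (forall a, (s a < b)%N = (a < b)%N) ->
  JM b * bperm s = bperm s * JM b.
Proof.
move=> sb sl; rewrite JME mulrDl mulrDr -scalerAl -scalerAr mul1r mulr1; congr (_ + _).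
rewrite mulr_suml mulr_sumr [RHS](reindex_inj (@perm_inj _ s)) /=.
apply: eq_big => [a|a ab]; first by rewrite sl.
have nab : a != b by rewrite -(inj_eq val_inj) neq_ltn ab.
by rewrite mulrBl mulrBr tr_conj bperm_eps // sb.
Qed.

Lemma JMs_perm b s : s b = b -> (forall a, (s a < b)%N = (a < b)%N) ->
  JMs b * bperm s = bperm s * JMs b.
Proof.
move=> sb sl; rewrite JMsE mulr_suml mulr_sumr [RHS](reindex_inj (@perm_inj _ s)) /=.
apply: eq_big => [a|a ab]; first by rewrite sl.
by rewrite tr_conj sb.
Qed.

Lemma tperm_below a c b : (a < b)%N -> (c < b)%N ->
  tperm a c b = b /\ forall e, (tperm a c e < b)%N = (e < b)%N.
Proof.
move=> ab cb; have [na nc] : a != b /\ c != b by rewrite -!(inj_eq val_inj) !neq_ltn ab cb.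
by rewrite tpermD //; split=> // e; case: tpermP => [->|->|]; rewrite ?ab ?cb.
Qed.

Lemma JM_tr a c b : (a < b)%N -> (c < b)%N -> JM b * tr a c = tr a c * JM b.
Proof. by move=> ab /(tperm_below ab)[? ?]; apply: JM_perm. Qed.

Lemma JMs_tr a c b : (a < b)%N -> (c < b)%N -> JMs b * tr a c = tr a c * JMs b.
Proof. by move=> ab /(tperm_below ab)[? ?]; apply: JMs_perm. Qed.

Lemma bflip_JM b : bflip (JM b) = JM b.
Proof.
rewrite JME linearD /= linearZ /= bflip1 raddf_sum; congr (_ + _).
by apply: eq_bigr => a _; rewrite raddfB /= bflip_perm tpermV bflip_eps.
Qed.

(** The terms of [JM b] at [a] and at [c] cancel against each other next to
    [eps a c]; the others commute with it. *)
Lemma JM_eps a c b : a != c -> (a < b)%N -> (c < b)%N -> JM b * eps a c = eps a c * JM b.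
Proof.
move=> ac ab cb.
have [na nc] : a != b /\ c != b by rewrite -!(inj_eq val_inj) !neq_ltn ab cb.
have ca : c != a by rewrite eq_sym.
have [na' nc'] : b != a /\ b != c by rewrite ![b == _]eq_sym.
pose R := \sum_(e < m | [&& (e < b)%N, e != a & e != c]) (tr e b - eps e b).
have JR : JM b = kappa%:A + (tr a b - eps a b) + (tr c b - eps c b) + R.
  rewrite JME (bigD1 a) //= (bigD1 c) /=; last by rewrite cb ca.
  by rewrite !addrA; congr (_ + _); apply: eq_bigl => e; rewrite andbA.
have RE : R * eps a c = eps a c * R.
  rewrite mulr_suml mulr_sumr; apply: eq_bigr => e /and3P[eb ea ec].
  have neb : e != b by rewrite -(inj_eq val_inj) neq_ltn eb.
  rewrite mulrBl mulrBr; congr (_ - _); last by rewrite eps_disjoint.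
  by rewrite bperm_eps // !tpermD.
have h1 : tr a b * eps a c = eps c b * eps a c.
  by rewrite trC [eps a c]bepsC tr_eps_eps.
have h2 : tr c b * eps a c = eps a b * eps a c by rewrite trC tr_eps_eps.
have z1 : (tr a b - eps a b + (tr c b - eps c b)) * eps a c = 0.
  by rewrite mulrDl !mulrBl h1 h2 addrC subrKA subrr.
have z2 : eps a c * (tr a b - eps a b + (tr c b - eps c b)) = 0.
  apply: (can_inj (@bflipK _ om m)).
  by rewrite raddf0 bflipM bflip_eps raddfD !raddfB /= !bflip_perm !bflip_eps !tpermV.
rewrite JR -(addrA kappa%:A) mulrDl mulrDr RE; congr (_ + _).
by rewrite [LHS]mulrDl [RHS]mulrDr z1 z2 -scalerAl -scalerAr mul1r mulr1.
Qed.

(** The larger of the two commutes with all transpositions and elementary diagrams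
    of the dots below it. *)
Lemma JM_comm a b : GRing.comm (JM a) (JM b).
Proof.
wlog ab : a b / (a < b)%N.
  move=> h; case: (ltngtP a b) => [/h //|/h/commr_sym //|/val_inj ->].
  exact: commr_refl.
rewrite /GRing.comm [JM a]JME mulrDl mulrDr -scalerAl -scalerAr mul1r mulr1; congr (_ + _).
rewrite mulr_suml mulr_sumr; apply: eq_bigr => e ea.
have eb := ltn_trans ea ab; have ne : e != a by rewrite -(inj_eq val_inj) neq_ltn ea.
by rewrite mulrBl mulrBr JM_tr // JM_eps.
Qed.

Lemma JMs_comm a b : GRing.comm (JMs a) (JMs b).
Proof.
wlog ab : a b / (a < b)%N.
  move=> h; case: (ltngtP a b) => [/h //|/h/commr_sym //|/val_inj ->].
  exact: commr_refl.
rewrite /GRing.comm [JMs a]JMsE mulr_suml mulr_sumr; apply: eq_bigr => e ea.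
by rewrite JMs_tr // (ltn_trans ea ab).
Qed.

(** The Jucys-Murphy element of the dots below [b] other than [a], seen from
    [a]; it is what [JM b] becomes when it crosses the edge joining [a] and [b]. *)
Definition JMat a b : B :=
  kappa%:A + \sum_(e < m | (e < b)%N && (e != a)) (tr a e - eps a e).

(** Sliding along the edge that joins [a] and [b] exchanges the roles of
    transpositions and elementary diagrams, which changes the sign; the term of
    [a] itself accounts for the shift by [2 kappa = om - 1]. *)
Lemma JM_cross a b d : (2 : F) != 0 -> (a < b)%N -> d (inl a) = inl b ->
  JM b * bd d = - JMat a b * bd d.
Proof.
move=> two ab dab; have dba : d (inl b) = inl a by rewrite -dab mateK.
have nab : a != b by rewrite -(inj_eq val_inj) neq_ltn ab.
rewrite JME (bigD1 a) //= !mulrDl !mulNr transp_absorb // eps_absorb //.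
rewrite /JMat mulrDl opprD !mulr_suml.
have -> : \sum_(e < m | (e < b)%N && (e != a)) (tr e b - eps e b) * bd d =
   - \sum_(e < m | (e < b)%N && (e != a)) (tr a e - eps a e) * bd d.
  rewrite -sumrN; apply: eq_bigr => e /andP[eb ea].
  have neb : e != b by rewrite -(inj_eq val_inj) neq_ltn eb.
  rewrite !mulrBl (@transp_eps _ _ _ _ a e b) // [eps e b]bepsC.
  by rewrite -(@transp_eps _ _ _ _ b e a) // [tr e a]trC opprB.
rewrite !addrA; congr (_ - _).
rewrite -!scalerAl mul1r -{2}(scale1r (bd d)) -scalerDl -scalerBl -scaleNr.
by congr (_ *: _); rewrite /kappa; field.
Qed.

End JucysMurphy.

(** * Crossing a horizontal edge *)

Section Annihilator.
Variables (F : fieldType) (om : F) (m : nat).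
Local Notation B := (Br om m).
Local Notation bd := (@bd F om m).
Local Notation bperm := (@bperm F om m).
Local Notation eps := (@beps' F om m).
Local Notation tr a b := (bperm (tperm a b)).
Local Notation JM b := (@JM F om m b).
Local Notation JMs b := (@JMs F om m b).
Local Notation JMat a b := (@JMat F om m a b).
Local Notation kappa := (@kappa F om).
Implicit Types (s t : {perm 'I_m}) (d : diagram m) (a b c e : 'I_m) (x y E : B).

Lemma ltn_neq a b : (a < b)%N -> a != b.
Proof. by move=> ab; rewrite -(inj_eq val_inj) neq_ltn ab. Qed.

Lemma JMs_adj a b : b = a.+1 :> nat -> JMs b * tr a b = tr a b * JMs a + 1.
Proof.
move=> ba; have ab : (a < b)%N by rewrite ba.
rewrite !JMsE (bigD1 a) //= mulrDl tr2 addrC; congr (_ + _).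
rewrite mulr_suml mulr_sumr.
rewrite (eq_bigl (fun e : 'I_m => (e < a)%N)); last first.
  by move=> e; rewrite ba ltnS -(inj_eq val_inj) /= ltn_neqAle andbC.
apply: eq_bigr => e ea; have eb := ltn_trans ea ab.
by rewrite tr_conj tpermR tpermD // eq_sym ltn_neq.
Qed.

Lemma JM_adj a b : b = a.+1 :> nat -> JM b * tr a b = tr a b * JM a + 1 - eps a b.
Proof.
move=> ba; have ab : (a < b)%N by rewrite ba.
rewrite !JME (bigD1 a) //= !mulrDl mulrDr mulNr tr2 eps_tr ?ltn_neq //.
rewrite -!scalerAl -!scalerAr mul1r mulr1 -!addrA; congr (_ + _).
rewrite addrA addrC; congr (_ + _); rewrite mulr_suml mulr_sumr.
rewrite (eq_bigl (fun e : 'I_m => (e < a)%N)); last first.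
  by move=> e; rewrite ba ltnS -(inj_eq val_inj) /= ltn_neqAle andbC.
apply: eq_bigr => e ea; have eb := ltn_trans ea ab.
rewrite mulrBl mulrBr tr_conj bperm_eps ?ltn_neq // tpermR.
by rewrite tpermD // eq_sym ltn_neq.
Qed.

(** Indexed by natural numbers, for use in products over intervals. *)
Definition JMn (i : nat) : B := if insub i is Some o then JMs o else 0.

Lemma JMnE a : JMn a = JMs a. Proof. by rewrite /JMn valK. Qed.

Definition JMpoly (c : nat) : {poly B} := \prod_(0 <= i < c) ('X - (JMn i)%:P).

Lemma JMpolyS (c : nat) : JMpoly c.+1 = JMpoly c * ('X - (JMn c)%:P).
Proof. by rewrite /JMpoly big_nat_recr. Qed.

Lemma comm_XsubC x y : GRing.comm x y -> GRing.comm x%:P ('X - y%:P).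
Proof.
move=> xy; rewrite /GRing.comm mulrBr mulrBl -!polyCM xy; congr (_ - _).
exact: commr_polyX.
Qed.

(** Only the factors of [a] and [b = a + 1] fail to commute with the transposition,
    and their sum and their product do commute with it. *)
Lemma JMpoly_adj a b (c : nat) : b = a.+1 :> nat -> (b < c)%N ->
  GRing.comm (tr a b)%:P (JMpoly c).
Proof.
move=> ba; have ab : (a < b)%N by rewrite ba.
elim: c => // c IH; rewrite ltnS leq_eqVlt => /orP[/eqP bc|bc]; last first.
  rewrite JMpolyS; apply: commrM; first exact: IH.
  apply: comm_XsubC; rewrite /JMn; case: insubP => [o _ oc|_]; last exact: commr0.
  by apply/esym/JMs_tr; rewrite oc // (ltn_trans ab).
rewrite -bc ba !JMpolyS -mulrA; apply: commrM.
  rewrite /JMpoly big_seq; elim/big_rec: _ => [|i p]; first exact: commr1.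
  rewrite mem_index_iota => /andP[_ ia] cp; apply: commrM => //.
  have im : (i < m)%N by apply: ltn_trans (ltn_ord a).
  rewrite -[i]/(val (Ordinal im)) JMnE; apply: comm_XsubC.
  have [ia' ib] : Ordinal im != a /\ Ordinal im != b.
    by rewrite -!(inj_eq val_inj) /= !neq_ltn ia (ltn_trans ia ab).
  apply/esym/JMs_perm => [|e]; first by rewrite tpermD // eq_sym.
  case: tpermP => [->|->|//] /=; rewrite ba.
    by rewrite !ltnNge ltnW //= ltnW // ltnS ltnW.
  by rewrite !ltnNge ltnW //= ltnW // ltnS ltnW.
rewrite -ba !JMnE.
have h1 := JMs_adj ba.
have h2 : tr a b * JMs b = JMs a * tr a b + 1.
  apply: (can_inj (@bflipK _ om m)).
  have fl e : bflip (JMs e) = JMs e.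
    by rewrite JMsE raddf_sum; apply: eq_bigr => u _; rewrite /= bflip_perm tpermV.
  by rewrite bflipM raddfD /= bflipM bflip1 !fl bflip_perm tpermV h1.
set Ya := JMs a in h1 h2 *; set Yb := JMs b in h1 h2 *; set t := tr a b in h1 h2 *.
have e : ('X - Ya%:P) * ('X - Yb%:P) = 'X * 'X - (Ya + Yb)%:P * 'X + (Ya * Yb)%:P.
  have Z (A u v w : {poly B}) : A - u - (v - w) = A - (v + u) + w.
    by rewrite opprB opprD !addrA addrAC [A - u - v]addrAC.
  by rewrite mulrBl !mulrBr polyCM polyCD mulrDl -(commr_polyX Yb%:P) Z.
have cs : t * (Ya + Yb) = (Ya + Yb) * t.
  by rewrite mulrDr mulrDl h1 h2 addrA addrAC [_ + Ya * _]addrC addrA.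
have cp : t * (Ya * Yb) = Ya * Yb * t.
  have e1 : t * Ya = Yb * t - 1 by rewrite h1 addrK.
  by rewrite [LHS]mulrA e1 mulrBl -[Yb * t * Yb]mulrA h2 mulrDr mulr1 mul1r addrK mulrA (JMs_comm om b a).
rewrite e; apply: commrD; last by rewrite /GRing.comm -!polyCM cp.
apply: commrB; first by apply: commrM; exact: commr_polyX.
apply: commrM; last exact: commr_polyX.
by rewrite /GRing.comm -!polyCM cs.
Qed.

(** The elementary symmetric functions of the Jucys-Murphy elements are central:
    adjacent transpositions generate the others. *)
Lemma JMpoly_tr a b (c : nat) : (a < c)%N -> (b < c)%N -> GRing.comm (tr a b)%:P (JMpoly c).
Proof.
wlog ab : a b / (a < b)%N.
  move=> h ac bc; case: (ltngtP a b) => [ab|ba|/val_inj ->]; first exact: h.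
    by rewrite trC; apply: h.
  by rewrite tperm1 bperm1; exact/commr_sym/commr1.
move=> ac; have [k bE] : exists k, b = (a + k.+1)%N :> nat by exists (b - a).-1; lia.
elim: k b bE {ab} => [|k IH] b bE bc; first by apply: JMpoly_adj => //; lia.
have em : (a + k.+1 < m)%N by have := ltn_ord b; lia.
pose e := Ordinal em.
have -> : tr a b = tr e b * (tr a e * tr e b).
  have ne : e != b by apply: ltn_neq; rewrite /= bE; lia.
  have na : a != e by apply: ltn_neq; rewrite /=; lia.
  have nab : a != b by apply: ltn_neq; rewrite bE; lia.
  by rewrite tr_conj mulrA tr2 mul1r tpermL tpermD // eq_sym.
have h1 : GRing.comm (tr e b)%:P (JMpoly c) by apply: JMpoly_adj => //; rewrite bE /=; lia.
have h2 : GRing.comm (tr a e)%:P (JMpoly c) by apply: IH => //=; lia.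
rewrite !polyCM; apply/commr_sym; do 2?apply: commrM; exact: commr_sym.
Qed.

Lemma JMpoly_root b : (JMpoly b.+1).[JMs b] = 0.
Proof.
rewrite JMpolyS JMnE; apply/eqP; rewrite -[_ == 0]/(root _ _).
by apply/factor_theorem; exists (JMpoly b).
Qed.

(** [JMs b], with the dots [a] and [l - 1 = b] exchanged. *)
Definition JMsat a (l : nat) : B := \sum_(e < m | (e < l)%N && (e != a)) tr a e.

Lemma JMsat_conj a b : (a <= b)%N -> JMsat a b.+1 = tr a b * JMs b * tr a b.
Proof.
move=> ab; have -> : JMs b = JMsat b b.+1.
  rewrite JMsE; apply: eq_big => [e|e _]; last by rewrite trC.
  by rewrite ltnS -(inj_eq val_inj) ltn_neqAle andbC.
rewrite -mulrA; suff -> : JMsat b b.+1 * tr a b = tr a b * JMsat a b.+1.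
  by rewrite mulrA tr2 mul1r.
rewrite mulr_suml mulr_sumr [RHS](reindex_inj (@perm_inj _ (tperm a b))) /=.
apply: eq_big => [e|e _]; last by rewrite tr_conj tpermR.
have -> : (tperm a b e == a) = (e == b).
  by rewrite -(inj_eq (@perm_inj _ (tperm a b)) e b) tpermR.
by case: tpermP => [->|->|//]; rewrite !ltnS ?ab ?leqnn.
Qed.

(** [JMs b] is a root of the polynomial with roots the [JMs i], [i <= b], whose
    coefficients are central; to the right of [E] these coefficients become
    numbers.  Being central they survive the conjugation of [JMs b] into
    [JMsat a]. *)
Lemma JMsat_annihilated E (g : nat -> F) (l : nat) a :
  (l <= m)%N -> (a < l)%N -> (forall i : 'I_m, (i < l)%N -> E * JMs i = g i *: E) ->
  E * horner_alg (JMsat a l) (\prod_(0 <= i < l) ('X - (g i)%:P)) = 0.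
Proof.
case: l => // l lm al EJ.
pose b := Ordinal lm; pose phi (c : nat) : {poly F} := \prod_(0 <= i < c) ('X - (g i)%:P).
have key (c : nat) : (c <= l.+1)%N -> E%:P * JMpoly c = map_poly (in_alg B) (phi c) * E%:P.
  elim: c => [|c IH] cl.
    by rewrite /JMpoly /phi !big_geq // rmorph1 mulr1 mul1r.
  have cm : (c < m)%N by exact: (leq_trans cl lm).
  rewrite JMpolyS mulrA IH ?(ltnW cl) //.
  rewrite /phi big_nat_recr //= rmorphM /= -!mulrA; congr (_ * _).
  rewrite -[c in JMn c]/(val (Ordinal cm)) JMnE mulrBr -polyCM EJ //=.
  rewrite rmorphB /= map_polyX map_polyC /= mulrBl commr_polyX; congr (_ - _).
  by rewrite -polyCM -scalerAl mul1r.
have kc i : E * (JMpoly l.+1)`_i = (phi l.+1)`_i *: E.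
  have := congr1 (fun p : {poly B} => p`_i) (key _ (leqnn _)).
  by rewrite /= coefCM coefMC coef_map /= -scalerAl mul1r.
pose N := maxn (size (JMpoly l.+1)) (size (map_poly (in_alg B) (phi l.+1))).
rewrite -/(phi l.+1) /horner_alg /horner_morph (horner_coef_wide _ (leq_maxr _ _ : _ <= N)%N).
have Ypow i : JMsat a l.+1 ^+ i = tr a b * JMs b ^+ i * tr a b.
  rewrite (@JMsat_conj a b) //; elim: i => [|i IH].
    by rewrite !expr0 mulr1 tr2.
  rewrite exprS IH -!mulrA [tr a b * (tr a b * _)]mulrA tr2 mul1r.
  by rewrite exprS !mulrA.
transitivity (E * tr a b * (JMpoly l.+1).[JMs b] * tr a b); last first.
  by rewrite (@JMpoly_root b) mulr0 mul0r.
rewrite (horner_coef_wide _ (leq_maxl _ _ : _ <= N)%N) mulr_sumr mulr_sumr mulr_suml.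
apply: eq_bigr => i _; rewrite coef_map /= -scalerAl mul1r -scalerAr scalerAl.
rewrite -kc Ypow.
have ct : tr a b * (JMpoly l.+1)`_i = (JMpoly l.+1)`_i * tr a b.
  have := congr1 (fun p : {poly B} => p`_i) (@JMpoly_tr a b l.+1 al (ltnSn _)).
  by rewrite /= coefCM coefMC.
by rewrite -!mulrA [tr a b * (_ * (_ * _))]mulrA ct !mulrA.
Qed.

End Annihilator.

Lemma horner_algE (F : fieldType) (A : algType F) (x : A) (p : {poly F}) :
  horner_alg x p = \sum_(i < size p) p`_i *: x ^+ i.
Proof.
rewrite /horner_alg /horner_morph (horner_coef_wide _ (size_poly _ _)).
by apply: eq_bigr => i _; rewrite coef_map /= -scalerAl mul1r.
Qed.

Section Crossing.
Variables (F : fieldType) (om : F) (m : nat).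
Local Notation B := (Br om m).
Local Notation bd := (@bd F om m).
Local Notation bperm := (@bperm F om m).
Local Notation eps := (@beps' F om m).
Local Notation tr a b := (bperm (tperm a b)).
Local Notation JM b := (@JM F om m b).
Local Notation JMs b := (@JMs F om m b).
Local Notation kappa := (@kappa F om).
Implicit Types (d : diagram m) (a b u v : 'I_m) (x y E : B).

Lemma eps_killed_tr E b y u v : (u < b)%N -> (v < b)%N ->
  (forall u v, u != v -> (u < b)%N -> (v < b)%N -> E * y * eps u v = 0) ->
  forall u' v', u' != v' -> (u' < b)%N -> (v' < b)%N -> E * (y * tr u v) * eps u' v' = 0.
Proof.
move=> ub vb h u' v' nuv u'b v'b; have [_ l] := tperm_below ub vb.
have e : tr u v * eps u' v' = eps (tperm u v u') (tperm u v v') * tr u v.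
  by rewrite bperm_eps ?(inj_eq perm_inj) // !tpermK.
by rewrite -!mulrA e !mulrA h ?mul0r // ?(inj_eq perm_inj) // l.
Qed.

(** Across the edge joining [a] and [b], [JM b] becomes the opposite of the
    Jucys-Murphy element seen from [a].  Next to [E] the elementary diagrams
    vanish, so that only the element of the symmetric group remains, and it is
    annihilated by the polynomial whose roots are the eigenvalues of the
    [JMs i]. *)
Lemma crossing_annihilated E (c : nat -> F) b d a : (2 : F) != 0 -> (a < b)%N ->
  d (inl a) = inl b ->
  (forall i : 'I_m, (i < b)%N -> E * JM i = c i *: E) ->
  (forall u v, u != v -> (u < b)%N -> (v < b)%N -> E * eps u v = 0) ->
  E * horner_alg (JM b) (\prod_(0 <= i < b) ('X + (c i)%:P)) * bd d = 0.
Proof.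
move=> two ab dab EJ Eeps.
have EJs (i : 'I_m) : (i < b)%N -> E * JMs i = (c i - kappa) *: E.
  move=> ib; have := EJ i ib; rewrite JM_JMs mulrBr mulrDr -scalerAr mulr1.
  rewrite mulr_sumr [X in _ - X]big1 ?subr0; last first.
    by move=> u ui; rewrite Eeps ?ltn_neq // (ltn_trans ui ib).
  by rewrite scalerBl => <-; rewrite addrC addrA addNr add0r.
set f := \prod_(0 <= i < b) _.
pose z : B := - JMat om a b; pose z' : B := - (kappa%:A + JMsat om a b).
pose Eps : B := \sum_(e < m | (e < b)%N && (e != a)) eps a e.
have zE : z = z' + Eps.
  by rewrite /z /z' /JMat sumrB opprD opprB addrCA addrC -opprD.
have p1 i : JM b ^+ i * bd d = z ^+ i * bd d.
  elim: i => // i IH; rewrite exprS -mulrA IH mulrA.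
  have cz : GRing.comm (JM b) z.
    apply: commrN; apply: commrD.
      by rewrite /GRing.comm -scalerAl -scalerAr mul1r mulr1.
    apply: commr_sum => e /andP[eb ea]; apply: commrB; first exact: JM_tr.
    by apply: JM_eps; rewrite // eq_sym.
  by rewrite (commrX i cz) -mulrA (JM_cross om two ab dab) mulrA -exprSr.
have p2 i : E * z ^+ i = E * z' ^+ i.
  have k0 j : forall u v, u != v -> (u < b)%N -> (v < b)%N -> E * z' ^+ j * eps u v = 0.
    elim: j => [|j IH] u v uv ub vb; first by rewrite expr0 mulr1 Eeps.
    rewrite exprSr mulrA {2}/z' mulrN mulNr mulrDr mulrDl.
    rewrite -scalerAr mulr1 -scalerAl IH // scaler0 add0r.
    rewrite mulr_sumr mulr_suml big1 ?oppr0 // => e /andP[eb ea]; rewrite -(mulrA E).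
    exact: (@eps_killed_tr E b).
  elim: i => // i IH; rewrite !exprSr mulrA IH zE mulrDr.
  have -> : E * z' ^+ i * Eps = 0.
    by rewrite mulr_sumr big1 // => e /andP[eb ea]; rewrite k0 // eq_sym.
  by rewrite addr0 mulrA.
have s1 : horner_alg (JM b) f * bd d = horner_alg z f * bd d.
  rewrite !horner_algE !mulr_suml; apply: eq_bigr => i _.
  by rewrite -!scalerAl p1.
have s2 : E * horner_alg z f = E * horner_alg z' f.
  rewrite !horner_algE !mulr_sumr; apply: eq_bigr => i _.
  by rewrite -!scalerAr p2.
rewrite -mulrA s1 mulrA s2.
have -> : horner_alg z' f = (-1) ^+ b *:
    horner_alg (JMsat om a b) (\prod_(0 <= i < b) ('X - (c i - kappa)%:P)).
  rewrite /f /z' !rmorph_prod; move: (JMsat om a b) kappa => w k.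
  elim: (b : nat) => [|l IH]; first by rewrite !big_geq // expr0 scale1r.
  rewrite !big_nat_recr //= IH exprSr -scalerA -!scalerAl; congr (_ *: _).
  rewrite scaleN1r -mulrN; congr (_ * _).
  rewrite rmorphD rmorphB /= !horner_algX !horner_algC opprB scalerBl.
  by rewrite opprD addrC addrA.
rewrite -scalerAr (@JMsat_annihilated _ _ _ E (fun i => c i - kappa)) //.
  by rewrite scaler0 mul0r.
by rewrite ltnW.
Qed.

End Crossing.

(** * The inclusion of B_m in B_(m+1) *)

Section Extend.
Variables (C : finType) (m : nat).

Definition extend (I : {ffun 'I_m -> C}) (k : C) : {ffun 'I_m.+1 -> C} :=
  [ffun c => if unlift ord_max c is Some c' then I c' else k].
Definition restrict (I : {ffun 'I_m.+1 -> C}) : {ffun 'I_m -> C} :=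
  [ffun c => I (lift ord_max c)].

Lemma extend_lift I k c : extend I k (lift ord_max c) = I c.
Proof. by rewrite ffunE liftK. Qed.

Lemma extend_max I k : extend I k ord_max = k.
Proof. by rewrite ffunE unlift_none. Qed.

Lemma extendK I k : restrict (extend I k) = I.
Proof. by apply/ffunP => c; rewrite ffunE extend_lift. Qed.

Lemma restrictK I : extend (restrict I) (I ord_max) = I.
Proof.
apply/ffunP => c; rewrite !ffunE; case: unliftP => [j ->|->] //.
by rewrite ffunE.
Qed.

Lemma big_extend (R : Type) (idx : R) (op : Monoid.com_law idx) (f : {ffun 'I_m.+1 -> C} -> R) :
  \big[op/idx]_K f K = \big[op/idx]_K \big[op/idx]_k f (extend K k).
Proof.
rewrite pair_big (reindex (fun p => extend p.1 p.2)) //=.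
exists (fun K => (restrict K, K ord_max)) => [[K k] _|K _] /=; last exact: restrictK.
by rewrite extendK extend_max.
Qed.

End Extend.

Section Widen.
Variable m : nat.
Local Notation wd := (widen_ord (leqnSn m)).

Lemma widen_lift i : wd i = lift ord_max i.
Proof. by apply: val_inj; rewrite /= /bump leqNgt ltn_ord. Qed.

Definition dwiden_fun (d : diagram m) : {ffun dot m.+1 -> dot m.+1} :=
  [ffun p => match p with
   | inl i => if unlift ord_max i is Some j then dot_widen (d (inl j)) else inr ord_max
   | inr i => if unlift ord_max i is Some j then dot_widen (d (inr j)) else inl ord_max end].

Lemma dwiden_funE d p : dwiden_fun d (dot_widen p) = dot_widen (d p).
Proof. by case: p => i; rewrite ffunE /= widen_lift liftK. Qed.

Lemma dot_widen_inj : injective (@dot_widen m).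
Proof. by move=> [i|i] [j|j] //= [] /val_inj ->. Qed.

Lemma dot_case (p : dot m.+1) : [\/ exists q, p = dot_widen q, p = inl ord_max | p = inr ord_max].
Proof.
case: p => i; case: (unliftP ord_max i) => [j ->|->].
- by apply: Or31; exists (inl j); rewrite /= widen_lift.
- exact: Or32.
- by apply: Or31; exists (inr j); rewrite /= widen_lift.
exact: Or33.
Qed.

Lemma dwiden_subproof d : [forall p, (dwiden_fun d (dwiden_fun d p) == p) && (dwiden_fun d p != p)].
Proof.
apply/forallP => p; case: (dot_case p) => [[q ->]|->|->].
- by rewrite !dwiden_funE mateK eqxx (inj_eq dot_widen_inj) mate_neq.
- by rewrite !ffunE unlift_none unlift_none eqxx.
by rewrite !ffunE unlift_none unlift_none eqxx.
Qed.

Definition dwiden d : diagram m.+1 := Diagram (dwiden_subproof d).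

Lemma dwidenE (d : diagram m) p : dwiden d (dot_widen p) = dot_widen (d p).
Proof. exact: dwiden_funE. Qed.

Lemma dwidenP (d : diagram m) (d' : diagram m.+1) :
  [forall p, d' (dot_widen p) == dot_widen (d p)] = (d' == dwiden d).
Proof.
apply/forallP/eqP => [h|-> p]; last by rewrite dwidenE.
have nw q : d' (dot_widen q) = dot_widen (d q) by exact/eqP.
have ex (p : dot m.+1) : (forall q, p <> dot_widen q) -> forall q, d' p <> dot_widen q.
  move=> np q e; apply: (np (d q)); rewrite -nw -e mateK //.
have nl q : (inl ord_max : dot m.+1) <> dot_widen q.
  by case: q => i; rewrite /= ?widen_lift => -[] // e; have := neq_bump m i; rewrite -e eqxx.
have nr q : (inr ord_max : dot m.+1) <> dot_widen q.
  by case: q => i; rewrite /= ?widen_lift => -[] // e; have := neq_bump m i; rewrite -e eqxx.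
apply: diagramP => p; case: (dot_case p) => [[q ->]|->|->].
- by rewrite nw dwidenE.
- rewrite ffunE unlift_none; case: (dot_case (d' (inl ord_max))) => [[q /(ex _ nl)]|e|] //.
  by have := mate_neq d' (inl ord_max); rewrite e eqxx.
rewrite ffunE unlift_none; case: (dot_case (d' (inr ord_max))) => [[q /(ex _ nr)]||e] //.
by have := mate_neq d' (inr ord_max); rewrite e eqxx.
Qed.

Lemma coh_dwiden d N (I J : {ffun 'I_m -> 'I_N.+1}) i j :
  coh (dwiden d) (extend I i) (extend J j) = coh d I J && (i == j).
Proof.
have labE p : lab (extend I i) (extend J j) (dot_widen p) = lab I J p.
  by case: p => c; rewrite /= widen_lift extend_lift.
apply/forallP/andP => [h|[/forallP h /eqP ij] p].
  split; last by have := h (inl ord_max); rewrite ffunE unlift_none /= !extend_max.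
  by apply/forallP => p; have := h (dot_widen p); rewrite dwidenE !labE.
case: (dot_case p) => [[q ->]|->|->]; first by rewrite dwidenE !labE.
  by rewrite ffunE unlift_none /= !extend_max ij.
by rewrite ffunE unlift_none /= !extend_max ij.
Qed.

Lemma dcomp_widen d1 d2 : dcomp (dwiden d1) (dwiden d2) = dwiden (dcomp d1 d2) /\
  loops (dwiden d1) (dwiden d2) = loops d1 d2.
Proof.
apply: dcomp_spec => I J; rewrite -(restrictK I) -(restrictK J) big_extend.
set i := I _; set j := J _; rewrite coh_dwiden -mulnb mulnA -count_labelings.
rewrite big_distrl /=; apply: eq_bigr => K _.
rewrite (bigD1 j) //= big1 ?addn0; last first.
  by move=> k /negPf kj; rewrite !coh_dwiden kj andbF muln0.
by rewrite !coh_dwiden eqxx andbT -mulnb mulnAC.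
Qed.

End Widen.

Section WidenRing.
Variables (F : fieldType) (om : F) (m : nat).

Definition bw (x : Br om m) : Br om m.+1 := bwiden x.

Lemma bwE x d' : bw x d' = \sum_(d : diagram m | d' == dwiden d) x d.
Proof. by rewrite ffunE; apply: eq_bigl => d; rewrite dwidenP. Qed.

Lemma bw_linear : linear bw.
Proof.
move=> a x y; apply/ffunP => d; rewrite !ffunE scaler_sumr -big_split.
by apply: eq_bigr => d' _; rewrite !ffunE.
Qed.

HB.instance Definition _ := GRing.isLinear.Build F (Br om m) (Br om m.+1) _ bw bw_linear.

Lemma bw_bd d : bw (bd om d) = bd om (dwiden d).
Proof.
apply/ffunP => d'; rewrite bwE ffunE; case: eqP => [->|/eqP nd].
  rewrite (bigD1 d) ?eqxx //= ffunE eqxx big1 ?addr0 // => d1 /andP[_ /negPf nd].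
  by rewrite ffunE nd.
by rewrite big1 // => d1 /eqP ed; rewrite ffunE; case: eqP => // e; rewrite ed e eqxx in nd.
Qed.

Lemma bwM x y : bw (x * y) = bw x * bw y.
Proof.
elim/bd_ind: x => [|d1|a x x' ex ex']; first by rewrite mul0r raddf0 mul0r.
  elim/bd_ind: y => [|d2|a y y' ey ey']; first by rewrite mulr0 raddf0 mulr0.
    rewrite bd_mul linearZ /= !bw_bd bd_mul.
    by have [-> ->] := dcomp_widen d1 d2.
  by rewrite mulrDr -scalerAr linearP /= ey ey' linearP /= mulrDr -scalerAr.
by rewrite mulrDl -scalerAl linearP /= ex ex' linearP /= mulrDl -scalerAl.
Qed.

Lemma bw_perm a b : bw (bperm om (tperm a b)) =
  bperm om (tperm (widen_ord (leqnSn m) a) (widen_ord (leqnSn m) b)).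
Proof.
rewrite bw_bd; congr bd; rewrite !widen_lift; apply: diagramP => p.
have tl i : tperm (lift ord_max a) (lift ord_max b) (lift ord_max i) = lift ord_max (tperm a b i).
  by case: (tpermP a b i) => [->|->|/eqP ia /eqP ib]; rewrite ?tpermL ?tpermR // tpermD //
    (inj_eq lift_inj) eq_sym.
case: (dot_case p) => [[[i|i] ->]|->|->].
- by rewrite dwidenE !ffunE /= !widen_lift tl.
- by rewrite dwidenE !ffunE /= !tpermV !widen_lift tl.
- by rewrite !ffunE unlift_none tpermD // eq_sym neq_lift.
by rewrite !ffunE unlift_none tpermV tpermD // eq_sym neq_lift.
Qed.

Lemma bw1 : bw 1 = 1.
Proof.
rewrite !one_bd bw_bd; congr bd; apply: diagramP => p.
case: (dot_case p) => [[[i|i] ->]|->|->].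
- by rewrite dwidenE !ffunE /= !perm1.
- by rewrite dwidenE !ffunE /= !invg1 !perm1.
- by rewrite !ffunE unlift_none perm1.
by rewrite !ffunE unlift_none invg1 perm1.
Qed.

Lemma bw_eps a b : bw (beps' om a b) =
  beps' om (widen_ord (leqnSn m) a) (widen_ord (leqnSn m) b).
Proof.
case: (eqVneq a b) => [->|ab].
  have z k (c : 'I_k) : beps' om c c = 0.
    by apply/ffunP => d; rewrite !ffunE (negPf (mate_neq _ _)).
  by rewrite !z raddf0.
have wab : lift ord_max a != lift ord_max b by rewrite (inj_eq lift_inj).
rewrite !widen_lift !bepsE bw_bd; congr bd; apply: diagramP => p.
case: (dot_case p) => [[[i|i] ->]|->|->].
- rewrite dwidenE !ffunE /= !widen_lift !(inj_eq lift_inj).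
  by case: (i == a); last case: (i == b); rewrite /= widen_lift.
- rewrite dwidenE !ffunE /= !widen_lift !(inj_eq lift_inj).
  by case: (i == a); last case: (i == b); rewrite /= widen_lift.
- by rewrite !ffunE unlift_none !(negPf (neq_lift _ _)).
by rewrite !ffunE unlift_none !(negPf (neq_lift _ _)).
Qed.

Lemma bw_JM b : bw (JM om b) = JM om (widen_ord (leqnSn m) b).
Proof.
rewrite !JME linearD linearZ /= bw1 raddf_sum /=; congr (_ + _).
rewrite [RHS]big_mkcond big_ord_recr /= ifF ?addr0; last by rewrite ltnNge ltnW.
rewrite -big_mkcond; apply: eq_big => a // _.
by rewrite raddfB /= bw_perm bw_eps.
Qed.

End WidenRing.

Lemma dcomp_permd m (s t : {perm 'I_m}) :
  dcomp (permd s) (permd t) = permd (s * t) /\ loops (permd s) (permd t) = 0%N.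
Proof.
apply: dcomp_spec => I J.
rewrite coh_permd_l mul1n !coh_permd; congr nat_of_bool.
apply/forallP/forallP => h i; last by have := h (s^-1 i)%g; rewrite !ffunE permM permKV.
by have := h (s i); rewrite ffunE permK permM.
Qed.

Lemma loops_permd_l m (s : {perm 'I_m}) (d : diagram m) : loops (permd s) d = 0%N.
Proof.
have [_] := dcompA (permd s^-1) (permd s) d.
rewrite (dcomp_permd _ _).1 (dcomp_permd _ _).2 mulVg (dcomp1d d).2.
by case: (loops _ d).
Qed.

(** * Semisimplicity of the Jucys-Murphy elements of the symmetric group *)

Section Regular.
Variables (F : fieldType) (om : F) (m : nat).
Local Notation B := (Br om m).
Implicit Types x y : B.

Definition rdim := #|{: diagram m}|.-1.

Lemma rdimE : rdim.+1 = #|{: diagram m}|.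
Proof. by rewrite prednK //; apply/card_gt0P; exists (permd 1). Qed.

Definition dia (i : 'I_rdim.+1) : diagram m := enum_val (cast_ord rdimE i).
Definition dia_rank (d : diagram m) : 'I_rdim.+1 := cast_ord (esym rdimE) (enum_rank d).

Lemma diaK : cancel dia dia_rank.
Proof. by move=> i; rewrite /dia_rank enum_valK cast_ordK. Qed.

Lemma dia_rankK : cancel dia_rank dia.
Proof. by move=> d; rewrite /dia cast_ordKV enum_rankK. Qed.

(** The left regular representation, used to annihilate and to diagonalize
    elements of the algebra. *)
Definition lmx x : 'M[F]_rdim.+1 := \matrix_(i, j) (x * bd om (dia j)) (dia i).

Lemma lmx_linear : linear lmx.
Proof. by move=> a x y; apply/matrixP => i j; rewrite !mxE mulrDl -scalerAl !ffunE. Qed.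

HB.instance Definition _ := GRing.isLinear.Build F B 'M[F]_rdim.+1 _ lmx lmx_linear.

Lemma lmxM x y : lmx (x * y) = lmx x *m lmx y.
Proof.
apply/matrixP => i j; rewrite !mxE -mulrA {1}(bd_sum (y * _)) mulr_sumr sum_ffunE.
rewrite (reindex dia); last by exists dia_rank => ? _; rewrite ?diaK ?dia_rankK.
by apply: eq_bigr => k _; rewrite -scalerAr ffunE !mxE mulrC.
Qed.

Lemma lmx1 : lmx 1 = 1%:M.
Proof.
apply/matrixP => i j; rewrite !mxE mul1r ffunE.
by rewrite (inj_eq (can_inj diaK)).
Qed.

Lemma lmx_inj : injective lmx.
Proof.
move=> x y e; apply/ffunP => d.
have := congr1 (fun A : 'M[F]__ => A (dia_rank d) (dia_rank (permd 1))) e.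
by rewrite !mxE !dia_rankK -one_bd !mulr1.
Qed.

Lemma lmx_horner x p : lmx (horner_alg x p) = horner_mx (lmx x) p.
Proof.
rewrite horner_algE raddf_sum -[p in RHS]coefK poly_def raddf_sum; apply: eq_bigr => i _.
rewrite /= linearZ /= horner_mxZ rmorphXn /= horner_mx_X; congr (_ *: _).
by elim: (i : nat) => [|j IH]; rewrite ?expr0 ?lmx1 // !exprS lmxM IH.
Qed.

Lemma lmx_minpoly x : horner_alg x (mxminpoly (lmx x)) = 0.
Proof. by apply: lmx_inj; rewrite lmx_horner mx_root_minpoly raddf0. Qed.

End Regular.

Section Semisimple.
Variables (C : numClosedFieldType) (om : C) (m : nat).

(** Transpositions permute the diagrams, so [JMs b] acts on the algebra by a real
    symmetric matrix, which is diagonalizable. *)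
Lemma JMs_semisimple (b : 'I_m) : exists2 rs : seq C, uniq rs &
  horner_alg (JMs om b) (\prod_(r <- rs) ('X - r%:P)) = 0.
Proof.
have trE (s : {perm 'I_m}) i j : lmx (bperm om s) i j = (dia i == dcomp (permd s) (dia j))%:R.
  rewrite mxE bd_mul.
  rewrite loops_permd_l.
  by rewrite expr0 scale1r ffunE.
have sym : (lmx (JMs om b))^T = lmx (JMs om b).
  rewrite JMsE raddf_sum raddf_sum /=; apply: eq_bigr => a _.
  apply/matrixP => i j; rewrite mxE !trE; congr (_ %:R); congr nat_of_bool.
  have K d d' : (d == dcomp (permd (tperm a b)) d') -> d' == dcomp (permd (tperm a b)) d.
    move/eqP->; rewrite -(dcompA _ _ _).1.
    by rewrite (dcomp_permd _ _).1 tperm2 (dcomp1d _).1.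
  by apply/idP/idP; apply: K.
have real : lmx (JMs om b) \is a realmx.
  apply/mxOverP => i j; rewrite JMsE raddf_sum /= summxE.
  by apply: rpred_sum => a _; rewrite trE realn.
have herm : lmx (JMs om b) \is hermsymmx.
  apply: realsym_hermsym => //; apply/is_hermitianmxP.
  by rewrite expr0 scale1r map_mx_id // sym.
have dg : diagonalizable (lmx (JMs om b)).
  exists (spectralmx (lmx (JMs om b))); first exact: spectral_unit.
  have := hermitian_normalmx herm => /orthomx_spectralP e.
  apply/(diagonalizable_forLR (spectral_unit _)).
  exists (spectral_diag (lmx (JMs om b))).
  by rewrite {1}e mxpoly.conjVmx ?spectral_unit.
have [rs urs /mxminpoly_minP e] := (diagonalizableP _).1 dg.
by exists rs => //; apply: lmx_inj; rewrite lmx_horner e raddf0.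
Qed.
End Semisimple.

(** * Resolvents and their values at simple poles *)

Section DifferenceQuotient.
Variable F : fieldType.

(** The quotient of [p - p.[u]] by ['X - u]; evaluated at [x], it inverts [u - x]
    up to [p.[u]] as soon as [p] annihilates [x]. *)
Definition dquo (p : {poly F}) (u : F) : {poly F} :=
  \sum_(i < size p) p`_i *: \sum_(j < i) u ^+ j *: 'X^(i.-1 - j).

Lemma dquoE p u : ('X - u%:P) * dquo p u = p - (p.[u])%:P.
Proof.
have pE : p = \sum_(i < size p) p`_i *: 'X^i by rewrite -poly_def coefK.
rewrite /dquo mulr_sumr [X in _ = X - _]pE horner_coef rmorph_sum /= -sumrB.
apply: eq_bigr => i _; rewrite -scalerAr -[p`_i *: 'X^i]mul_polyC polyCM -mulrBr mul_polyC.
congr (_ *: _); rewrite polyC_exp subrXX; congr (_ * _); apply: eq_bigr => j _.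
by rewrite -mul_polyC polyC_exp mulrC -subn1 -subnDA add1n.
Qed.

Lemma horner_dquo (A : algType F) (x : A) p u :
  (x - u%:A) * horner_alg x (dquo p u) = horner_alg x p - (p.[u])%:A.
Proof.
have := congr1 (horner_alg x) (dquoE p u).
by rewrite rmorphM !rmorphB /= horner_algX !horner_algC.
Qed.

Lemma horner_dquo_sum (A : algType F) (x : A) p u : horner_alg x (dquo p u) =
  \sum_(i < size p) p`_i *: \sum_(j < i) u ^+ j *: x ^+ (i.-1 - j).
Proof.
rewrite /dquo linear_sum; apply: eq_bigr => i _; rewrite /= linearZ /= -scalerAl mul1r; congr (_ *: _).
rewrite linear_sum; apply: eq_bigr => j _; rewrite /= linearZ /= -scalerAl mul1r.
by rewrite rmorphXn /= horner_algX.
Qed.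

Lemma mul_horner_dquo (A : algType F) (e x : A) p u : e * horner_alg x (dquo p u) =
  \sum_(i < size p) \sum_(j < i) (p`_i * u ^+ j) *: (e * x ^+ (i.-1 - j)).
Proof.
rewrite horner_dquo_sum mulr_sumr; apply: eq_bigr => i _.
rewrite -scalerAr mulr_sumr scaler_sumr; apply: eq_bigr => j _.
by rewrite -scalerAr scalerA.
Qed.

(** [M] provides the inverse of [u - x], and a polynomial [chi] that annihilates
    only [e x] suffices to compute its product with [e]. *)
Lemma resolvent_dquo (A : algType F) (e x : A) (u : F) (M chi : {poly F}) :
  M.[u] != 0 -> horner_alg x M = 0 -> e * horner_alg x chi = 0 ->
  let y := (M.[u])^-1 *: horner_alg x (dquo M u) in
  [/\ (u *: 1 - x) * y = 1, y * (u *: 1 - x) = 1 &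
      chi.[u] *: (e * y) = e * horner_alg x (dquo chi u)].
Proof.
move=> M0 xM ex0 y.
have Uq p : (u *: 1 - x) * horner_alg x (dquo p u) = p.[u] *: 1 - horner_alg x p.
  by rewrite -opprB mulNr horner_dquo opprB.
have Uc p : GRing.comm (u *: 1 - x) (horner_alg x p).
  have cx : GRing.comm x (horner_alg x p).
    by rewrite /GRing.comm -{1 4}[x]horner_algX -!rmorphM mulrC.
  apply/commr_sym/commrB; last exact: commr_sym.
  by rewrite /GRing.comm -scalerAl -scalerAr mul1r mulr1.
have Uy : (u *: 1 - x) * y = 1.
  by rewrite -scalerAr Uq xM subr0 scalerA mulVf // scale1r.
split=> //; first by rewrite -scalerAl -Uc Uq xM subr0 scalerA mulVf // scale1r.
set R := horner_alg x (dquo chi u).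
rewrite -[e * R]mulr1 -Uy !mulrA -[e * R * _]mulrA -Uc Uq mulrBr ex0 subr0.
by rewrite -[e * (_ *: 1)]scalerAr mulr1 -[RHS]scalerAl.
Qed.

End DifferenceQuotient.

Lemma scale_div (K : fieldType) (V : lmodType K) (a b chi : K) (z w : V) :
  b != 0 -> chi = a * b -> chi *: z = w -> a *: z = b^-1 *: w.
Proof. by move=> b0 -> <-; rewrite scalerA mulrCA mulVf // mulr1. Qed.

Lemma brauer_scaleE (K : fieldType) (w : K) m (a : K) (x : Br w m) d : (a *: x) d = a * x d.
Proof. by rewrite ffunE. Qed.

Lemma inverse_unique (A : pzRingType) (a y y0 : A) : a * y = 1 -> y0 * a = 1 -> y = y0.
Proof. by move=> ay y0a; rewrite -[y]mul1r -y0a -mulrA ay mulr1. Qed.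

Section Extension.
Variables (F : fieldType) (om : F) (m : nat).
Local Notation K := {fraction {poly F}}.
Local Notation B := (Br om m).
Local Notation BK := (Br (const_frac om) m).

Lemma const_frac_is_additive : zmod_morphism (@const_frac F).
Proof. by move=> a b; rewrite /const_frac !raddfB. Qed.
Lemma const_frac_is_multiplicative : monoid_morphism (@const_frac F).
Proof. by split; [rewrite /const_frac !rmorph1 | move=> a b; rewrite /const_frac !rmorphM]. Qed.
HB.instance Definition _ := GRing.isZmodMorphism.Build F K (@const_frac F) const_frac_is_additive.
HB.instance Definition _ := GRing.isMonoidMorphism.Build F K (@const_frac F) const_frac_is_multiplicative.

Local Notation u := (tofrac 'X : K).

Lemma tofrac_horner (p : {poly F}) : tofrac p = (map_poly (@const_frac F) p).[u].
Proof.
rewrite -{1}[p]coefK poly_def rmorph_sum /= (horner_coef_wide _ (size_poly _ _)).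
apply: eq_bigr => i _.
by rewrite -mul_polyC rmorphM rmorphXn coef_map.
Qed.

Definition bex (x : B) : BK := bext x.

Lemma bex_is_zmod_morphism : zmod_morphism bex.
Proof. by move=> x y; apply/ffunP => d; rewrite !ffunE; exact: (raddfB (@const_frac F)). Qed.
HB.instance Definition _ := GRing.isZmodMorphism.Build B BK bex bex_is_zmod_morphism.

Lemma bexM x y : bex (x * y) = bex x * bex y.
Proof.
have h (a b : F) l : const_frac (a * b * om ^+ l) = const_frac a * const_frac b * const_frac om ^+ l.
  by rewrite -rmorphXn -!rmorphM.
apply/ffunP => d; rewrite !ffunE.
apply: etrans (rmorph_sum (@const_frac F) _ _ _) _; apply: eq_bigr => d1 _.
apply: etrans (rmorph_sum (@const_frac F) _ _ _) _; apply: eq_bigr => d2 _.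
by apply: etrans (h _ _ _) _; rewrite !ffunE.
Qed.

Lemma bex1 : bex 1 = 1.
Proof. by apply/ffunP => d; rewrite !ffunE; exact: (rmorph_nat (@const_frac F)). Qed.

Lemma bexZ (a : F) x : bex (a *: x) = const_frac a *: bex x.
Proof. by apply/ffunP => d; rewrite !ffunE; exact: (rmorphM (@const_frac F)). Qed.

Lemma bexX x i : bex (x ^+ i) = bex x ^+ i.
Proof. by elim: i => [|i IH]; rewrite ?expr0 ?bex1 // !exprS bexM IH. Qed.

Lemma bex_horner x p : bex (horner_alg x p) = horner_alg (bex x) (map_poly (@const_frac F) p).
Proof.
rewrite horner_algE raddf_sum /horner_alg /horner_morph /=.
rewrite (horner_coef_wide _ (leq_trans (size_poly _ _) (size_poly _ _))).
apply: eq_bigr => i _; rewrite !coef_map /= bexZ bexX.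
by rewrite -[RHS]scalerAl mul1r.
Qed.

Lemma frac_value_unique (f : K) c v v' : frac_value f c v -> frac_value f c v' -> v = v'.
Proof.
move=> [p [q [qc fE ->]]] [p' [q' [qc' fE' ->]]].
have nz (r : {poly F}) : r.[c] != 0 -> tofrac r != 0 :> K.
  by rewrite tofrac_eq0; apply: contraNneq => ->; rewrite horner0.
have /eqP : p.[c] * q'.[c] = p'.[c] * q.[c].
  rewrite -!hornerM; congr (_.[c]).
  by move/eqP: fE'; rewrite fE eqr_div ?nz // -!tofracM tofrac_eq => /eqP ->.
by rewrite -(eqr_div _ _ qc qc') => /eqP.
Qed.

(** By the formula for the resolvent in terms of [('X - c) * h], multiplication by
    [u - c] cancels the only factor of the denominator that vanishes at [c].  That
    [u - x] is invertible follows from the minimal polynomial of [x]. *)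
Lemma resolvent_simple_root (e x : B) (c : F) (h : {poly F}) :
  h.[c] != 0 -> e * horner_alg x (('X - c%:P) * h) = 0 ->
  forall E, resolvent_value om e x c E <-> E = (h.[c])^-1 *: (e * horner_alg x h) :> B.
Proof.
move=> hc ex0.
set chi := ('X - c%:P) * h in ex0.
pose mp (p : {poly F}) := map_poly (@const_frac F) p.
pose M := mxminpoly (lmx x).
have M0 : tofrac M != 0 :> K by rewrite tofrac_eq0 monic_neq0 // mxminpoly_monic.
have xM : horner_alg x M = 0 by apply: lmx_minpoly.
have bM : horner_alg (bex x) (mp M) = 0 by rewrite -bex_horner xM raddf0.
have bchi : bex e * horner_alg (bex x) (mp chi) = 0 by rewrite -bex_horner -bexM ex0 raddf0.
have Mu : (mp M).[u] != 0 by rewrite -tofrac_horner.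
have [y0 [Uy yU ey]] : exists y0 : BK, [/\ (u *: 1 - bex x) * y0 = 1,
    y0 * (u *: 1 - bex x) = 1 &
    (mp chi).[u] *: (bex e * y0) = bex e * horner_alg (bex x) (dquo (mp chi) u)].
  by eexists; exact: (resolvent_dquo Mu bM bchi).
rewrite -tofrac_horner in ey.
set R := horner_alg (bex x) (dquo (mp chi) u) in ey.
have tchi : tofrac chi = (u - const_frac c) * tofrac h by rewrite rmorphM rmorphB.
have h0 : tofrac h != 0 :> K.
  by rewrite tofrac_eq0; apply: contraNneq hc => ->; rewrite horner0.
have eyE := scale_div h0 tchi ey.
pose P d : {poly F} := \sum_(i < size chi) \sum_(j < i)
  (chi`_i * (e * x ^+ (i.-1 - j) : B) d) *: 'X^j.
have PE d : (bex e * R) d = tofrac (P d).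
  have sc (a b : F) j : const_frac a * u ^+ j * const_frac b = tofrac ((a * b) *: 'X^j).
    by rewrite -mul_polyC polyCM !rmorphM rmorphXn /= mulrAC.
  have -> : bex e * R = \sum_(i < size chi) \sum_(j < i)
      (const_frac chi`_i * u ^+ j) *: bex (e * x ^+ (i.-1 - j)).
    rewrite /R mul_horner_dquo size_map_poly; apply: eq_bigr => i _.
    apply: eq_bigr => j _. rewrite coef_map. rewrite -bexX. rewrite -bexM. reflexivity.
  rewrite sum_ffunE rmorph_sum; apply: eq_bigr => i _.
  rewrite sum_ffunE rmorph_sum; apply: eq_bigr => j _.
  by rewrite !ffunE; exact: sc.
have chi_c : dquo chi c = h.
  have := dquoE chi c; rewrite {3}/chi hornerM hornerXsubC subrr mul0r subr0 => e1.
  by apply: (mulfI (negbT (polyXsubC_eq0 c))).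
have Pc d : (P d).[c] = (e * horner_alg x h) d.
  rewrite -chi_c mul_horner_dquo sum_ffunE horner_sum; apply: eq_bigr => i _.
  rewrite sum_ffunE horner_sum; apply: eq_bigr => j _.
  rewrite brauer_scaleE hornerZ hornerXn.
  exact: (mulrAC chi`_i ((e * x ^+ (i.-1 - j) : B) d) (c ^+ j)).
have val d : frac_value (((u - const_frac c) *: (bex e * y0)) d) c ((h.[c])^-1 * (e * horner_alg x h) d).
  rewrite eyE brauer_scaleE PE; exists (P d), h; split=> //; first exact: mulrC.
  by rewrite Pc; exact: mulrC.
move=> E; split=> [[y [h1 h2 h3]]|->].
  have yE : y = y0.
    have h1' : (u *: 1 - bex x) * (y : BK) = 1 by exact: h1.
    exact: (inverse_unique h1' yU).
  apply/ffunP => d; rewrite brauer_scaleE; apply: (frac_value_unique (h3 d)).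
  by rewrite yE; exact: val.
exists y0; split=> [||d].
- exact: Uy.
- exact: yU.
by rewrite [X in frac_value _ _ X]brauer_scaleE; exact: val.
Qed.

End Extension.

(** * The tableau idempotents *)

Section JMAlgebra.
Variables (F : fieldType) (om : F).

(** The commutative subalgebra generated by the Jucys-Murphy elements. *)
Inductive JMalg m : Br om m -> Prop :=
| JMalg_scalar a : JMalg a%:A
| JMalg_JM i : JMalg (JM om i)
| JMalg_add x y : JMalg x -> JMalg y -> JMalg (x + y)
| JMalg_mul x y : JMalg x -> JMalg y -> JMalg (x * y).

Lemma JMalg_scale m a (x : Br om m) : JMalg x -> JMalg (a *: x).
Proof. by move=> hx; rewrite -[x]mul1r scalerAl; apply/JMalg_mul/hx/JMalg_scalar. Qed.

Lemma JMalg1 m : JMalg (1 : Br om m).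
Proof. by rewrite -[1]scale1r; apply: JMalg_scalar. Qed.

Lemma JMalg_horner m (x : Br om m) p : JMalg x -> JMalg (horner_alg x p).
Proof.
move=> hx; rewrite horner_algE; elim/big_ind: _ => [|y z|i _].
- by rewrite -(scale0r 1); apply: JMalg_scalar.
- exact: JMalg_add.
apply: JMalg_scale; elim: (i : nat) => [|j IH]; first exact: JMalg1.
by rewrite exprS; apply: JMalg_mul.
Qed.

Lemma JMalg_comm m (x y : Br om m) : JMalg x -> (forall i, GRing.comm y (JM om i)) ->
  GRing.comm y x.
Proof.
move=> hx hy; elim: hx => {x} [a|i|x z _ cx _ cz|x z _ cx _ cz] //.
- by rewrite /GRing.comm -scalerAl -scalerAr mul1r mulr1.
- exact: commrD.
exact: commrM.
Qed.

Lemma JMalg_comm2 m (x y : Br om m) : JMalg x -> JMalg y -> GRing.comm x y.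
Proof.
move=> hx hy; apply: JMalg_comm => // i; apply: commr_sym.
by apply: JMalg_comm => // j; apply: JM_comm.
Qed.

Lemma bflip_JMalg m (x : Br om m) : JMalg x -> bflip x = x.
Proof.
move=> hx; elim: hx => {x} [a|i|x z _ cx _ cz|x z hx cx hz cz].
- by rewrite linearZ /= bflip1.
- exact: bflip_JM.
- by rewrite raddfD /= cx cz.
by rewrite bflipM cx cz; apply: JMalg_comm2.
Qed.

Lemma JMalg_bw m (x : Br om m) : JMalg x -> JMalg (bw x).
Proof.
move=> hx; elim: hx => {x} [a|i|x z _ cx _ cz|x z hx cx hz cz].
- by rewrite linearZ /= bw1; apply: JMalg_scalar.
- by rewrite bw_JM; apply: JMalg_JM.
- by rewrite raddfD; apply: JMalg_add.
by rewrite bwM; apply: JMalg_mul.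
Qed.

(** The ideal spanned by the diagrams with a horizontal edge; the quotient is the
    group algebra of the symmetric group. *)
Definition nonperm m (x : Br om m) : Prop := forall d, is_permd d -> x d = 0.

Lemma nonperm_sum m (x : Br om m) : nonperm x ->
  x = \sum_(d | ~~ is_permd d) (x d : F) *: bd om d.
Proof.
move=> hx; rewrite {1}(bd_sum x) [RHS]big_mkcond; apply: eq_bigr => d _.
by case: ifP => // /negbFE/hx ->; rewrite scale0r.
Qed.

Lemma nonpermD m (x y : Br om m) : nonperm x -> nonperm y -> nonperm (x + y).
Proof. by move=> hx hy d hd; rewrite ffunE hx // hy // addr0. Qed.

Lemma nonpermZ m a (x : Br om m) : nonperm x -> nonperm (a *: x).
Proof. by move=> hx d hd; rewrite ffunE hx // scaler0. Qed.

Lemma nonperm0 m : nonperm (0 : Br om m).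
Proof. by move=> d _; rewrite ffunE. Qed.

Lemma nonperm_bd m (d : diagram m) : ~~ is_permd d -> nonperm (bd om d).
Proof.
by move=> hd d' hd'; rewrite ffunE; case: eqP => // e; rewrite -e hd' in hd.
Qed.

Lemma nonpermMr m (x y : Br om m) : nonperm y -> nonperm (x * y).
Proof.
move=> hy; elim/bd_ind: x => [|d|a x x' ex ex']; first by rewrite mul0r; apply: nonperm0.
  rewrite (nonperm_sum hy) mulr_sumr; elim/big_ind: _ => [|u v|d' hd'].
  - exact: nonperm0.
  - exact: nonpermD.
  rewrite -scalerAr bd_mul; do 2!apply: nonpermZ; apply: nonperm_bd.
  exact: not_permd_compr.
by rewrite mulrDl -scalerAl; apply/nonpermD/ex'/nonpermZ.
Qed.

Lemma nonpermMl m (x y : Br om m) : nonperm x -> nonperm (x * y).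
Proof.
move=> hx; elim/bd_ind: y => [|d|a y y' ey ey']; first by rewrite mulr0; apply: nonperm0.
  rewrite (nonperm_sum hx) mulr_suml; elim/big_ind: _ => [|u v|d' hd'].
  - exact: nonperm0.
  - exact: nonpermD.
  rewrite -scalerAl bd_mul; do 2!apply: nonpermZ; apply: nonperm_bd.
  exact: not_permd_compl.
by rewrite mulrDr -scalerAr; apply/nonpermD/ey'/nonpermZ.
Qed.

Lemma nonperm_horner m (x y : Br om m) p : nonperm (x - y) -> nonperm (horner_alg x p - horner_alg y p).
Proof.
move=> h; have hX i : nonperm (x ^+ i - y ^+ i).
  elim: i => [|i IH]; first by rewrite subrr; apply: nonperm0.
  have -> : x ^+ i.+1 - y ^+ i.+1 = (x - y) * x ^+ i + y * (x ^+ i - y ^+ i).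
    by rewrite mulrBl mulrBr !exprS addrA subrK.
  by apply: nonpermD; [apply: nonpermMl | apply: nonpermMr].
rewrite !horner_algE -sumrB; elim/big_ind: _ => [|u v|i _].
- exact: nonperm0.
- exact: nonpermD.
by rewrite -scalerBr; apply: nonpermZ.
Qed.

Lemma nonperm_eps m (a b : 'I_m) : a != b -> nonperm (beps' om a b).
Proof.
move=> ab; rewrite bepsE; apply/nonperm_bd/(@not_permd _ _ a b).
by rewrite ffunE eqxx.
Qed.

Lemma JM_mod_nonperm m (b : 'I_m) : nonperm (JM om b - (kappa om *: 1 + JMs om b)).
Proof.
rewrite JM_JMs addrAC subrr add0r -sumrN.
elim/big_ind: _ => [|u v|a ab].
- exact: nonperm0.
- exact: nonpermD.
by rewrite -scaleN1r; apply/nonpermZ/nonperm_eps/ltn_neq.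
Qed.

Lemma kills_nonperm m (E x : Br om m) : (forall d, ~~ is_permd d -> E * bd om d = 0) ->
  nonperm x -> E * x = 0.
Proof.
move=> h /nonperm_sum ->; rewrite mulr_sumr big1 // => d hd.
by rewrite -scalerAr h // scaler0.
Qed.

End JMAlgebra.

Lemma bw_scalar (F : fieldType) (om : F) m a : bw (a%:A : Br om m) = a%:A.
Proof. by rewrite linearZ /= bw1. Qed.

Section Idempotents.
Variables (F : fieldType) (om : F).
Hypotheses (om0 : om != 0) (two : (2 : F) != 0).
Variable c : nat -> F.

(** The properties of [E_T] for a tableau with contents [c 0, c 1, ...]: it is
    the idempotent on which the Jucys-Murphy elements act by the contents, and it
    kills the ideal spanned by the diagrams with horizontal edges.  By [ti_one] it
    fixes every vector on which the Jucys-Murphy elements act by the contents. *)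
Record tab_idem m (E : Br om m) : Prop := TabIdem {
  ti_alg : JMalg E;
  ti_JM : forall i : 'I_m, E * JM om i = c i *: E;
  ti_kill : forall d, ~~ is_permd d -> E * bd om d = 0;
  ti_idem : E * E = E;
  ti_one : exists b : 'I_m -> Br om m, E = 1 + \sum_i b i * (JM om i - (c i)%:A) }.

Lemma eigen_horner m (E x : Br om m) a p : E * x = a *: E -> E * horner_alg x p = p.[a] *: E.
Proof.
move=> Ex; have ExX i : E * x ^+ i = a ^+ i *: E.
  by elim: i => [|i IH]; rewrite ?expr0 ?mulr1 ?scale1r // exprSr mulrA IH -scalerAl Ex scalerA exprSr.
rewrite horner_algE mulr_sumr horner_coef scaler_suml; apply: eq_bigr => i _.
by rewrite -scalerAr ExX scalerA.
Qed.

Lemma ti_flip m (E : Br om m) : tab_idem E -> bflip E = E.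
Proof. by move=> hE; apply/bflip_JMalg/ti_alg. Qed.

Lemma ti_kill_eps m (E : Br om m) : tab_idem E -> forall a b, a != b -> E * beps' om a b = 0.
Proof. by move=> hE a b ab; apply: kills_nonperm (ti_kill hE) _; apply: nonperm_eps. Qed.

Lemma ti_bw_JM m (E : Br om m) : tab_idem E -> forall i : 'I_m.+1, (i < m)%N ->
  bw E * JM om i = c i *: bw E.
Proof.
move=> hE i im; have -> : i = widen_ord (leqnSn m) (Ordinal im) by apply: val_inj.
by rewrite -bw_JM -bwM (ti_JM hE) linearZ.
Qed.

Lemma ti_bw_eps m (E : Br om m) : tab_idem E -> forall a b : 'I_m.+1, a != b ->
  (a < m)%N -> (b < m)%N -> bw E * beps' om a b = 0.
Proof.
move=> hE a b ab am bm.
have ea : a = widen_ord (leqnSn m) (Ordinal am) by apply: val_inj.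
have eb : b = widen_ord (leqnSn m) (Ordinal bm) by apply: val_inj.
rewrite ea eb -bw_eps -bwM ti_kill_eps ?raddf0 //.
Qed.

Lemma ti_bw_comm m (E : Br om m) p : tab_idem E ->
  GRing.comm (bw E) (horner_alg (JM om (ord_max : 'I_m.+1)) p).
Proof.
move=> hE; apply: JMalg_comm2; first exact/JMalg_bw/ti_alg.
exact/JMalg_horner/JMalg_JM.
Qed.

Definition crossing_poly (m : nat) : {poly F} := \prod_(0 <= i < m) ('X + (c i)%:P).

(** A top edge between two dots below the last one is absorbed by an elementary
    diagram that [E] kills; an edge that reaches the last dot is dealt with by
    [crossing_annihilated]. *)
Lemma ti_bw_kill m (E : Br om m) : tab_idem E -> forall d, ~~ is_permd d ->
  bw E * horner_alg (JM om (ord_max : 'I_m.+1)) (crossing_poly m) * bd om d = 0.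
Proof.
move=> hE d nd; have [a [b [ab dab]]] := top_edge nd.
wlog lab : a b ab dab / (a < b)%N.
  move=> h; case: (ltngtP a b) => [l|l|/val_inj e]; first exact: (h a b).
    by apply: (h b a) => //; rewrite 1?eq_sym // -dab mateK.
  by rewrite e eqxx in ab.
have := ltn_ord b; rewrite ltnS leq_eqVlt => /orP[/eqP bm|bm].
  have eb : b = ord_max by apply: val_inj.
  rewrite eb in lab dab.
  apply: (crossing_annihilated two lab dab) => [i im|u v uv um vm].
    exact: ti_bw_JM.
  exact: ti_bw_eps.
rewrite (ti_bw_comm _ hE) -mulrA.
have -> : bd om d = om^-1 *: (beps' om a b * bd om d).
  by rewrite eps_absorb // scalerA mulVf // scale1r.
rewrite -scalerAr mulrA ti_bw_eps ?mul0r ?scaler0 ?mulr0 //.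
exact: ltn_trans lab bm.
Qed.

(** [E h(x) / h(c)] is the spectral projection of [x] onto its eigenvalue [c]
    inside [E].  It kills the diagrams with horizontal edges because the crossing
    polynomial acts on it by its value at [c m], a product of the nonzero numbers
    [c i + c m]. *)
Lemma tab_idem_step m (E : Br om m) (h : {poly F}) : tab_idem E ->
  (forall i, (i < m)%N -> c i + c m != 0) -> h.[c m] != 0 ->
  bw E * horner_alg (JM om (ord_max : 'I_m.+1)) (('X - (c m)%:P) * h) = 0 ->
  tab_idem ((h.[c m])^-1 *: (bw E * horner_alg (JM om (ord_max : 'I_m.+1)) h)).
Proof.
move=> hE cN hc ann; set x := JM om ord_max; set e := bw E in ann *.
set E1 := _ *: _; have ee : e * e = e by rewrite -bwM ti_idem.
have ce p : GRing.comm e (horner_alg x p) by apply: ti_bw_comm.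
have E1e : E1 * e = E1.
  by rewrite /E1 -scalerAl -mulrA -ce mulrA ee.
have E1x : E1 * x = c m *: E1.
  apply/eqP; rewrite -subr_eq0 /E1 -scalerAl [_ *: (_ *: _)]scalerA mulrC -scalerA -scalerBr.
  rewrite -mulrA scalerAr -mulrBr.
  have -> : horner_alg x h * x - c m *: horner_alg x h = horner_alg x (('X - (c m)%:P) * h).
    rewrite mulrC rmorphM rmorphB /= horner_algX horner_algC mulrBr -scalerAr mulr1.
    by [].
  by rewrite ann scaler0.
have algE1 : JMalg E1.
  by apply/JMalg_scale/JMalg_mul; [apply/JMalg_bw/ti_alg | apply/JMalg_horner/JMalg_JM].
split=> //.
- move=> i; have := ltn_ord i; rewrite ltnS leq_eqVlt => /orP[/eqP im|im].
    by rewrite im -E1x; congr (_ * JM om _); apply: val_inj.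
  rewrite /E1 -scalerAl -mulrA (_ : horner_alg x h * JM om i = JM om i * horner_alg x h).
    by rewrite mulrA ti_bw_JM // -scalerAl !scalerA mulrC.
  by apply: JMalg_comm2; [apply/JMalg_horner|]; apply: JMalg_JM.
- move=> d nd; have f0 : (crossing_poly m).[c m] != 0.
    rewrite /crossing_poly horner_prod prodf_seq_neq0; apply/allP => i.
    by rewrite mem_index_iota => /andP[_ im]; rewrite !hornerE addrC cN.
  apply: (scalerI f0); rewrite scaler0 scalerAl -(eigen_horner _ E1x) /E1.
  rewrite -!scalerAl ce -!mulrA [e * _]mulrA ti_bw_kill // mulr0 scaler0.
  by [].
- rewrite {2}/E1 -scalerAr mulrA E1e (eigen_horner _ E1x) scalerA mulVf // scale1r.
  by [].
have [b bE] := ti_one hE.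
pose g := (h.[c m])^-1 *: (e * horner_alg x (dquo h (c m))).
exists (fun i => if unlift ord_max i is Some j then bw (b j) else g).
rewrite big_ord_recr /= unlift_none.
have -> : \sum_(i < m) (if unlift ord_max (widen_ord (leqnSn m) i) is Some j then bw (b j) else g) *
    (JM om (widen_ord (leqnSn m) i) - (c i)%:A) = e - 1.
  rewrite /e bE raddfD /= bw1 addrC addKr raddf_sum; apply: eq_bigr => i _ /=.
  by rewrite {1}widen_lift liftK bwM raddfB /= bw_JM bw_scalar.
rewrite addrA [1 + _]addrC subrK /g -scalerAl -mulrA.
have := horner_dquo x h (c m).
have -> : (x - (c m)%:A) * horner_alg x (dquo h (c m)) = horner_alg x (dquo h (c m)) * (x - (c m)%:A).
  rewrite -[X in X - _](horner_algX x) -(horner_algC x) -rmorphB -!rmorphM /= mulrC.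
  by [].
move=> ->; rewrite mulrBr scalerBr -[in X in _ - X]scalerAr mulr1 scalerA mulVf // scale1r addrC subrK.
by [].
Qed.

End Idempotents.

Lemma JM_jm (F : fieldType) (om : F) m (b : 'I_m) : JM om b = jm om b :> Br om m.
Proof. by rewrite unlock. Qed.

Section Existence.
Variables (C : numClosedFieldType) (om : C).
Hypothesis om0 : om != 0.
Let two : (2 : C) != 0. Proof. by rewrite pnatr_eq0. Qed.

(** A polynomial with [c m] as a simple root that annihilates [E x].  The crossing
    polynomial, which does not vanish at [c m], sends [E] to an element that kills
    the diagrams with horizontal edges; modulo these, [x] is a shift of the
    diagonalizable element [JMs]. *)
Lemma spectral_factor (c : nat -> C) m (E : Br om m) : tab_idem c E ->
  (forall i, (i < m)%N -> c i + c m != 0) ->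
  exists2 h : {poly C}, h.[c m] != 0 &
    bw E * horner_alg (JM om (ord_max : 'I_m.+1)) (('X - (c m)%:P) * h) = 0.
Proof.
move=> hE cN; set x := JM om ord_max; set e := bw E.
have [rs urs rs0] := JMs_semisimple om (ord_max : 'I_m.+1).
pose g := c m - kappa om.
(* Whether or not [g] is an eigenvalue, it becomes a simple root. *)
have [rs' [g' urs' rs'0]] : exists rs', [/\ g \notin rs', uniq rs' &
    horner_alg (JMs om (ord_max : 'I_m.+1)) (('X - g%:P) * \prod_(r <- rs') ('X - r%:P)) = 0].
  case: (boolP (g \in rs)) => gr.
    exists (rem g rs); split; [by rewrite mem_rem_uniq // inE eqxx | exact: rem_uniq|].
    by rewrite -(big_cons _ _ g _ xpredT (fun r => 'X - r%:P)) /= -(perm_big _ (perm_to_rem gr)) rs0.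
  by exists rs; split=> //; rewrite rmorphM /= rs0 mulr0.
pose q : {poly C} := \prod_(r <- rs') ('X - r%:P).
pose sh (p : {poly C}) := p \Po ('X - (kappa om)%:P).
exists (crossing_poly c m * sh q).
  rewrite hornerM mulf_neq0 //.
    rewrite /crossing_poly horner_prod prodf_seq_neq0; apply/allP => i.
    by rewrite mem_index_iota => /andP[_ im]; rewrite !hornerE addrC cN.
  by rewrite /sh horner_comp hornerXsubC -/g -[_ == 0]/(root q g) root_prod_XsubC.
have shE (y : Br om m.+1) p : horner_alg (kappa om *: 1 + y) (sh p) = horner_alg y p.
  rewrite /sh comp_polyE [RHS]horner_algE rmorph_sum; apply: eq_bigr => i _.
  rewrite -mul_polyC rmorphM rmorphXn rmorphB /= horner_algX !horner_algC -scalerAl mul1r.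
  by rewrite addrC addKr.
have -> : ('X - (c m)%:P) * (crossing_poly c m * sh q) = crossing_poly c m * sh (('X - g%:P) * q).
  rewrite mulrCA; congr (_ * _); rewrite /sh comp_polyM comp_polyB comp_polyX comp_polyC.
  by rewrite -addrA -opprD -polyCD /g [kappa om + _]addrC subrK.
rewrite rmorphM mulrA; apply: (@kills_nonperm _ _ _ (e * horner_alg x (crossing_poly c m))).
  exact: ti_bw_kill.
have := @nonperm_horner _ om _ x (kappa om *: 1 + JMs om ord_max) (sh (('X - g%:P) * q)).
by rewrite shE rs'0 subr0; apply; apply: JM_mod_nonperm.
Qed.

Lemma tab_idem0 (c : nat -> C) : tab_idem c (bone C 0 : Br om 0).
Proof.
split.
- exact: JMalg1.
- by case.
- by move=> d /forallPn[[]].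
- exact: mulr1.
by exists (fun _ => 0); rewrite big_ord0 addr0.
Qed.

(** The tableau idempotents exist for a parameter that need not be generic: their
    regularity only rests on [c i + c j != 0]. *)
Lemma idem_spec (T : tableau) (M : nat) (c := fun r => content om T r.+1) :
  c 0 = kappa om -> (forall i j, (i < j < M)%N -> c i + c j != 0) ->
  forall m, (m <= M)%N -> tab_idem c (idem om T m : Br om m) /\
   ((m < M)%N -> exists h : {poly C}, [/\ h.[c m] != 0,
     bw (idem om T m) * horner_alg (JM om (ord_max : 'I_m.+1)) (('X - (c m)%:P) * h) = 0 &
     idem om T m.+1 = (h.[c m])^-1 *:
        (bw (idem om T m) * horner_alg (JM om (ord_max : 'I_m.+1)) h) :> Br om m.+1]).
Proof.
move=> c0 cN.
have step m : (m < M)%N -> tab_idem c (idem om T m : Br om m) ->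
   exists h : {poly C}, [/\ h.[c m] != 0,
     bw (idem om T m) * horner_alg (JM om (ord_max : 'I_m.+1)) (('X - (c m)%:P) * h) = 0 &
     idem om T m.+1 = (h.[c m])^-1 *:
        (bw (idem om T m) * horner_alg (JM om (ord_max : 'I_m.+1)) h) :> Br om m.+1].
  case: m => [|m] mM hE.
    exists 1; rewrite rmorph1 !mulr1 hornerC oner_neq0; split=> //.
      rewrite -/(1 : Br om 0) rmorphB /= horner_algX horner_algC.
      suff -> : JM om (ord_max : 'I_1) = (c 0)%:A by rewrite subrr mulr0.
      by rewrite c0 JME big_pred0 ?addr0 // => a; rewrite ord1.
    by rewrite invr1 scale1r [RHS]bw1.
  have [h hc ann] := spectral_factor hE (fun i im => cN i m.+1 (introT andP (conj im mM))).
  exists h; split=> //=.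
  have uq := resolvent_simple_root hc ann.
  apply: classical_sets.xget_unique => [|y] /=; rewrite JM_jm in uq *; last by move/(uq y).1.
  by apply/(uq _).2.
elim=> [_|m IH mM]; first by split; [exact: tab_idem0 | move=> /step; apply; exact: tab_idem0].
have [hE /(_ mM)[h [hc ann eE]]] := IH (ltnW mM).
have hE1 : tab_idem c (idem om T m.+1 : Br om m.+1).
  rewrite eE; apply: tab_idem_step => // i im.
  by apply: cN; rewrite im.
by split=> // /step; apply.
Qed.

End Existence.

(** * Operators on tensors and partial traces *)

Section Entries.
Variables (F : fieldType) (n m : nat).
Local Notation W := (tensor F n m).
Local Notation X := (mindex n m).
Implicit Types (A B : 'End(W)) (I J K : X) (t : W).

Lemma tensor_sum t : t = \sum_J (t J : F) *: tbasis F J.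
Proof.
apply/ffunP => I; rewrite sum_ffunE (bigD1 I) //= !ffunE eqxx big1 ?addr0.
  by rewrite /GRing.scale /= mulr1.
by move=> J /negPf JI; rewrite !ffunE eq_sym JI /GRing.scale /= mulr0.
Qed.

Lemma lfun_entry A t I : A t I = \sum_J entry A I J * t J.
Proof.
rewrite {1}(tensor_sum t) linear_sum sum_ffunE; apply: eq_bigr => J _.
by rewrite linearZ ffunE /GRing.scale /= mulrC.
Qed.

Lemma entryP A B : (forall I J, entry A I J = entry B I J) -> A = B.
Proof.
move=> h; apply/lfunP => t; apply/ffunP => I; rewrite !lfun_entry.
by apply: eq_bigr => J _; rewrite h.
Qed.

Lemma entry_operator (k : X -> X -> F) I J : entry (operator k) I J = k I J.
Proof.
have lin : linear (fun t : W => [ffun I => \sum_J k I J * t J] : W).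
  move=> a u v; apply/ffunP => L; rewrite !ffunE scaler_sumr -big_split.
  apply: eq_bigr => M _; rewrite !ffunE mulrDr; congr (_ + _).
  by rewrite /GRing.scale /= mulrCA.
pose f := GRing.isLinear.Build F W W _ _ lin.
pose g : {linear W -> W} := HB.pack (fun t : W => [ffun I => \sum_J k I J * t J] : W) f.
rewrite /entry /operator -[X in linfun X]/(g : W -> W) lfunE /= ffunE.
rewrite (bigD1 J) //= ffunE eqxx mulr1 big1 ?addr0 // => L /negPf LJ.
by rewrite ffunE LJ mulr0.
Qed.

Lemma entry_comp A B I J : entry (A \o B)%VF I J = \sum_K entry A I K * entry B K J.
Proof. by rewrite /entry comp_lfunE lfun_entry. Qed.

Lemma entry_id I J : entry \1%VF I J = (I == J)%:R :> F.
Proof. by rewrite /entry id_lfunE ffunE. Qed.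

Lemma entryD A B I J : entry (A + B) I J = entry A I J + entry B I J.
Proof. by rewrite /entry add_lfunE ffunE. Qed.

Lemma entryZ (a : F) A I J : entry (a *: A) I J = a * entry A I J.
Proof. by rewrite /entry scale_lfunE ffunE. Qed.

Lemma entryN A I J : entry (- A) I J = - entry A I J.
Proof. by rewrite /entry opp_lfunE ffunE. Qed.

Lemma entry_sum (T : finType) (f : T -> 'End(W)) I J :
  entry (\sum_i f i) I J = \sum_i entry (f i) I J.
Proof. by rewrite /entry sum_lfunE sum_ffunE. Qed.

Lemma prod_eqr (P : pred 'I_m) (I J : X) :
  \prod_(c < m | P c) (I c == J c)%:R = [forall (c | P c), I c == J c]%:R :> F.
Proof.
case: (boolP [forall (c | P c), _]) => [/forall_inP h|].
  by rewrite big1 // => c Pc; rewrite h.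
by case/forall_inPn => c Pc /negPf h; rewrite (bigD1 c) //= h mul0r.
Qed.

Lemma entry_P a b I J : a != b ->
  entry (P_op F n a b) I J = (I == [ffun c => J (tperm a b c)])%:R.
Proof.
move=> ab; rewrite entry_sum; under eq_bigr do rewrite entry_sum.
under eq_bigr => i _. under eq_bigr => j _ do rewrite entry_operator prod_eqr !mxE.
over.
rewrite (bigD1 (I a)) //= [X in _ + X]big1 ?addr0; last first.
  by move=> i /negPf ia; apply: big1 => j _; rewrite [I a == i]eq_sym ia /= !mul0r.
rewrite (bigD1 (J a)) //= [X in _ + X]big1 ?addr0; last first.
  by move=> j /negPf ja; rewrite [J a == j]eq_sym ja andbF !mul0r.
rewrite !eqxx /= mul1r -natrM mulnb; congr (_ %:R); congr nat_of_bool.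
apply/andP/eqP => [[/andP[/eqP Iba /eqP Jba] /forall_inP h]|->].
  apply/ffunP => c; rewrite ffunE; case: tpermP => [->|->|/eqP ca /eqP cb] //.
  by apply/eqP/h; rewrite ca cb.
rewrite !ffunE tpermL tpermR !eqxx; split=> //; apply/forall_inP => c /andP[ca cb].
by rewrite ffunE tpermD // eq_sym.
Qed.

Lemma entry_Q a b I J : a != b ->
  entry (Q_op F n a b) I J = eps F (I a) * eps F (J a) *
   [&& I b == rev_ord (I a), J b == rev_ord (J a) &
     [forall (c | (c != a) && (c != b)), I c == J c]]%:R.
Proof.
move=> ab; rewrite entry_sum; under eq_bigr do rewrite entry_sum.
under eq_bigr => i _. under eq_bigr => j _ do rewrite entryZ entry_operator prod_eqr !mxE.
over.
rewrite (bigD1 (I a)) //= [X in _ + X]big1 ?addr0; last first.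
  by move=> i /negPf ia; apply: big1 => j _; rewrite [I a == i]eq_sym ia /= !mul0r mulr0.
rewrite (bigD1 (J a)) //= [X in _ + X]big1 ?addr0; last first.
  by move=> j /negPf ja; rewrite [J a == j]eq_sym ja andbF !mul0r mulr0.
by rewrite !eqxx /= mul1r -natrM mulnb -andbA.
Qed.

End Entries.

Lemma extend_eq (C : finType) m (I J : {ffun 'I_m -> C}) i j :
  (extend I i == extend J j) = (I == J) && (i == j).
Proof.
apply/eqP/andP => [e|[/eqP-> /eqP->] //].
have := congr1 (@restrict _ _) e; rewrite !extendK => ->.
by have := congr1 (fun f : {ffun _ -> C} => f ord_max) e; rewrite !extend_max => ->.
Qed.

Section Amplify.
Variables (F : fieldType) (n m : nat).

(** The operator [A (x) 1]. *)
Definition ampl (A : 'End(tensor F n m)) : 'End(tensor F n m.+1) :=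
  operator (fun I J => entry A (restrict I) (restrict J) * (I ord_max == J ord_max)%:R).

Lemma entry_ampl A (I J : mindex n m) i j :
  entry (ampl A) (extend I i) (extend J j) = entry A I J * (i == j)%:R.
Proof. by rewrite entry_operator !extendK !extend_max. Qed.

Lemma entryP_extend (A B : 'End(tensor F n m.+1)) :
  (forall (I J : mindex n m) i j, entry A (extend I i) (extend J j) = entry B (extend I i) (extend J j)) -> A = B.
Proof. by move=> h; apply: entryP => I J; rewrite -(restrictK I) -(restrictK J). Qed.

Lemma sum_extend (f : mindex n m.+1 -> F) : \sum_K f K = \sum_(K : mindex n m) \sum_k f (extend K k).
Proof. exact: big_extend. Qed.

Lemma ampl_comp A B : ampl (A \o B)%VF = (ampl A \o ampl B)%VF.
Proof.
apply: entryP_extend => I J i j; rewrite entry_ampl !entry_comp sum_extend mulr_suml.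
apply: eq_bigr => K _; rewrite (bigD1 i) //= big1 ?addr0.
  by rewrite !entry_ampl eqxx mulr1 mulrA.
by move=> k /negPf ki; rewrite !entry_ampl [i == k]eq_sym ki mulr0 mul0r.
Qed.

Lemma ampl_id : ampl \1%VF = \1%VF.
Proof.
apply: entryP_extend => I J i j; rewrite entry_ampl !entry_id -natrM mulnb.
by rewrite extend_eq.
Qed.

Lemma ampl_linear : linear ampl.
Proof.
move=> a A B; apply: entryP_extend => I J i j.
by rewrite entryD entryZ !entry_ampl entryD entryZ mulrDl mulrA.
Qed.
HB.instance Definition _ := GRing.isLinear.Build F _ _ _ ampl ampl_linear.

Lemma ptrace_linear : linear (@ptrace F n m).
Proof.
move=> a A B; apply: entryP => I J; rewrite entryD entryZ !entry_operator mulr_sumr -big_split.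
by apply: eq_bigr => k _; rewrite entryD entryZ.
Qed.
HB.instance Definition _ := GRing.isLinear.Build F _ _ _ (@ptrace F n m) ptrace_linear.

Lemma entry_ptrace (A : 'End(tensor F n m.+1)) I J :
  entry (ptrace A) I J = \sum_k entry A (extend I k) (extend J k).
Proof. by rewrite entry_operator. Qed.

Lemma ptrace_ampl A B (Z : 'End(tensor F n m.+1)) :
  ptrace (ampl A \o Z \o ampl B)%VF = (A \o ptrace Z \o B)%VF.
Proof.
apply: entryP => I J; rewrite entry_ptrace entry_comp.
under eq_bigr do rewrite entry_comp sum_extend.
rewrite exchange_big; apply: eq_bigr => K _ /=.
rewrite entry_comp mulr_suml [RHS](eq_bigr (fun L => \sum_k entry A I L * entry Z (extend L k) (extend K k) * entry B K J)); last first.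
  by move=> L _; rewrite entry_ptrace mulr_sumr mulr_suml.
rewrite [RHS]exchange_big; apply: eq_bigr => k _ /=.
rewrite (bigD1 k) //= [X in _ + X]big1 ?addr0; last first.
  by move=> l /negPf lk; rewrite entry_ampl lk !mulr0.
rewrite entry_ampl eqxx mulr1 entry_comp sum_extend mulr_suml; apply: eq_bigr => L _.
congr (_ * _); rewrite (bigD1 k) //= big1 ?addr0; first by rewrite entry_ampl eqxx mulr1.
by move=> l /negPf lk; rewrite entry_ampl eq_sym lk mulr0 mul0r.
Qed.

Lemma ptrace_id : ptrace \1%VF = (2 * n)%:R *: (\1%VF : 'End(tensor F n m)).
Proof.
apply: entryP => I J; rewrite entry_ptrace entryZ -ampl_id.
under eq_bigr do rewrite entry_ampl eqxx mulr1.
by rewrite sumr_const card_ord mulr_natl.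
Qed.

Local Notation wd := (widen_ord (leqnSn m)).

Lemma ampl_P (a b : 'I_m) : a != b -> ampl (P_op F n a b) = P_op F n (wd a) (wd b).
Proof.
move=> ab; apply: entryP_extend => I J i j.
have wab : lift ord_max a != lift ord_max b by rewrite (inj_eq lift_inj).
rewrite !widen_lift entry_ampl !entry_P // -natrM mulnb; congr (_ %:R); congr nat_of_bool.
have tl c : tperm (lift ord_max a) (lift ord_max b) (lift ord_max c) = lift ord_max (tperm a b c).
  by case: (tpermP a b c) => [->|->|/eqP ia /eqP ib]; rewrite ?tpermL ?tpermR // tpermD //
    (inj_eq lift_inj) eq_sym.
apply/andP/eqP => [[/eqP eI /eqP ij]|/ffunP h].
  apply/ffunP => c; rewrite ffunE; case: (unliftP ord_max c) => [c' ->|->].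
    by rewrite tl !extend_lift eI ffunE.
  by rewrite tpermD ?extend_max // eq_sym neq_lift.
split.
  by apply/eqP/ffunP => c; have := h (lift ord_max c); rewrite !ffunE tl liftK liftK.
have := h ord_max; rewrite ffunE tpermD ?[lift _ _ == _]eq_sym ?neq_lift //.
by rewrite !extend_max => ->.
Qed.

Lemma ampl_Q (a b : 'I_m) : a != b -> ampl (Q_op F n a b) = Q_op F n (wd a) (wd b).
Proof.
move=> ab; apply: entryP_extend => I J i j.
have wab : lift ord_max a != lift ord_max b by rewrite (inj_eq lift_inj).
rewrite !widen_lift entry_ampl !entry_Q // !extend_lift -mulrA -natrM mulnb -!andbA.
congr (_ * (nat_of_bool [&& _, _ & _])%:R).
apply/andP/forall_inP => [[/forall_inP h /eqP ij] c|h].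
  case: (unliftP ord_max c) => [c' ->|->]; last by rewrite !extend_max ij.
  by rewrite !(inj_eq lift_inj) !extend_lift => /h.
split; last by have := h ord_max; rewrite !extend_max; apply; rewrite !neq_lift.
apply/forall_inP => c /andP[ca cb]; have := h (lift ord_max c).
by rewrite !extend_lift; apply; rewrite !(inj_eq lift_inj) ca.
Qed.

End Amplify.

Section LastTwo.
Variables (F : fieldType) (n k : nat).
Local Notation b := (ord_max : 'I_k.+2).
Local Notation a := (widen_ord (leqnSn k.+1) (ord_max : 'I_k.+1)).

Let aE : a = lift b (ord_max : 'I_k.+1). Proof. exact: widen_lift. Qed.
Let ab : a != b. Proof. by rewrite aE eq_sym neq_lift. Qed.

Lemma extend2_tperm (J : mindex n k) j1 j2 :
  [ffun c => extend (extend J j1) j2 (tperm a b c)] = extend (extend J j2) j1 :> mindex n k.+2.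
Proof.
apply/ffunP => c; rewrite ffunE; case: tpermP => [->|->|ca cb].
- by rewrite aE extend_lift !extend_max.
- by rewrite aE extend_lift !extend_max.
case: (unliftP ord_max c) cb ca => [c' ->|->] // _ ca; rewrite !extend_lift.
by case: (unliftP ord_max c') ca => [c'' ->|->] ca; rewrite ?extend_lift //; case: ca; rewrite aE.
Qed.

Lemma entry_P2 (I J : mindex n k) i1 i2 j1 j2 :
  entry (P_op F n a b) (extend (extend I i1) i2) (extend (extend J j1) j2) =
  [&& I == J, i1 == j2 & i2 == j1]%:R.
Proof. by rewrite entry_P // extend2_tperm !extend_eq andbA. Qed.

Lemma entry_Q2 (I J : mindex n k) i1 i2 j1 j2 :
  entry (Q_op F n a b) (extend (extend I i1) i2) (extend (extend J j1) j2) =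
  eps F i1 * eps F j1 * [&& I == J, i2 == rev_ord i1 & j2 == rev_ord j1]%:R.
Proof.
rewrite entry_Q // aE !extend_lift !extend_max; congr (_ * (nat_of_bool _)%:R).
suff -> : [forall (c | (c != lift ord_max ord_max) && (c != ord_max)),
    extend (extend I i1) i2 c == extend (extend J j1) j2 c] = (I == J).
  by rewrite andbA andbC.
apply/forall_inP/eqP => [h|-> c /andP[ca cb]].
  apply/ffunP => c; have := h (lift ord_max (lift ord_max c)).
  rewrite !extend_lift (inj_eq lift_inj) ![lift _ _ == _]eq_sym !neq_lift => /(_ isT).
  by move/eqP.
case: (unliftP ord_max c) cb ca => [c' ->|->]; last by rewrite eqxx.
move=> _; rewrite (inj_eq lift_inj) !extend_lift.
by case: (unliftP ord_max c') => [c'' ->|->]; rewrite ?extend_lift // eqxx.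
Qed.

Lemma sum_pick (C : finType) (c : C) (f : C -> F) : \sum_x (x == c)%:R * f x = f c.
Proof.
rewrite (bigD1 c) //= eqxx mul1r big1 ?addr0 // => x /negPf ->.
by rewrite mul0r.
Qed.

Lemma eps_sq (i : 'I_(2 * n)) : eps F i * eps F i = 1.
Proof. by rewrite /eps; case: ifP => _; rewrite ?mulrNN mulr1. Qed.

Lemma ptrace_P : ptrace (P_op F n a b) = \1%VF.
Proof.
apply: entryP_extend => I J i j; rewrite entry_ptrace entry_id extend_eq.
under eq_bigr do rewrite entry_P2.
rewrite (bigD1 i) //= big1 ?addr0 ?eqxx //= => l /negPf li.
by rewrite [i == l]eq_sym li andbF.
Qed.

Lemma ptrace_Q : ptrace (Q_op F n a b) = \1%VF.
Proof.
apply: entryP_extend => I J i j; rewrite entry_ptrace entry_id extend_eq.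
under eq_bigr do rewrite entry_Q2.
rewrite (bigD1 (rev_ord i)) //= big1 ?addr0 ?eqxx /=.
  case: (I == J); last by rewrite mulr0.
  rewrite (inj_eq rev_ord_inj); case: eqP => [->|_]; last by rewrite mulr0.
  by rewrite eps_sq mulr1.
by move=> l /negPf li; rewrite li andbF mulr0.
Qed.

(** [P] exchanges the last two factors, so that the trace falls on the factor on
    which [A] acts. *)
Lemma P_sandwich (A : 'End(tensor F n k.+1)) :
  ptrace (P_op F n a b \o ampl A \o P_op F n a b)%VF = ampl (ptrace A).
Proof.
apply: entryP_extend => I J i j; rewrite entry_ptrace entry_ampl entry_ptrace mulr_suml.
apply: eq_bigr => l _; rewrite entry_comp.
under eq_bigr => L _ do rewrite entry_P // mulrC.
rewrite (eq_bigr (fun L => (L == extend (extend J l) j)%:R *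
   entry (P_op F n a b \o ampl A)%VF (extend (extend I i) l) L)); last first.
  move=> L _; congr ((nat_of_bool _)%:R * _); apply/eqP/eqP => ->.
    exact: extend2_tperm.
  by rewrite extend2_tperm.
rewrite sum_pick entry_comp.
rewrite (eq_bigr (fun L => (L == extend (extend I l) i)%:R * entry (ampl A) L (extend (extend J l) j))); last first.
  move=> L _; rewrite entry_P //; congr ((nat_of_bool _)%:R * _); apply/eqP/eqP => [e|->].
    rewrite -extend2_tperm e; apply/ffunP => c; rewrite !ffunE tpermK.
    by [].
  by rewrite extend2_tperm.
by rewrite sum_pick entry_ampl.
Qed.

(** [Q] is, up to normalization, the projection onto an invariant vector of the
    last two factors, and [A (x) 1] has there the expectation [ptrace A / N]. *)
Lemma Q_sandwich (A : 'End(tensor F n k.+1)) :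
  (Q_op F n a b \o ampl A \o Q_op F n a b)%VF = (ampl (ampl (ptrace A)) \o Q_op F n a b)%VF.
Proof.
apply: entryP_extend => I0 J0 i2 j2; rewrite -(restrictK I0) -(restrictK J0).
set I := restrict I0; set i1 := I0 _; set J := restrict J0; set j1 := J0 _.
pose q (x y : 'I_(2 * n)) : F := eps F x * (y == rev_ord x)%:R.
have QE (K L : mindex n k) x1 x2 y1 y2 :
    entry (Q_op F n a b) (extend (extend K x1) x2) (extend (extend L y1) y2) =
    (K == L)%:R * q x1 x2 * q y1 y2.
  rewrite entry_Q2 /q; case: (K == L); last by rewrite mulr0 !mul0r.
  by rewrite /= -mulnb natrM mul1r mulrACA.
rewrite !entry_comp [RHS](_ : _ = entry (ptrace A) I J * q i1 i2 * q j1 j2); last first.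
  rewrite sum_extend sum_extend (bigD1 J) //= [X in _ + X]big1 ?addr0; last first.
    move=> K /negPf KJ; apply: big1 => x1 _; apply: big1 => x2 _.
    by rewrite QE KJ !mul0r mulr0.
  rewrite (bigD1 i1) //= [X in _ + X]big1 ?addr0; last first.
    move=> x1 /negPf xi; apply: big1 => x2 _.
    by rewrite !entry_ampl eq_sym xi mulr0 !mul0r.
  rewrite (bigD1 i2) //= [X in _ + X]big1 ?addr0; last first.
    by move=> x2 /negPf xi; rewrite entry_ampl eq_sym xi mulr0 !mul0r.
  by rewrite QE !entry_ampl !eqxx !mulr1 mul1r mulrA.
rewrite sum_extend sum_extend (bigD1 J) //= [X in _ + X]big1 ?addr0; last first.
  move=> K /negPf KJ; apply: big1 => x1 _; apply: big1 => x2 _.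
  by rewrite QE KJ !mul0r mulr0.
rewrite entry_ptrace !mulr_suml; apply: eq_bigr => x1 _.
rewrite (bigD1 (rev_ord x1)) //= [X in _ + X]big1 ?addr0; last first.
  by move=> x2 /negPf h; rewrite QE /q h !mulr0 mul0r mulr0.
rewrite entry_comp sum_extend sum_extend (bigD1 I) //= [X in _ + X]big1 ?addr0; last first.
  move=> K /negPf KI; apply: big1 => y1 _; apply: big1 => y2 _.
  by rewrite QE eq_sym KI !mul0r.
rewrite (bigD1 x1) //= [X in _ + X]big1 ?addr0; last first.
  move=> y1 /negPf yx; apply: big1 => y2 _; rewrite QE entry_ampl /q.
  case: (eqVneq y2 (rev_ord y1)) => [->|_]; last by rewrite !mulr0 mul0r.
  by rewrite (inj_eq rev_ord_inj) yx !mulr0.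
rewrite (bigD1 (rev_ord x1)) //= [X in _ + X]big1 ?addr0; last first.
  by move=> y2 /negPf h; rewrite QE /q h !mulr0 mul0r.
rewrite !QE entry_ampl !eqxx /q eqxx !mulr1 !mul1r.
transitivity (entry A (extend I x1) (extend J x1) * (eps F i1 * (i2 == rev_ord i1)%:R) *
  (eps F j1 * (j2 == rev_ord j1)%:R) * (eps F x1 * eps F x1)); first by ring.
by rewrite eps_sq mulr1.
Qed.

End LastTwo.

(** * The closures of the resolvents *)

Section Action.
Variables (F : fieldType) (n : nat).
Local Notation om := (brauer_omega F n).
Variable act : forall m, {linear brauer F m -> 'End(tensor F n m)}.
Hypothesis hact : forall m, tensor_action (act m).
Local Notation bw := (@bw F om _).

Lemma act1 m : act m (1 : Br om m) = \1%VF.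
Proof. by have [[h _] _] := hact m; exact: h. Qed.

Lemma actM m (x y : Br om m) : act m (x * y) = (act m x \o act m y)%VF.
Proof. by have [[_ h] _] := hact m; exact: h. Qed.

Lemma actD m (x y : Br om m) : act m (x + y) = act m x + act m y.
Proof. exact: (linearD (act m)). Qed.

Lemma actB m (x y : Br om m) : act m (x - y) = act m x - act m y.
Proof. exact: (linearB (act m)). Qed.

Lemma actZ m a (x : Br om m) : act m (a *: x) = a *: act m x.
Proof. exact: (linearZ_LR (act m)). Qed.

Lemma act_tr m (a b : 'I_m) : (a < b)%N -> act m (bperm om (tperm a b)) = - P_op F n a b.
Proof. by move=> ab; have [_ /(_ _ _ ab)[<- _]] := hact m; rewrite (bsE om). Qed.

Lemma act_eps m (a b : 'I_m) : (a < b)%N -> act m (beps' om a b) = - Q_op F n a b.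
Proof. by move=> ab; have [_ /(_ _ _ ab)[_ <-]] := hact m. Qed.

(** Only for the subalgebra generated by the Jucys-Murphy elements, whose images
    are known from those of the transpositions and of the elementary diagrams. *)
Lemma act_bw m (x : Br om m) : JMalg x -> act m.+1 (bw x) = ampl (act m x).
Proof.
elim=> {x} [a|i|x y _ hx _ hy|x y _ hx _ hy].
- by rewrite bw_scalar !actZ !act1 linearZ /= ampl_id.
- rewrite bw_JM !JME !actD !actZ !act1 linearD linearZ /= ampl_id; congr (_ + _).
  pose f m' (z : Br om m') := act m' z.
  have fs m' (I : finType) (P : pred I) (g : I -> Br om m') :
     act m' (\sum_(i | P i) g i) = \sum_(i | P i) act m' (g i) by exact: (linear_sum (act m')).
  rewrite !fs linear_sum [LHS]big_mkcond big_ord_recr /= ifF ?addr0; last by rewrite ltnNge ltnW.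
  rewrite -big_mkcond; apply: eq_big => a // ai.
  rewrite !actB !act_tr // !act_eps // linearB !linearN /= ampl_P ?ampl_Q //; exact: ltn_neq.
- by rewrite raddfD /= !actD hx hy linearD.
by rewrite bwM !actM hx hy ampl_comp.
Qed.

(** The closure of the last strand.  The sign makes a closed loop count for
    [om = - N]. *)
Definition cl m (x : Br om m.+1) : 'End(tensor F n m) := - ptrace (act m.+1 x).

Lemma clD m (x y : Br om m.+1) : cl (x + y) = cl x + cl y.
Proof. by rewrite /cl actD linearD opprD. Qed.

Lemma clB m (x y : Br om m.+1) : cl (x - y) = cl x - cl y.
Proof. by rewrite /cl actB linearB opprD. Qed.

Lemma clZ m a (x : Br om m.+1) : cl (a *: x) = a *: cl x.
Proof. by rewrite /cl actZ linearZ /= scalerN. Qed.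

Lemma cl_bw m (A B : Br om m) (X : Br om m.+1) : JMalg A -> JMalg B ->
  cl (bw A * X * bw B) = (act m A \o cl X \o act m B)%VF.
Proof.
move=> hA hB; rewrite /cl !actM !act_bw // ptrace_ampl.
by rewrite comp_lfunNr comp_lfunNl.
Qed.

Lemma cl_bwl m (A : Br om m) (X : Br om m.+1) : JMalg A -> cl (bw A * X) = (act m A \o cl X)%VF.
Proof.
move=> hA; have := cl_bw X hA (JMalg1 om m).
by rewrite bw1 mulr1 act1 comp_lfun1r.
Qed.

Lemma cl1 m : cl (1 : Br om m.+1) = om *: \1%VF.
Proof. by rewrite /cl act1 ptrace_id scaleNr. Qed.

Section LastTwoStrands.
Variable k : nat.
Local Notation b := (ord_max : 'I_k.+2).
Local Notation a := (widen_ord (leqnSn k.+1) (ord_max : 'I_k.+1)).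
Local Notation s := (bperm om (tperm a b) : Br om k.+2).
Local Notation e := (beps' om a b : Br om k.+2).

Let ab : (a < b)%N. Proof. by rewrite /=. Qed.
Let nab : a != b. Proof. exact: ltn_neq. Qed.

Lemma cl_s : cl s = \1%VF.
Proof. by rewrite /cl act_tr // linearN /= ptrace_P opprK. Qed.

Lemma cl_e : cl e = \1%VF.
Proof. by rewrite /cl act_eps // linearN /= ptrace_Q opprK. Qed.

Lemma cl_s_conj (Y : Br om k.+1) : JMalg Y -> cl (s * bw Y * s) = ampl (cl Y).
Proof.
move=> hY; rewrite /cl !actM act_bw // act_tr //.
rewrite !(comp_lfunNl, comp_lfunNr) opprK P_sandwich linearN.
by [].
Qed.

(** In a diagram of the form [e Y e], the last strand of [Y] is closed. *)
Lemma act_e_conj (Y : Br om k.+1) : JMalg Y ->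
  act k.+2 (e * bw Y * e) = (ampl (ampl (cl Y)) \o act k.+2 e)%VF.
Proof.
move=> hY; rewrite /cl !actM act_bw // act_eps //.
by rewrite !(comp_lfunNl, comp_lfunNr) opprK Q_sandwich !linearN /= !comp_lfunNl opprK.
Qed.

(** The recursion for the closures of the resolvents [y], [z] of consecutive
    Jucys-Murphy elements, compressed by [E].  Sliding [s] through the resolvent
    gives [z s = s y + z y - z e y], and crossing an edge turns the resolvent at
    [u] into the opposite of the resolvent [y'] at [- u].  Applied twice to
    [z = (z s) s], this expresses the compressed closure of [z] through itself,
    through the closure of [y] and through the scalars [p] and [- q] by which [y]
    and [y'] act on [E]. *)
Lemma resolvent_closure_step (c : nat -> F) (E : Br om k.+1) (E' : Br om k)
    (u r : F) (y y' : Br om k.+1) (z z' : Br om k.+2)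
    (p := (u - c k)^-1) (q := (u + c k)^-1) :
  (2 : F) != 0 -> u - c k != 0 -> u + c k != 0 -> 1 - p ^+ 2 != 0 ->
  tab_idem c E -> tab_idem c E' -> E * bw E' = E ->
  JMalg y -> JMalg y' -> JMalg z -> JMalg z' ->
  y * (u *: 1 - JM om ord_max) = 1 -> y' * (- u *: 1 - JM om ord_max) = 1 ->
  z * (u *: 1 - JM om b) = 1 -> z' * (- u *: 1 - JM om b) = 1 ->
  cl (bw E' * y) = r *: act k E' ->
  cl (bw E * z) = ((r * (1 - q ^+ 2) + (p ^+ 2 - q ^+ 2) - p * q * (p - q)) / (1 - p ^+ 2)) *: act k.+1 E.
Proof.
move=> two uc uc' p1 hE hE' EE' jy jy' jz jz' yK y'K zK z'K hr.
have bwi (Y : Br om k.+1) v : Y * (v *: 1 - JM om ord_max) = 1 ->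
    bw Y * (v *: 1 - JM om a) = 1.
  by move=> h; rewrite -bw_JM -(bw_scalar om k.+1 v) -raddfB /= -bwM h bw1.
set ya := bw y; set ya' := bw y'.
have yaK : ya * (u *: 1 - JM om a) = 1 by apply: bwi.
have ya'K : ya' * (- u *: 1 - JM om a) = 1 by apply: bwi.
have jya : JMalg ya by apply: JMalg_bw.
have jya' : JMalg ya' by apply: JMalg_bw.
have jsub (v : F) i : JMalg (v *: 1 - JM om i : Br om k.+2).
  rewrite -scaleN1r; apply: JMalg_add; first exact: JMalg_scalar.
  by apply: JMalg_scale; apply: JMalg_JM.
have xs := JM_adj om (erefl : b = a.+1 :> nat).
have slide (v : F) (Y Z : Br om k.+2) : Y * (v *: 1 - JM om a) = 1 ->
    Z * (v *: 1 - JM om b) = 1 -> JMalg Y -> JMalg Z ->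
    Z * s = s * Y + Z * Y - Z * e * Y.
  move=> hY hZ jY jZ.
  have hY' : (v *: 1 - JM om a) * Y = 1 by rewrite (JMalg_comm2 (jsub v a) jY).
  have e1 : (v *: 1 - JM om b) * s = s * (v *: 1 - JM om a) - 1 + e.
    rewrite mulrBl xs mulrBr -scalerAl -scalerAr mul1r mulr1.
    by rewrite !opprD opprK !addrA.
  have := congr1 (fun x => Z * x * Y) e1; rewrite /= mulrA hZ mul1r => e2.
  have e3 : s * Y = Z * s - Z * Y + Z * e * Y.
    rewrite e2 mulrDr mulrDl mulrBr mulrBl mulr1; congr (_ - _ + _).
    by rewrite -!mulrA hY' mulr1.
  by rewrite e3 addrAC addrK subrK.
(* The sliding relation is used at [u] and at [- u]. *)
have sl1 := slide u ya z yaK zK jya jz.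
have sl2 := slide (- u) ya' z' ya'K z'K jya' jz'.
have cross : JM om b * e = - (JM om a * e).
  rewrite (bepsE om nab) (@JM_cross _ _ _ a b (epsd nab) two ab); last by rewrite ffunE eqxx.
  rewrite mulNr; congr (- (_ * _)); rewrite /JMat JME; congr (_ + _).
  apply: eq_big => [i|i _]; last by rewrite trC bepsC.
  by rewrite ltnS -(inj_eq val_inj) /= ltn_neqAle andbC.
have ze : z * e = - (ya' * e).
  have h : (u *: 1 - JM om b) * (- (ya' * e)) = e.
    rewrite mulrN mulrA (JMalg_comm2 (jsub u b) jya') -mulrA mulrBl cross opprK.
    have -> : u *: 1 * e + JM om a * e = - ((- u *: 1 - JM om a) * e).
      by rewrite mulrBl scaleNr mulNr opprB opprK addrC.
    by rewrite mulrN opprK mulrA ya'K mul1r.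
  by rewrite -{1}h mulrA zK mul1r.
have ey : e * ya = - (e * z').
  have := congr1 (@bflip F om k.+2) cross; rewrite raddfN /= !bflipM bflip_eps !bflip_JM => cross'.
  have h : e * z' * (u *: 1 - JM om a) = - e.
    rewrite -mulrA (JMalg_comm2 jz' (jsub u a)) mulrA mulrBr -[e * JM om a]opprK -cross' opprK.
    have -> : e * (u *: 1) + e * JM om b = - (e * (- u *: 1 - JM om b)).
      by rewrite mulrBr scaleNr mulrN opprB opprK addrC.
    by rewrite mulNr -mulrA (JMalg_comm2 (jsub _ b) jz') z'K mulr1.
  have -> : e * z' = e * z' * (u *: 1 - JM om a) * ya.
    by rewrite -[in RHS]mulrA (JMalg_comm2 (jsub u a) jya) yaK mulr1.
  by rewrite h mulNr opprK.
have es : e * s = e by rewrite eps_tr.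
have jE : JMalg E := ti_alg hE.
set A := act k.+1 E.
(* Compressed by [E] on both sides, [ya] and [ya'] act as the scalars [p] and [- q]. *)
pose tau (X : Br om k.+2) := (A \o cl X \o A)%VF.
have tauE X : tau X = cl (bw E * X * bw E) by rewrite cl_bw.
have tauD X Y : tau (X + Y) = tau X + tau Y by rewrite /tau clD comp_lfunDr comp_lfunDl.
have tauB X Y : tau (X - Y) = tau X - tau Y.
  by rewrite /tau clB comp_lfunDr comp_lfunNr comp_lfunDl comp_lfunNl.
have tauN X : tau (- X) = - tau X by rewrite -sub0r tauB /tau /cl -(scale0r (1 : Br om k.+2)) actZ scale0r linear0 oppr0 comp_lfun0r comp_lfun0l sub0r.
have AA : (A \o A)%VF = A by rewrite /A -actM (ti_idem hE).
have EJ : bw E * JM om a = c k *: bw E by apply: (ti_bw_JM (i := a) hE); exact: ltnSn.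
have Ey : bw E * ya = p *: bw E.
  have h : (u - c k) *: (bw E * ya) = bw E.
    have -> : (u - c k) *: (bw E * ya) = bw E * (u *: 1 - JM om a) * ya.
      rewrite mulrBr -scalerAr mulr1 EJ.
      by rewrite -scalerBl -scalerAl.
    by rewrite -mulrA (JMalg_comm2 (jsub u a) jya) yaK mulr1.
  by rewrite -[LHS](scalerK uc) h.
have Ey' : bw E * ya' = - q *: bw E.
  have h : (- u - c k) *: (bw E * ya') = bw E.
    have -> : (- u - c k) *: (bw E * ya') = bw E * (- u *: 1 - JM om a) * ya'.
      rewrite mulrBr -scalerAr mulr1 EJ.
      by rewrite -scalerBl -scalerAl.
    by rewrite -mulrA (JMalg_comm2 (jsub (- u) a) jya') ya'K mulr1.
  have uc'' : - u - c k != 0 by rewrite -opprD oppr_eq0.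
  by rewrite -[LHS](scalerK uc'') h -opprD invrN.
have yE : ya * bw E = p *: bw E by rewrite -(JMalg_comm2 (JMalg_bw jE) jya).
have y'E : ya' * bw E = - q *: bw E by rewrite -(JMalg_comm2 (JMalg_bw jE) jya').
have tl X : tau (ya * X) = p *: tau X.
  by rewrite !tauE mulrA Ey -!scalerAl clZ.
have tr X : tau (X * ya) = p *: tau X.
  by rewrite !tauE -!mulrA yE -!scalerAr clZ.
have tl' X : tau (ya' * X) = - q *: tau X.
  by rewrite !tauE mulrA Ey' -!scalerAl clZ.
have tr' X : tau (X * ya') = - q *: tau X.
  by rewrite !tauE -!mulrA y'E -!scalerAr clZ.
have ts : tau s = A by rewrite /tau cl_s comp_lfun1r AA.
have te : tau e = A by rewrite /tau cl_e comp_lfun1r AA.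
have AEA : (A \o ampl (cl y) \o A)%VF = r *: A.
  have e1 : A = (A \o ampl (act k E'))%VF.
    by rewrite -(act_bw (ti_alg hE')) /A -actM EE'.
  have -> : (A \o ampl (cl y))%VF = r *: A.
    rewrite {1}e1 -comp_lfunA -ampl_comp -(cl_bwl _ (ti_alg hE')) hr linearZ /=.
    by rewrite -comp_lfunZr -e1.
  by rewrite -comp_lfunZl AA.
have tsys : tau (s * ya * s) = r *: A by rewrite /tau cl_s_conj.
have teye : tau (e * ya * e) = r *: A.
  rewrite /tau /cl act_e_conj // -[X in ptrace X]comp_lfun1r -ampl_id ptrace_ampl.
  by rewrite -/(cl e) comp_lfun1r -comp_lfunNr -/(cl e) cl_e comp_lfun1r AEA.
have tzs : tau (z * s) = p *: A + p *: tau z - (q * p) *: A.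
  rewrite sl1 tauB tauD tr ts tr; congr (_ - _).
  by rewrite ze mulNr tauN -mulrA tl' tr te scalerA -scaleNr mulNr opprK.
have eyz : e * ya * s = - (e * ya') + e * ya * ya' - e * ya * e * ya'.
  have ez : e * z' = - (e * ya) by rewrite ey opprK.
  transitivity (- (e * (z' * s))); first by rewrite ey mulNr mulrA.
  by rewrite sl2 mulrBr mulrDr !mulrA es ez !mulNr !opprD !opprK.
have teys : tau (e * ya * s) = - (- q *: A) + - q *: (p *: A) - - q *: (r *: A).
  by rewrite eyz tauB tauD tauN !tr' tr te teye.
(* A second use of the sliding relation makes [tau z] reappear on the right. *)
have zz : z = s * ya * s + ya * (z * s) + ya' * (e * ya * s).
  have zs2 : z = (s * ya + z * ya - z * e * ya) * s by rewrite -sl1 -mulrA tr2 mulr1.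
  rewrite {1}zs2 mulrBl mulrDl; congr (_ + _ + _).
    by rewrite [RHS]mulrA -(JMalg_comm2 jz jya).
  by rewrite ze !mulNr opprK !mulrA.
have fin : cl (bw E * z) = tau z.
  rewrite tauE -mulrA (JMalg_comm2 jz (JMalg_bw jE)) mulrA -bwM (ti_idem hE).
  by [].
have main : tau z = r *: A + p *: (p *: A + p *: tau z - (q * p) *: A)
   + - q *: (- (- q *: A) + - q *: (p *: A) - - q *: (r *: A)).
  by rewrite {1}zz !tauD tsys tl tzs tl' teys.
rewrite fin; apply: entryP => I J.
have := congr1 (fun Z => entry Z I J) main.
rewrite !(entryD, entryZ, entryN); set t := entry (tau z) I J; set x := entry A I J.
move=> tE; apply: (mulfI p1); rewrite mulrA mulrCA divff // mulr1.
by rewrite mulrBl mul1r {1}tE; ring.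
Qed.

End LastTwoStrands.
End Action.

Section PolyIdentity.
Variable C : numFieldType.

Lemma poly_nonroot (p : {poly C}) : p != 0 -> exists u, p.[u] != 0.
Proof.
move=> p0; pose s := [seq i%:R : C | i <- iota 0 (size p)].
case: (boolP (all (root p) s)) => [ap|/allPn[u _ pu]]; last by exists u.
have us : uniq s by rewrite map_inj_uniq ?iota_uniq // => i j /eqP; rewrite eqr_nat => /eqP.
by have := max_poly_roots p0 ap us; rewrite size_map size_iota ltnn.
Qed.

Lemma poly_eq_generic (bad p q : {poly C}) : bad != 0 ->
  (forall u, bad.[u] != 0 -> p.[u] = q.[u]) -> p = q.
Proof.
move=> b0 h; apply/eqP; rewrite -subr_eq0; apply: contraT => pq.
have [u] := poly_nonroot (mulf_neq0 pq b0).
rewrite hornerM mulf_eq0 negb_or !hornerE => /andP[pqu bu].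
by rewrite h // subrr eqxx in pqu.
Qed.
End PolyIdentity.

Section Closures.
Variables (C : numFieldType) (n : nat).
Local Notation om := (brauer_omega C n).
Local Notation k := (kappa om).
Variable act : forall m, {linear brauer C m -> 'End(tensor C n m)}.
Hypothesis hact : forall m, tensor_action (act m).
Variables (c : nat -> C) (M : nat) (E : forall m, Br om m).
Hypothesis E0 : E 0 = 1.
Hypothesis hE : forall m, (m <= M)%N -> tab_idem c (E m).
Hypothesis hS : forall m, (m < M)%N -> exists h : {poly C}, [/\ h.[c m] != 0,
  bw (E m) * horner_alg (JM om (ord_max : 'I_m.+1)) (('X - (c m)%:P) * h) = 0 &
  E m.+1 = (h.[c m])^-1 *: (bw (E m) * horner_alg (JM om (ord_max : 'I_m.+1)) h)].

Let two : (2 : C) != 0. Proof. by rewrite pnatr_eq0. Qed.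

(** The resolvent is a rational function of [u], whose poles are the roots of the
    minimal polynomial of [x]. *)
Lemma resolvent_exists m (x : Br om m) : JMalg x -> exists2 bad : {poly C}, bad != 0 &
  forall u, bad.[u] != 0 -> exists y : Br om m,
    [/\ JMalg y, y * (u *: 1 - x) = 1 & (u *: 1 - x) * y = 1].
Proof.
move=> jx; exists (mxminpoly (lmx x)); first by rewrite monic_neq0 // mxminpoly_monic.
move=> u hu; have z0 : (0 : Br om m) * horner_alg x 0 = 0 by rewrite mul0r.
have [h1 h2 _] := resolvent_dquo hu (lmx_minpoly x) z0.
eexists; split; [|exact: h2|exact: h1].
exact/JMalg_scale/JMalg_horner.
Qed.

Lemma E_absorb m : (m < M)%N -> E m.+1 * bw (E m) = E m.+1.
Proof.
move=> mM; have [h [_ _ ->]] := hS mM; have hm := hE (ltnW mM).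
by rewrite -scalerAl -mulrA -(ti_bw_comm _ hm) mulrA -bwM (ti_idem hm).
Qed.

(** The solution of the recursion of [resolvent_closure_step], up to the shift in
    [rho_gen], which makes the recursion homogeneous. *)
Definition Ggen (m : nat) (u : C) : C := (u + k) * (2 * u + 1) / (2 * u * (u - k)) *
  \prod_(0 <= i < m) (((u + c i) ^+ 2 - 1) * (u - c i) ^+ 2 /
                      ((u + c i) ^+ 2 * ((u - c i) ^+ 2 - 1))).

Definition rho_gen m u : C := Ggen m u - 1 + (2 * u)^-1.

Lemma rho_genS m u (p := (u - c m)^-1) (q := (u + c m)^-1) :
  u != 0 -> u - k != 0 -> u - c m != 0 -> u + c m != 0 -> (u - c m) ^+ 2 - 1 != 0 ->
  rho_gen m.+1 u = (rho_gen m u * (1 - q ^+ 2) + (p ^+ 2 - q ^+ 2) - p * q * (p - q)) / (1 - p ^+ 2).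
Proof.
move=> u0 uk uc uc' uc1; rewrite /rho_gen /Ggen big_nat_recr //= mulrA.
rewrite -/(Ggen m u); set G := Ggen m u.
have : 1 - p ^+ 2 != 0.
  have -> : 1 - p ^+ 2 = ((u - c m) ^+ 2 - 1) / (u - c m) ^+ 2.
    by rewrite mulrBl divff ?expf_neq0 // mul1r /p exprVn.
  by rewrite mulf_neq0 // invr_eq0 expf_neq0.
rewrite /p /q => p1.
have e1 : (1 - (u - c m)^-1 ^+ 2) = ((u - c m) ^+ 2 - 1) / (u - c m) ^+ 2.
  by rewrite mulrBl divff ?expf_neq0 // mul1r exprVn.
by rewrite e1; field; rewrite uc1 uc uc' u0.
Qed.

Lemma closure_resolvent m : (m <= M)%N -> exists2 bad : {poly C}, bad != 0 &
  forall u, bad.[u] != 0 -> forall y : Br om m.+1, y * (u *: 1 - JM om ord_max) = 1 ->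
    cl act (bw (E m) * y) = rho_gen m u *: act m (E m).
Proof.
elim: m => [_|m IH mM].
  exists (('X - k%:P) * 'X) => [|u]; first by rewrite mulf_neq0 ?polyXsubC_eq0 ?polyX_eq0.
  rewrite !hornerE mulf_eq0 negb_or => /andP[uk u0] y.
  have -> : JM om (ord_max : 'I_1) = k%:A.
    by rewrite JME big_pred0 ?addr0 // => a; rewrite ord1.
  rewrite -scalerBl -scalerAr mulr1 => hy.
  have -> : y = (u - k)^-1 *: 1 by rewrite -hy scalerA mulVf // scale1r.
  rewrite E0 bw1 mul1r clZ (cl1 hact) (act1 hact) scalerA; congr (_ *: _).
  have omE : om = 2 * k + 1 by rewrite /kappa; field.
  rewrite /rho_gen /Ggen big_geq // mulr1 [X in _ * X]omE.
  by move: k uk => kk uk; field; rewrite u0 uk.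
(* The values of [u] at which one of the resolvents, or of the denominators, degenerates. *)
have [bad b0 IHu] := IH (ltnW mM).
have [b1 b10 r1] := resolvent_exists (JMalg_JM om (ord_max : 'I_m.+1)).
have [b2 b20 r2] := resolvent_exists (JMalg_JM om (ord_max : 'I_m.+2)).
have neg (p : {poly C}) : p != 0 -> p \Po (- 'X) != 0.
  by rewrite -!size_poly_eq0 size_comp_poly2 // size_polyN size_polyX.
pose sp : {poly C} := 'X * ('X - k%:P) * ('X - (c m)%:P) * ('X - (- c m)%:P) *
   (('X - (c m + 1)%:P) * ('X - (c m - 1)%:P)).
exists (bad * b1 * (b1 \Po (- 'X)) * b2 * (b2 \Po (- 'X)) * sp).
  by rewrite /sp !mulf_neq0 ?polyXsubC_eq0 ?polyX_eq0 ?neg.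
move=> u; rewrite !hornerM !mulf_eq0 !negb_or !horner_comp !hornerXsubC !hornerN !hornerX.
move=> /andP[/andP[/andP[/andP[/andP[hb h1] h1'] h2] h2']].
move=> /andP[/andP[/andP[/andP[u0 uk] uc] uc'] /andP[u1 u2]] z hz.
have [y [jy yK _]] := r1 u h1; have [y' [jy' yK' _]] := r1 _ h1'.
have [z0 [jz zK zK2]] := r2 u h2; have [z' [jz' zK' _]] := r2 _ h2'.
have -> : z = z0 by rewrite -[z]mulr1 -zK2 mulrA hz mul1r.
rewrite opprK in uc'.
have uc1 : (u - c m) ^+ 2 - 1 != 0.
  have -> : (u - c m) ^+ 2 - 1 = (u - (c m + 1)) * (u - (c m - 1)) by ring.
  by rewrite mulf_neq0.
have p1 : 1 - (u - c m)^-1 ^+ 2 != 0.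
  have -> : 1 - (u - c m)^-1 ^+ 2 = ((u - c m) ^+ 2 - 1) / (u - c m) ^+ 2.
    by rewrite mulrBl divff ?expf_neq0 // mul1r exprVn.
  by rewrite mulf_neq0 // invr_eq0 expf_neq0.
rewrite rho_genS //.
apply: (resolvent_closure_step hact two uc uc' p1 (hE mM) (hE (ltnW mM)) (E_absorb mM)
  jy jy' jz jz' yK yK' zK zK').
exact: IHu.
Qed.

(** The next idempotent is the residue at its content of the compressed resolvent,
    so that its closure is the residue of the generating function.  The two
    expressions of the compressed resolvent are compared as polynomials in [u]
    before they are evaluated at the content. *)
Theorem closure_residue m (A B bad : {poly C}) : (m < M)%N -> c m != 0 -> bad != 0 ->
  B.[c m] != 0 -> (forall u, bad.[u] != 0 -> (u - c m) * Ggen m u * B.[u] = A.[u]) ->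
  cl act (E m.+1) = (A.[c m] / B.[c m]) *: act m (E m).
Proof.
move=> mM cm0 bad0 Bc hG; have [h [hc ann ->]] := hS mM.
have [bad1 b10 hcl] := closure_resolvent (ltnW mM).
have [bad2 b20 hres] := resolvent_exists (JMalg_JM om (ord_max : 'I_m.+1)).
set x := JM om ord_max in ann hcl hres *; set chi := _ * h in ann.
apply: entryP => I J; set a := entry (act m (E m)) I J.
pose L : {poly C} := \sum_(i < size chi) \sum_(j < i)
  (chi`_i * entry (cl act (bw (E m) * x ^+ (i.-1 - j))) I J) *: 'X^j.
have LE u : L.[u] = entry (cl act (bw (E m) * horner_alg x (dquo chi u))) I J.
  pose f (X : Br om m.+1) := entry (cl act X) I J.
  have fD X Y : f (X + Y) = f X + f Y by rewrite /f clD entryD.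
  have fZ b X : f (b *: X) = b * f X by rewrite /f clZ entryZ.
  have f0 : f 0 = 0 by rewrite -(scale0r 0) fZ mul0r.
  rewrite -/(f _) mul_horner_dquo (big_morph f fD f0) horner_sum; apply: eq_bigr => i _.
  rewrite (big_morph f fD f0) horner_sum; apply: eq_bigr => j _.
  by rewrite hornerZ hornerXn fZ mulrAC.
have chi_c : dquo chi (c m) = h.
  have := dquoE chi (c m); rewrite {3}/chi hornerM hornerXsubC subrr mul0r subr0 => e1.
  by apply: (mulfI (negbT (polyXsubC_eq0 (c m)))).
have idp : L * B * (2 *: 'X) =
   a *: (h * (A * (2 *: 'X) - ('X - (c m)%:P) * B * (2 *: 'X) + ('X - (c m)%:P) * B)).
  apply: (@poly_eq_generic _ (bad * bad1 * bad2 * 'X * ('X - (c m)%:P))).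
    by rewrite !mulf_neq0 ?polyXsubC_eq0 ?polyX_eq0.
  move=> u; rewrite !hornerM !mulf_eq0 !negb_or hornerX hornerXsubC.
  move=> /andP[/andP[/andP[/andP[hb hb1] hb2] u0] uc].
  have [y [_ yK yK2]] := hres u hb2.
  have e1 : L.[u] = chi.[u] * rho_gen m u * a.
    have e2 : bw (E m) * horner_alg x (dquo chi u) = chi.[u] *: (bw (E m) * y).
      have := horner_dquo x chi u; rewrite -opprB => e3.
      have : bw (E m) * ((u *: 1 - x) * horner_alg x (dquo chi u)) = chi.[u] *: bw (E m).
        by rewrite -opprB mulNr -[in X in - (X * _)]opprB e3 opprB mulrBr ann subr0 -scalerAr mulr1.
      have cx : GRing.comm (u *: 1 - x) (horner_alg x (dquo chi u)).
        apply: JMalg_comm2; last by apply/JMalg_horner/JMalg_JM.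
        rewrite -scaleN1r; apply: JMalg_add; first exact: JMalg_scalar.
        by apply/JMalg_scale/JMalg_JM.
      rewrite cx mulrA => e4.
      by rewrite scalerAl -e4 -[RHS]mulrA yK2 mulr1.
    by rewrite LE e2 clZ entryZ (hcl u hb1 y yK) entryZ mulrA.
  rewrite !(hornerM, hornerZ, hornerD, hornerN, hornerX, hornerC) e1 -(hG u hb) /rho_gen.
  by rewrite /chi hornerM hornerXsubC; field.
have := congr1 (fun p : {poly C} => p.[c m]) idp.
rewrite /= !(hornerM, hornerZ, hornerD, hornerN, hornerX, hornerC) subrr !mul0r subr0 addr0 LE chi_c => fin.
rewrite clZ !entryZ -/a; set l := entry _ I J in fin *.
apply: (mulfI (mulf_neq0 hc (mulf_neq0 Bc (mulf_neq0 two cm0)))).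
transitivity (l * B.[c m] * (2 * c m)); first by field.
by rewrite fin; field.
Qed.

End Closures.

(** * Products over the boxes of a diagram *)

Section Telescope.
Variable C : fieldType.
Implicit Types x y : C.

(** A box contributes the quotient of two values of this function to the
    generating function. *)
Definition hfac x : C := (x ^+ 2 - 1) / x ^+ 2.

Lemma hfacN x : hfac (- x) = hfac x.
Proof. by rewrite /hfac sqrrN. Qed.

(** Telescoping along a row or a column. *)
Lemma prod_hfac x (p l : nat) : (p <= l)%N -> (forall j, (p <= j <= l.+1)%N -> x + j%:R != 0) ->
  \prod_(p.+1 <= j < l.+1) hfac (x + j%:R) =
  (x + p%:R) / (x + p%:R + 1) * ((x + l%:R + 1) / (x + l%:R)).
Proof.
move=> pl; rewrite -(subnKC pl); elim: (l - p)%N => [|k IH] nz.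
  have n0 : x + p%:R != 0 by apply: nz; lia.
  have n1 : x + p%:R + 1 != 0 by rewrite -addrA -(natrD _ p 1) nz //; lia.
  rewrite addn0 big_geq // mulrA divfK // divff //.
rewrite addnS big_nat_recr /=; last by lia.
rewrite IH => [|j jl]; last by apply: nz; lia.
have n1 : x + (p + k)%:R != 0 by apply: nz; lia.
have n2 : x + (p + k).+1%:R != 0 by apply: nz; lia.
have n3 : x + p%:R + 1 != 0 by rewrite -addrA -(natrD _ p 1) nz //; lia.
rewrite -natr1 addrA in n2; rewrite -natr1 !addrA.
move: n1 n2 n3; move: (p + k)%:R p%:R => u v n1 n2 n3.
by rewrite /hfac; field; rewrite n1 n2 n3.
Qed.

Lemma prod_ratio x (p l : nat) : (p <= l)%N -> (forall j, (p <= j <= l)%N -> x + j%:R != 0) ->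
  \prod_(p.+1 <= j < l.+1) ((x + j%:R) / (x + j%:R - 1)) = (x + l%:R) / (x + p%:R).
Proof.
move=> pl; rewrite -(subnKC pl); elim: (l - p)%N => [|k IH] nz.
  have n0 : x + p%:R != 0 by apply: nz; lia.
  by rewrite addn0 big_geq // divff.
rewrite addnS big_nat_recr /=; last by lia.
rewrite IH => [|j jl]; last by apply: nz; lia.
have n1 : x + (p + k)%:R != 0 by apply: nz; lia.
have -> : x + (p + k).+1%:R - 1 = x + (p + k)%:R by rewrite -natr1 addrA addrK.
by rewrite mulrC mulrA divfK.
Qed.
End Telescope.

Lemma prod_pick (A : comPzRingType) a b s (g : nat -> A) :
  \prod_(a <= j < b) (if j == s then g j else 1) = if (a <= s < b)%N then g s else 1.
Proof.
case: ifP => h.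
  rewrite (bigD1_seq s) ?mem_index_iota ?iota_uniq //= eqxx big1 ?mulr1 // => j.
  by move/negPf->.
by rewrite big_nat big1 // => j hj; case: eqP => // e; rewrite -e hj in h.
Qed.

Section Shape.
Variables (R Cc : nat -> nat).
Hypothesis RC : forall i j, (0 < i)%N -> (0 < j)%N -> (j <= R i)%N = (i <= Cc j)%N.

Lemma row_anti i i' : (0 < i)%N -> (i <= i')%N -> (R i' <= R i)%N.
Proof.
move=> i0 ii'; case: (posnP (R i')) => [->//|r0].
have i'0 : (0 < i')%N by apply: leq_trans ii'.
by rewrite RC // (leq_trans ii') // -RC.
Qed.

Lemma col_anti j j' : (0 < j)%N -> (j <= j')%N -> (Cc j' <= Cc j)%N.
Proof.
move=> i0 ii'; case: (posnP (Cc j')) => [->//|r0].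
have i'0 : (0 < j')%N by apply: leq_trans ii'.
by rewrite -RC // (leq_trans ii') // RC.
Qed.

Lemma prod_exchange (A : comPzRingType) (F : nat -> nat -> A) a0 b0 P Q :
  (0 < a0)%N -> (0 < b0)%N ->
  (forall a, (a0 <= a <= P)%N -> (R a <= Q)%N) -> (forall b, (b0 <= b <= Q)%N -> (Cc b <= P)%N) ->
  \prod_(a0 <= a < P.+1) \prod_(b0 <= b < (R a).+1) F a b =
  \prod_(b0 <= b < Q.+1) \prod_(a0 <= a < (Cc b).+1) F a b.
Proof.
move=> a00 b00 RQ CP.
transitivity (\prod_(a0 <= a < P.+1) \prod_(b0 <= b < Q.+1) (if (b <= R a)%N then F a b else 1)).
  apply: eq_big_nat => a aP; rewrite (big_nat_widen _ _ Q.+1) /=; last by rewrite ltnS RQ.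
  by rewrite big_mkcond; apply: eq_bigr => b _; rewrite ltnS.
rewrite exchange_big_nat; apply: eq_big_nat => b bQ /=.
rewrite [RHS](big_nat_widen _ _ P.+1) /=; last by rewrite ltnS CP.
rewrite [RHS]big_mkcond; apply: eq_big_nat => a /andP[aa _]; rewrite ltnS RC //.
  exact: leq_trans aa.
by case/andP: bQ => bb _; apply: leq_trans bb.
Qed.

Variable B : nat.
Hypothesis RB : forall i, (B < i)%N -> R i = 0%N.

Lemma col_le j : (0 < j)%N -> (Cc j <= B)%N.
Proof.
move=> j0; rewrite leqNgt; apply/negP => h; have := RC (leq_ltn_trans (leq0n _) h) j0.
by rewrite RB // leqnn leqNgt j0.
Qed.

(** [B] is any bound on the number of rows, so that diagrams of different heights
    can be compared. *)
Definition boxprod (A : comPzRingType) (F : nat -> nat -> A) : A :=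
  \prod_(1 <= i < B.+1) \prod_(1 <= j < (R i).+1) F i j.

Lemma boxprodM (A : comPzRingType) (F F' : nat -> nat -> A) :
  boxprod (fun i j => F i j * F' i j) = boxprod F * boxprod F'.
Proof. by rewrite /boxprod -big_split; apply: eq_bigr => i _; rewrite big_split. Qed.

Lemma eq_boxprod (A : comPzRingType) (F F' : nat -> nat -> A) :
  (forall i j, (0 < i)%N -> (0 < j)%N -> (j <= R i)%N -> F i j = F' i j) ->
  boxprod F = boxprod F'.
Proof.
move=> h; apply: eq_big_nat => i /andP[i0 _]; apply: eq_big_nat => j /andP[j0 jR].
exact: h.
Qed.

Lemma boxprod_col (A : comPzRingType) (g : nat -> A) s : (0 < s)%N ->
  boxprod (fun i j => if j == s then g i else 1) = \prod_(1 <= i < (Cc s).+1) g i.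
Proof.
move=> s0; rewrite [RHS](big_nat_widen _ _ B.+1) /=; last by rewrite ltnS col_le.
rewrite big_mkcond; apply: eq_big_nat => i /andP[i0 _]; rewrite ltnS -RC //.
rewrite (prod_pick _ _ _ (fun _ => g i)) s0 ltnS.
by [].
Qed.

Lemma boxprod_row (A : comPzRingType) (g : nat -> A) r : (0 < r)%N ->
  boxprod (fun i j => if i == r then g j else 1) = \prod_(1 <= j < (R r).+1) g j.
Proof.
move=> r0; rewrite /boxprod.
transitivity (\prod_(1 <= i < B.+1) (if i == r then \prod_(1 <= j < (R i).+1) g j else 1)).
  by apply: eq_bigr => i _; case: eqP => // _; rewrite big1.
rewrite prod_pick r0 ltnS; case: leqP => // rB.
by rewrite RB // big_geq.
Qed.

Section AddableBox.
Variable K : fieldType.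

(** What is left of the row [i], respectively of the column [j], once its factors
    have telescoped against those of its neighbours. *)
Definition rowf (y : K) i : K := (y - (R i)%:R + i%:R - 1) / (y - (R i)%:R + i%:R).
Definition colf (y : K) j : K := (y - j%:R + (Cc j)%:R + 1) / (y - j%:R + (Cc j)%:R).

(** In each row the product telescopes to its two ends; the left ends telescope
    again from row to row. *)
Lemma prod_rows y p q P Q : (p <= P)%N -> (q <= Q)%N ->
  (forall a, (p < a <= P)%N -> (q <= R a <= Q)%N) ->
  (forall i j, (p <= i <= P.+1)%N -> (q <= j <= Q.+1)%N -> y + i%:R - j%:R != 0) ->
  \prod_(p.+1 <= a < P.+1) \prod_(q.+1 <= b < (R a).+1) hfac (y + a%:R - b%:R) =
  (y - q%:R + P%:R) / (y - q%:R + p%:R) * \prod_(p.+1 <= a < P.+1) rowf y a.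
Proof.
move=> pP qQ qR nz.
transitivity (\prod_(p.+1 <= a < P.+1)
   (((y - q%:R + a%:R) / (y - q%:R + a%:R - 1)) * rowf y a)).
  apply: eq_big_nat => a /andP[pa aP].
  have /andP[qa aQ] : (q <= R a <= Q)%N by apply: qR; rewrite pa.
  have nza j : (q <= j <= (R a).+1)%N -> - (y + a%:R) + j%:R != 0.
    by move=> hj; rewrite -oppr_eq0 opprD opprK nz //; lia.
  transitivity (\prod_(q.+1 <= b < (R a).+1) hfac (- (y + a%:R) + b%:R)).
    by apply: eq_bigr => b _; rewrite -hfacN opprB addrC.
  rewrite prod_hfac // /rowf.
  set X := y - q%:R + a%:R; set Y := y - (R a)%:R + a%:R.
  have -> : - (y + a%:R) + q%:R + 1 = - (X - 1) by rewrite /X; ring.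
  have -> : - (y + a%:R) + (R a)%:R + 1 = - (Y - 1) by rewrite /Y; ring.
  have -> : - (y + a%:R) + q%:R = - X by rewrite /X; ring.
  have -> : - (y + a%:R) + (R a)%:R = - Y by rewrite /Y; ring.
  by rewrite !invrN !mulrNN.
rewrite big_split /= prod_ratio // => j hj.
by rewrite addrAC nz //; lia.
Qed.

Lemma prod_cols y p q P Q : (p <= P)%N -> (q <= Q)%N ->
  (forall b, (q < b <= Q)%N -> (p <= Cc b <= P)%N) ->
  (forall i j, (p <= i <= P.+1)%N -> (q <= j <= Q.+1)%N -> y + i%:R - j%:R != 0) ->
  \prod_(q.+1 <= b < Q.+1) \prod_(p.+1 <= a < (Cc b).+1) hfac (y + a%:R - b%:R) =
  (y + p%:R - Q%:R) / (y + p%:R - q%:R) * \prod_(q.+1 <= b < Q.+1) colf y b.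
Proof.
move=> pP qQ pC nz.
transitivity (\prod_(q.+1 <= b < Q.+1)
   (((- (y + p%:R) + b%:R) / (- (y + p%:R) + b%:R - 1)) * colf y b)).
  apply: eq_big_nat => b /andP[qb bQ].
  have /andP[pb bP] : (p <= Cc b <= P)%N by apply: pC; rewrite qb.
  have nzb i : (p <= i <= (Cc b).+1)%N -> (y - b%:R) + i%:R != 0.
    by move=> hi; rewrite addrAC nz //; lia.
  transitivity (\prod_(p.+1 <= a < (Cc b).+1) hfac ((y - b%:R) + a%:R)).
    by apply: eq_bigr => a _; rewrite addrAC.
  rewrite prod_hfac // /colf; congr (_ * _).
  have -> : - (y + p%:R) + b%:R - 1 = - (y - b%:R + p%:R + 1) by ring.
  have -> : - (y + p%:R) + b%:R = - (y - b%:R + p%:R) by ring.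
  by rewrite invrN mulrNN.
rewrite big_split /= prod_ratio // => [|j hj]; last first.
  by rewrite -oppr_eq0 opprD opprK nz //; lia.
congr (_ * _).
have -> : - (y + p%:R) + Q%:R = - (y + p%:R - Q%:R) by ring.
have -> : - (y + p%:R) + q%:R = - (y + p%:R - q%:R) by ring.
by rewrite invrN mulrNN.
Qed.

(** The boxes to the lower right of [(p, p)] can be grouped by rows or by columns;
    this trades the rows or columns that the dimension formula involves for those
    that the residue involves. *)
Lemma rows_cols y p P Q : (p <= P)%N -> (p <= Q)%N ->
  (forall a, (p < a <= P)%N -> (p <= R a <= Q)%N) ->
  (forall b, (p < b <= Q)%N -> (p <= Cc b <= P)%N) ->
  (forall i j, (p <= i <= P.+1)%N -> (p <= j <= Q.+1)%N -> y + i%:R - j%:R != 0) ->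
  (y + P%:R - p%:R) * \prod_(p.+1 <= a < P.+1) rowf y a =
  (y + p%:R - Q%:R) * \prod_(p.+1 <= b < Q.+1) colf y b.
Proof.
move=> pP pQ hR hC nz.
have y0 : y != 0 by rewrite -[y](addrK p%:R) nz ?leqnn // ltnW.
have e1 := prod_rows pP pQ hR nz; have e2 := prod_cols pP pQ hC nz.
have ex : \prod_(p.+1 <= a < P.+1) \prod_(p.+1 <= b < (R a).+1) hfac (y + a%:R - b%:R) =
  \prod_(p.+1 <= b < Q.+1) \prod_(p.+1 <= a < (Cc b).+1) hfac (y + a%:R - b%:R).
  by apply: prod_exchange => // [a|b] h; [have := hR a | have := hC b]; lia.
apply: (mulIf (invr_neq0 y0)); rewrite ![_ * _ / y]mulrAC.
by move: ex; rewrite e1 e2 addrK [y + P%:R - p%:R]addrAC subrK => ->.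
Qed.

Variables (r s : nat).
Hypotheses (hs : s = (R r).+1) (hr : r = (Cc s).+1).

Let r0 : (0 < r)%N. Proof. by rewrite hr. Qed.
Let s0 : (0 < s)%N. Proof. by rewrite hs. Qed.

(** The contribution of all the boxes of the diagram to the generating function,
    in terms of the addable box [(r, s)]: the boxes above it are grouped by rows,
    the others by columns. *)
Lemma boxprod_hfac y : y != 0 ->
  (forall i j, (i <= B.+1)%N -> (j <= (R 1).+1)%N -> y + i%:R - j%:R != 0) ->
  boxprod (fun i j => hfac (y + i%:R - j%:R)) =
  (y + r%:R - s%:R) / y * (\prod_(1 <= i < r) rowf y i * \prod_(1 <= j < s) colf y j).
Proof.
move=> y0 nz; have sR : (s <= (R 1).+1)%N by rewrite hs ltnS row_anti.
have rB : (r <= B.+1)%N by rewrite hr ltnS col_le.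
rewrite /boxprod (@big_cat_nat _ _ _ r) //=.
rewrite {1}hr; have e1 := @prod_rows y 0 0 (Cc s) (R 1).
rewrite e1 //; first last.
- by move=> i j hi hj; apply: nz; lia.
- by move=> a ha; rewrite leq0n row_anti //; lia.
have -> : \prod_(r <= a < B.+1) \prod_(1 <= b < (R a).+1) hfac (y + a%:R - b%:R) =
  \prod_(1 <= b < s) \prod_(r <= a < (Cc b).+1) hfac (y + a%:R - b%:R).
  rewrite hs; apply: prod_exchange => // [a|b] h; last by apply: col_le; lia.
  by apply: row_anti; lia.
have e2 := @prod_cols y (Cc s) 0 B (R r); rewrite -hr -hs in e2.
rewrite e2 //; first last.
- by move=> i j hi hj; apply: nz; lia.
- move=> b hb; rewrite col_le ?andbT; last by lia.
  by apply: col_anti; lia.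
- exact: col_le.
have yr : y + (Cc s)%:R != 0 by have := nz (Cc s) 0%N; rewrite subr0; apply; lia.
have eR : s%:R = (R r)%:R + 1 :> K by rewrite {1}hs natr1.
have eC : r%:R = (Cc s)%:R + 1 :> K by rewrite {1}hr natr1.
rewrite !subr0 addr0 -hr.
have -> : y + (Cc s)%:R - (R r)%:R = y + r%:R - s%:R by rewrite eR eC; ring.
by rewrite mulrACA; congr (_ * _); rewrite mulrC mulrA divfK.
Qed.

End AddableBox.
End Shape.

(** * The dimension formula when a box is added *)

Section AddBox.
Variables (R Cc : nat -> nat).
Hypothesis RC : forall i j, (0 < i)%N -> (0 < j)%N -> (j <= R i)%N = (i <= Cc j)%N.
Variable B : nat.
Hypothesis RB : forall i, (B < i)%N -> R i = 0%N.
Variables (r s : nat).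
Hypotheses (hs : s = (R r).+1) (hr : r = (Cc s).+1).
Variables (K : numFieldType) (n : nat).
Hypotheses (Rn : (R 1 <= n)%N) (sn : (s <= n)%N).

Let r0 : (0 < r)%N. Proof. by rewrite hr. Qed.
Let s0 : (0 < s)%N. Proof. by rewrite hs. Qed.

Definition add_row i := (R i + (i == r))%N.
Definition add_col j := (Cc j + (j == s))%N.

Local Notation N := ((2 * n)%:R : K).
Local Notation A := (N + 1 + r%:R - s%:R : K).

(** The factors of the dimension formula of the conjugate diagram, read on the
    boxes of the diagram itself; [Rr] and [C] are its row and column lengths. *)
Definition dfac (Rr C : nat -> nat) (i j : nat) : K :=
  if (i < j)%N then N + 2 + (C i)%:R + (C j)%:R - i%:R - j%:R
  else N - (Rr i)%:R - (Rr j)%:R + i%:R + j%:R.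

Definition hookf (Rr C : nat -> nat) (i j : nat) : K :=
  (Rr i)%:R - j%:R + (C j)%:R - i%:R + 1.

Lemma corner_shift_neq0 i j : (j <= n.+1)%N -> A + i%:R - j%:R != 0.
Proof.
move=> jn; have -> : A + i%:R - j%:R = (2 * n + 1 + r + i - s - j)%:R.
  have h1 : (s <= 2 * n + 1 + r + i)%N by lia.
  have h2 : (j <= 2 * n + 1 + r + i - s)%N by lia.
  by rewrite !natrB //; ring.
by rewrite pnatr_eq0; lia.
Qed.

Lemma colf_den_neq0 i j : (0 < j <= n)%N -> A - j%:R + (Cc i)%:R != 0.
Proof. by move=> jn; have := @corner_shift_neq0 (Cc i) j; rewrite addrAC; apply; lia. Qed.

Lemma rowf_den_neq0 i j : (0 < i)%N -> A - (R i)%:R + j%:R != 0.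
Proof.
move=> i0; have := @corner_shift_neq0 j (R i); rewrite addrAC; apply.
by rewrite (leq_trans _ (leqnSn _)) // (leq_trans _ Rn) // (row_anti RC).
Qed.

Let dd : K := (N + 2 * r%:R - 2 * s%:R) / (N + 2 * r%:R - 2 * s%:R + 2).

Let ddN : N + 2 * r%:R - 2 * s%:R + 2 != 0.
Proof.
have -> : N + 2 * r%:R - 2 * s%:R + 2 = (2 * n + 2 * r + 2 - 2 * s)%:R.
  have h1 : (2 * s <= 2 * n + 2 * r + 2)%N by lia.
  by rewrite natrB //; ring.
by rewrite pnatr_eq0; lia.
Qed.

Let q i j : K :=
  (if j == s then (if (i < s)%N then colf Cc A i else 1) else 1) *
  (if i == s then (if (s < j)%N then colf Cc A j else 1) else 1) *
  (if i == r then (if (j < r)%N then rowf R A j else 1) else 1) *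
  (if j == r then (if (r < i)%N then rowf R A i else 1) else 1) *
  (if i == r then (if j == r then dd else 1) else 1).

Lemma natr_new_col : s%:R = (R r)%:R + 1 :> K. Proof. by rewrite {1}hs natr1. Qed.
Lemma natr_new_row : r%:R = (Cc s)%:R + 1 :> K. Proof. by rewrite {1}hr natr1. Qed.

Let dfac_q i j : (0 < i)%N -> (0 < j)%N -> (j <= R i)%N ->
  dfac add_row add_col i j = dfac R Cc i j * q i j.
Proof.
move=> i0 j0 jR; have iC : (i <= Cc j)%N by rewrite -RC.
have jn : (j <= n)%N by rewrite (leq_trans jR) // (leq_trans _ Rn) // (row_anti RC).
have nin : ~~ ((i == r) && (j == s)).
  by apply/negP => /andP[/eqP ei /eqP ej]; move: jR; rewrite ei ej {1}hs ltnn.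
rewrite /dfac /q /add_row /add_col; case: (ltnP i j) => ij.
  have -> : (if i == r then if (j < r)%N then rowf R A j else 1 else 1) = 1.
    by case: eqP => // ir; have -> : (j < r)%N = false by lia.
  have -> : (if j == r then if (r < i)%N then rowf R A i else 1 else 1) = 1.
    by case: eqP => // jr; have -> : (r < i)%N = false by lia.
  have -> : (if i == r then if j == r then dd else 1 else 1) = 1.
    by case: eqP => // ir; have -> : (j == r) = false by lia.
  rewrite !mulr1; case: (eqVneq j s) => [js|js].
    have -> : (i < s)%N by lia.
    have -> : (i == s) = false by lia.
    rewrite mulr1 addn0 addn1 -natr1 js /colf.
    have -> : N + 2 + (Cc i)%:R + (Cc s)%:R - i%:R - s%:R = A - i%:R + (Cc i)%:R.
      by rewrite natr_new_row; ring.
    rewrite mulrCA divff ?mulr1; last by apply: colf_den_neq0; lia.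
    by rewrite natr_new_row; ring.
  rewrite mul1r addn0; case: (eqVneq i s) => [is_|is_]; last by rewrite addn0 mulr1.
  have -> : (s < j)%N by lia.
  rewrite addn1 -natr1 is_ /colf.
  have -> : N + 2 + (Cc s)%:R + (Cc j)%:R - s%:R - j%:R = A - j%:R + (Cc j)%:R.
    by rewrite natr_new_row; ring.
  rewrite mulrCA divff ?mulr1; last by apply: colf_den_neq0; lia.
  by rewrite natr_new_row; ring.
have -> : (if j == s then if (i < s)%N then colf Cc A i else 1 else 1) = 1.
  by case: eqP => // js; have -> : (i < s)%N = false by lia.
have -> : (if i == s then if (s < j)%N then colf Cc A j else 1 else 1) = 1.
  by case: eqP => // is_; have -> : (s < j)%N = false by lia.
rewrite !mul1r; case: (eqVneq i r) => [ir|ir].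
  case: (eqVneq j r) => [jr|jr].
    rewrite ir jr ltnn !mul1r /dd !addn1 -natr1.
    have -> : N - (R r)%:R - (R r)%:R + r%:R + r%:R = N + 2 * r%:R - 2 * s%:R + 2.
      by rewrite natr_new_col; ring.
    by rewrite mulrCA divff // mulr1 natr_new_col; ring.
  have -> : (j < r)%N by lia.
  rewrite !mulr1 addn0 addn1 -natr1 ir /rowf.
  have -> : N - (R r)%:R - (R j)%:R + r%:R + j%:R = A - (R j)%:R + j%:R.
    by rewrite natr_new_col; ring.
  rewrite mulrCA divff ?mulr1; last exact: rowf_den_neq0.
  by rewrite natr_new_col; ring.
rewrite mul1r mulr1 addn0; case: (eqVneq j r) => [jr|jr]; last by rewrite addn0 mulr1.
have -> : (r < i)%N by lia.
rewrite addn1 -natr1 jr /rowf.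
have -> : N - (R i)%:R - (R r)%:R + i%:R + r%:R = A - (R i)%:R + i%:R.
  by rewrite natr_new_col; ring.
rewrite mulrCA divff ?mulr1; last exact: rowf_den_neq0.
by rewrite natr_new_col; ring.
Qed.

Let prod_lt (g : nat -> K) a b : \prod_(1 <= i < a) (if (i < b)%N then g i else 1) =
  \prod_(1 <= i < minn a b) g i.
Proof.
rewrite [RHS](big_nat_widen _ _ a) ?geq_minl // [RHS]big_mkcond.
apply: eq_big_nat => i /andP[_ ia]; rewrite /= leq_min ia.
by [].
Qed.

Let prod_gt (g : nat -> K) a b : (b < a)%N -> \prod_(1 <= i < a) (if (b < i)%N then g i else 1) =
  \prod_(b.+1 <= i < a) g i.
Proof.
move=> ba; rewrite (@big_cat_nat _ _ _ b.+1) //= big_nat big1 ?mul1r.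
  by apply: eq_big_nat => i /andP[-> _].
by move=> i /andP[_ ib]; rewrite ltnNge -ltnS ib.
Qed.

(** Adding the box [(r, s)] only changes the factors in the row [r], in the row
    [s] and in the columns with these numbers.  The changed factors beyond the
    corner of the diagram do not occur in the residue; [rows_cols] exchanges them
    for those that do, and this exchange depends on the position of the new box
    with respect to the diagonal. *)
Lemma boxprod_dfac :
  dfac add_row add_col r s * boxprod R B (dfac add_row add_col) =
  boxprod R B (dfac R Cc) * ((N + 2 * r%:R - 2 * s%:R) *
     (\prod_(1 <= i < r) rowf R A i * \prod_(1 <= j < s) colf Cc A j)).
Proof.
rewrite (eq_boxprod B dfac_q) boxprodM mulrCA; congr (_ * _).
rewrite !boxprodM !(boxprod_col RC RB) // !(boxprod_row RB) //.
rewrite -hr -hs prod_pick r0 !prod_lt; case: (ltngtP r s) => rs.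
- have -> : \prod_(1 <= j < (R s).+1) (if (s < j)%N then colf Cc A j else 1) = 1.
    rewrite big_nat big1 // => j /andP[_ jR]; case: ltnP => // sj.
    by have := row_anti RC r0 (ltnW rs); lia.
  have rR : (r <= R r)%N by lia.
  have rC : (r <= Cc r)%N by rewrite -RC.
  rewrite mulr1 prod_gt //.
  have reg : (A + (Cc r)%:R - r%:R) * \prod_(r.+1 <= a < (Cc r).+1) rowf R A a =
     (A + r%:R - (R r)%:R) * \prod_(r.+1 <= b < (R r).+1) colf Cc A b.
    apply: (rows_cols RC) => //.
    - move=> a /andP[ra aC]; rewrite (row_anti RC r0 (ltnW ra)) andbT.
      by rewrite RC // (ltn_trans _ ra).
    - move=> b /andP[rb bR]; rewrite (col_anti RC r0 (ltnW rb)) andbT.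
      by rewrite -RC // (ltn_trans _ rb).
    by move=> i j _ hj; apply: corner_shift_neq0; lia.
  rewrite -hs in reg.
  have -> : \prod_(1 <= j < s) colf Cc A j = \prod_(1 <= j < r) colf Cc A j * (colf Cc A r *
      \prod_(r.+1 <= j < s) colf Cc A j).
    rewrite (@big_cat_nat _ _ _ r 1 s) ?(ltnW rs) //= [X in _ * X = _]big_ltn //.
  have n1 : A - r%:R + (Cc r)%:R != 0 by apply: colf_den_neq0; lia.
  have fE : dfac add_row add_col r s = A - r%:R + (Cc r)%:R + 1.
    rewrite /dfac /add_col rs eqxx (_ : (r == s) = false); last by lia.
    by rewrite addn0 addn1 -natr1 natr_new_row; ring.
  rewrite fE /dd [colf Cc A r]/colf; move: reg.
  move: (\prod_(1 <= i < r) _) (\prod_(1 <= i < r) _) (\prod_(r.+1 <= i < _) _)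
    (\prod_(r.+1 <= i < _) _) => P1 P2 P3 P4 reg.
  have e1 : A + (Cc r)%:R - r%:R = A - r%:R + (Cc r)%:R by ring.
  have e2 : A + r%:R - (R r)%:R = N + 2 * r%:R - 2 * s%:R + 2 by rewrite natr_new_col; ring.
  rewrite e1 e2 in reg.
  move: n1 ddN reg.
  move: (A - r%:R + (Cc r)%:R) (N + 2 * r%:R - 2 * s%:R) => a y a0 y0 reg.
  rewrite mulrA /=; have -> : P4 = (y + 2) * P3 / a by rewrite -reg mulrC mulKf.
  by field; rewrite a0 y0.
- have -> : \prod_(1 <= i < (Cc r).+1) (if (r < i)%N then rowf R A i else 1) = 1.
    rewrite big_nat big1 // => i /andP[_ iR]; case: ltnP => // ri.
    by have := col_anti RC s0 (ltnW rs); lia.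
  have sC : (s <= Cc s)%N by lia.
  have sR : (s <= R s)%N by rewrite RC.
  rewrite prod_gt // !mulr1.
  have reg : (A + (Cc s)%:R - s%:R) * \prod_(s.+1 <= a < (Cc s).+1) rowf R A a =
     (A + s%:R - (R s)%:R) * \prod_(s.+1 <= b < (R s).+1) colf Cc A b.
    apply: (rows_cols RC) => //.
    - move=> a /andP[ra aC]; rewrite (row_anti RC s0 (ltnW ra)) andbT.
      by rewrite RC // (ltn_trans _ ra).
    - move=> b /andP[rb bR]; rewrite (col_anti RC s0 (ltnW rb)) andbT.
      by rewrite -RC // (ltn_trans _ rb).
    move=> i j _ /andP[_ hj]; apply: corner_shift_neq0; rewrite (leq_trans hj) // ltnS.
    by rewrite (leq_trans _ Rn) // (row_anti RC).
  rewrite -hr in reg.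
  have -> : \prod_(1 <= j < r) rowf R A j = \prod_(1 <= j < s) rowf R A j * (rowf R A s *
      \prod_(s.+1 <= j < r) rowf R A j).
    rewrite (@big_cat_nat _ _ _ s 1 r) ?(ltnW rs) //= [X in _ * X = _]big_ltn //.
  have n1 : A - (R s)%:R + s%:R != 0 by apply: rowf_den_neq0.
  have fE : dfac add_row add_col r s = A - (R s)%:R + s%:R - 1.
    rewrite /dfac /add_row ltnNge (ltnW rs) /= eqxx (_ : (s == r) = false); last by lia.
    by rewrite addn0 addn1 -natr1 natr_new_col; ring.
  rewrite fE [rowf R A s]/rowf; move: reg.
  move: (\prod_(1 <= i < s) _) (\prod_(1 <= i < s) _) (\prod_(s.+1 <= i < _) _)
    (\prod_(s.+1 <= i < _) _) => P1 P2 P3 P4 reg.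
  have e1 : A + (Cc s)%:R - s%:R = N + 2 * r%:R - 2 * s%:R by rewrite natr_new_row; ring.
  have e2 : A + s%:R - (R s)%:R = A - (R s)%:R + s%:R by ring.
  rewrite e1 e2 in reg.
  move: n1 reg.
  move: (A - (R s)%:R + s%:R) (N + 2 * r%:R - 2 * s%:R) => a y a0 reg.
  first [have -> : P3 = y * P4 / a by rewrite reg mulrC mulKf | have -> : P4 = y * P3 / a by rewrite reg mulrC mulKf].
  by field; rewrite a0.
have e1 : s = r by [].
have -> : \prod_(1 <= i < (Cc r).+1) (if (r < i)%N then rowf R A i else 1) = 1.
  by rewrite big_nat big1 // => i /andP[_ iR]; case: ltnP => // ri; move: hr; rewrite e1; lia.
have -> : \prod_(1 <= j < (R s).+1) (if (s < j)%N then colf Cc A j else 1) = 1.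
  rewrite e1 big_nat big1 // => i /andP[_ iR]; case: ltnP => // ri; move: hs; rewrite e1; lia.
have -> : dfac add_row add_col r s = N + 2 * r%:R - 2 * s%:R.
  by rewrite /dfac /add_row e1 ltnn eqxx addn1 -natr1; have := natr_new_col; rewrite e1 => ->; ring.
by rewrite e1 /= !mulr1 [_ * \prod_(1 <= i < r) colf _ _ _]mulrC.
Qed.

(** Only the hooks of the boxes in the row and in the column of the new box
    change. *)
Lemma boxprod_hookf :
  boxprod R B (hookf add_row add_col) = boxprod R B (hookf R Cc) *
     (\prod_(1 <= i < r) rowf R (s%:R - r%:R) i * \prod_(1 <= j < s) colf Cc (s%:R - r%:R) j).
Proof.
have inN i j : (0 < i)%N -> (0 < j)%N -> (j <= R i)%N -> hookf add_row add_col i j = hookf R Cc i j *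
  ((if j == s then (if (i < r)%N then rowf R (s%:R - r%:R) i else 1) else 1) *
   (if i == r then (if (j < s)%N then colf Cc (s%:R - r%:R) j else 1) else 1)).
  move=> i0 j0 jR; have iC : (i <= Cc j)%N by rewrite -RC.
  have h0 : hookf R Cc i j != 0.
    have -> : hookf R Cc i j = (R i - j + (Cc j - i) + 1)%:R.
      by rewrite !natrD !natrB // /hookf; ring.
    by rewrite pnatr_eq0 addn1.
  rewrite /hookf /add_row /add_col in h0 *.
  case: (eqVneq i r) => [ir|ir]; case: (eqVneq j s) => [js|js]; rewrite ?addn0 ?addn1 ?mulr1 //.
  - by move: jR; rewrite js ir {1}hs ltnn.
  - have -> : (j < s)%N by rewrite hs ltnS -ir.
    rewrite ir in h0 *; rewrite mul1r -natr1 /colf.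
    have -> : s%:R - r%:R - j%:R + (Cc j)%:R = (R r)%:R - j%:R + (Cc j)%:R - r%:R + 1 :> K.
      by rewrite natr_new_col; ring.
    by rewrite mulrCA divff // mulr1; ring.
  have -> : (i < r)%N by rewrite hr ltnS -js.
  rewrite js in h0 *; rewrite -natr1 /rowf.
  have -> : s%:R - r%:R - (R i)%:R + i%:R = - ((R i)%:R - s%:R + (Cc s)%:R - i%:R + 1) :> K.
    by rewrite natr_new_row; ring.
  by rewrite invrN mulrN mulrN mulrCA divff // mulr1; ring.
rewrite (eq_boxprod B inN) !boxprodM (boxprod_col RC RB) // (boxprod_row RB) //.
by rewrite -hr -hs !prod_lt !minnn.
Qed.

End AddBox.

(** * The residue of the generating function *)

Section ContentResidue.
Variables (R Cc : nat -> nat).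
Hypothesis RC : forall i j, (0 < i)%N -> (0 < j)%N -> (j <= R i)%N = (i <= Cc j)%N.
Variable B : nat.
Hypothesis RB : forall i, (B < i)%N -> R i = 0%N.
Variables (r s : nat).
Hypotheses (hs : s = (R r).+1) (hr : r = (Cc s).+1).
Variables (K : numFieldType) (n : nat).
Hypotheses (Rn : (R 1 <= n)%N) (sn : (s <= n)%N).
Local Notation N := ((2 * n)%:R : K).
Local Notation A := (N + 1 + r%:R - s%:R : K).
Local Notation k := (kappa (brauer_omega K n)).
Variables (c : nat -> K) (m : nat).
Hypothesis prodc : forall f : K -> K,
  \prod_(0 <= i < m) f (c i) = boxprod R B (fun i j => f (k + j%:R - i%:R)).
Hypotheses (cm : c m = k + s%:R - r%:R) (cm0 : c m != 0).

Let r0 : (0 < r)%N. Proof. by rewrite hr. Qed.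
Let s0 : (0 < s)%N. Proof. by rewrite hs. Qed.

(** The two products over the rows above and the columns to the left of the new
    box, with numerators and denominators apart: the residue requires the former not
    to vanish at the content, and the latter not to vanish at its reflection. *)
Definition numf (y : K) := \prod_(1 <= i < r) (y - (R i)%:R + i%:R - 1) *
  \prod_(1 <= j < s) (y - j%:R + (Cc j)%:R + 1).
Definition denf (y : K) := \prod_(1 <= i < r) (y - (R i)%:R + i%:R) *
  \prod_(1 <= j < s) (y - j%:R + (Cc j)%:R).

Lemma numf_denf y : \prod_(1 <= i < r) rowf R y i * \prod_(1 <= j < s) colf Cc y j =
  numf y / denf y.
Proof. by rewrite /rowf /colf !prodf_div mulf_div. Qed.

Lemma numf_content : numf (s%:R - r%:R) != 0.
Proof.
rewrite mulf_neq0 // prodf_seq_neq0; apply/allP => i; rewrite mem_index_iota => /andP[i0 ir] /=.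
  have Ri : (s <= R i)%N by rewrite RC // -ltnS -hr.
  have -> : s%:R - r%:R - (R i)%:R + i%:R - 1 = - ((R i - s) + (r - i) + 1)%:R :> K.
    by rewrite !natrD !natrB ?(ltnW ir) //; ring.
  by rewrite oppr_eq0 pnatr_eq0 addn1.
have Ci : (r <= Cc i)%N by rewrite -RC // -ltnS -hs.
have -> : s%:R - r%:R - i%:R + (Cc i)%:R + 1 = ((Cc i - r) + (s - i) + 1)%:R :> K.
  by rewrite !natrD !natrB ?(ltnW ir) //; ring.
by rewrite pnatr_eq0 addn1.
Qed.

Lemma denf_A : denf A != 0.
Proof.
rewrite mulf_neq0 // prodf_seq_neq0; apply/allP => i; rewrite mem_index_iota => /andP[i0 ir] /=.
  exact: (rowf_den_neq0 RC hs hr K Rn sn).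
by apply: (colf_den_neq0 hs hr K Rn sn); lia.
Qed.

Lemma twice_k : 2 * k = - N - 1.
Proof. by rewrite /kappa /brauer_omega; field. Qed.

Let npoly (L : {poly K}) : {poly K} :=
  \prod_(1 <= i < r) (L + (i%:R - (R i)%:R - 1)%:P) *
  \prod_(1 <= j < s) (L + ((Cc j)%:R - j%:R + 1)%:P).
Let dpoly (L : {poly K}) : {poly K} :=
  \prod_(1 <= i < r) (L + (i%:R - (R i)%:R)%:P) *
  \prod_(1 <= j < s) (L + ((Cc j)%:R - j%:R)%:P).

Let npolyE L u : (npoly L).[u] = numf L.[u].
Proof.
rewrite /npoly /numf hornerM !horner_prod; congr (_ * _); apply: eq_bigr => i _;
by rewrite hornerD hornerC; ring.
Qed.

Let dpolyE L u : (dpoly L).[u] = denf L.[u].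
Proof.
rewrite /dpoly /denf hornerM !horner_prod; congr (_ * _); apply: eq_bigr => i _;
by rewrite hornerD hornerC; ring.
Qed.

(** By [boxprod_hfac], used at [u - kappa] and at [- u - kappa], the poles and
    zeros of the generating function cancel along the rows and the columns of the
    diagram, leaving only those at its corners.  At [u = c m] the argument
    [- u - kappa] takes the value [N + 1 + r - s]. *)
Lemma Ggen_residue : exists P Q bad : {poly K},
  [/\ bad != 0, Q.[c m] != 0,
      forall u, bad.[u] != 0 -> (u - c m) * Ggen n c m u * Q.[u] = P.[u] &
      - (P.[c m] / Q.[c m]) = (N + 2 * r%:R - 2 * s%:R) *
        (numf A / denf A) / (numf (s%:R - r%:R) / denf (s%:R - r%:R))].
Proof.
pose v : {poly K} := 'X - k%:P; pose w : {poly K} := - ('X + k%:P).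
have vE u : v.[u] = u - k by rewrite /v hornerXsubC.
have wE u : w.[u] = - (u + k) by rewrite /w hornerN hornerD hornerX hornerC.
pose Q := (2 *: 'X) * dpoly w * npoly v.
pose P := (2 *: 'X + 1) * ('X + (k + s%:R - r%:R)%:P) * npoly w * dpoly v.
have t1 : v.[c m] = s%:R - r%:R by rewrite vE cm; ring.
have t2 : w.[c m] = A.
  by rewrite wE cm -[A]opprK; congr (- _); rewrite -[LHS]/(k + s%:R - r%:R + k);
     transitivity (2 * k + s%:R - r%:R); [ring | rewrite twice_k; ring].
have PE u : P.[u] = (2 * u + 1) * (u + (k + s%:R - r%:R)) * numf w.[u] * denf v.[u].
  by rewrite /P 3!hornerM npolyE dpolyE !hornerD !hornerZ !hornerC hornerX.
have QE u : Q.[u] = 2 * u * denf w.[u] * numf v.[u].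
  by rewrite /Q 2!hornerM npolyE dpolyE !hornerZ hornerX.
have Qc : Q.[c m] != 0.
  by rewrite QE t1 t2; apply: mulf_neq0 numf_content; apply: mulf_neq0 denf_A;
     apply: mulf_neq0 cm0; rewrite pnatr_eq0.
have Q0 : Q != 0 by apply: contraNneq Qc => ->; rewrite horner0.
(* The values of [u] at which some box contributes a zero or a pole. *)
pose bad : {poly K} := Q * \prod_(i < B.+2) \prod_(j < (R 1).+2)
  (('X - (j%:R - i%:R + k)%:P) * ('X - (i%:R - j%:R - k)%:P)).
exists P, Q, bad; split => //.
- rewrite /bad mulf_neq0 // prodf_seq_neq0; apply/allP => i _ /=.
  rewrite prodf_seq_neq0; apply/allP => j _ /=.
  by rewrite mulf_neq0 // polyXsubC_eq0.
- move=> u; rewrite hornerM mulf_eq0 negb_or => /andP[Qu /eqP bu].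
  have nz i j : (i <= B.+1)%N -> (j <= (R 1).+1)%N ->
     (w.[u] + i%:R - j%:R != 0) && (v.[u] + i%:R - j%:R != 0).
    move=> hi hj; rewrite -negb_or; apply/negP => h; case: bu.
    rewrite horner_prod (bigD1 (Ordinal (hi : i < B.+2)%N)) //= horner_prod.
    rewrite (bigD1 (Ordinal (hj : j < (R 1).+2)%N)) //= hornerM !hornerXsubC.
    have -> : (u - (j%:R - i%:R + k)) * (u - (i%:R - j%:R - k)) =
      - ((w.[u] + i%:R - j%:R) * (v.[u] + i%:R - j%:R)) by rewrite vE wE; ring.
    by case/orP: h => /eqP ->; rewrite ?mul0r ?mulr0 oppr0 !mul0r.
  have nzw i j hi hj := proj1 (andP (nz i j hi hj)).
  have nzv i j hi hj := proj2 (andP (nz i j hi hj)).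
  have w0 : w.[u] != 0 by have := nzw 0 0 isT isT; rewrite subr0 addr0.
  have v0 : v.[u] != 0 by have := nzv 0 0 isT isT; rewrite subr0 addr0.
  have kw := boxprod_hfac RC RB hs hr w0 nzw.
  have kv := boxprod_hfac RC RB hs hr v0 nzv.
  have vt : v.[u] + r%:R - s%:R != 0.
    by apply: nzv; [rewrite hr ltnS (col_le RC RB) | rewrite hs ltnS (row_anti RC)].
  have u0 : u != 0 by apply: contraNneq Qu; rewrite QE => ->; rewrite mulr0 !mul0r.
  have dw : denf w.[u] != 0 by apply: contraNneq Qu; rewrite QE => ->; rewrite mulr0 mul0r.
  have nv : numf v.[u] != 0 by apply: contraNneq Qu; rewrite QE => ->; rewrite mulr0.
  rewrite PE QE.
  have -> : Ggen n c m u = (u + k) * (2 * u + 1) / (2 * u * (u - k)) *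
     (boxprod R B (fun i j => hfac (w.[u] + i%:R - j%:R)) /
      boxprod R B (fun i j => hfac (v.[u] + i%:R - j%:R))).
    rewrite /Ggen; congr (_ * _).
    have -> : boxprod R B (fun i j => hfac (w.[u] + i%:R - j%:R)) =
       \prod_(0 <= i < m) hfac (u + c i).
      rewrite (prodc (fun x => hfac (u + x))); apply: eq_boxprod => i j _ _ _.
      by rewrite -hfacN wE; congr hfac; ring.
    have -> : boxprod R B (fun i j => hfac (v.[u] + i%:R - j%:R)) =
       \prod_(0 <= i < m) hfac (u - c i).
      rewrite (prodc (fun x => hfac (u - x))); apply: eq_boxprod => i j _ _ _.
      by rewrite vE; congr hfac; ring.
    rewrite -prodf_div; apply: eq_bigr => i _.
    by rewrite /hfac invf_div mulf_div.
  rewrite kw kv !numf_denf; move: dw nv v0 w0 vt.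
  have -> : u - c m = v.[u] + r%:R - s%:R by rewrite vE cm; ring.
  have -> : u + k = - w.[u] by rewrite wE opprK.
  have -> : u + (k + s%:R - r%:R) = - (w.[u] + r%:R - s%:R) by rewrite wE; ring.
  rewrite -vE; move: v.[u] w.[u] => y z.
  case: (eqVneq (denf y) 0) => [->|dv]; last first.
    move: (numf y) (numf z) (denf y) (denf z) dv => a b d e dv e0 a0 y0 z0 yr.
    by field; rewrite dv y0 a0 yr e0 z0 u0.
  by rewrite !(invr0, mulr0) mul0r.
rewrite PE QE t1 t2.
have -> : c m + (k + s%:R - r%:R) = 2 * c m by rewrite -cm; ring.
have -> : 2 * c m + 1 = - (N + 2 * r%:R - 2 * s%:R).
  transitivity (2 * k + 2 * s%:R - 2 * r%:R + 1); first by rewrite cm; ring.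
  by rewrite twice_k; ring.
have := numf_content; have := denf_A; move: cm0.
move: (c m) (numf A) (denf A) (numf (s%:R - r%:R)) (denf (s%:R - r%:R)) => x a b d e x0 b0 d0.
case: (eqVneq e 0) => [->|e0]; first by rewrite !(invr0, mulr0, mul0r, oppr0).
by field; rewrite d0 b0 x0 e0.
Qed.

End ContentResidue.

(** * Diagrams and tableaux as sequences *)

Section Diagrams.
Implicit Types mu lam rho : seq nat.

(** The two descriptions of the boxes of a diagram; everything else about
    diagrams is derived from it. *)
Lemma row_col mu i j : is_diagram mu -> (0 < i)%N -> (0 < j)%N ->
  (j <= rowlen mu i)%N = (i <= collen mu j)%N.
Proof.
case/andP=> + _; case: i => // i + _ j0; rewrite /rowlen /collen /=.
elim: mu i => [|x mu IH] [|i] //= pm; rewrite ?nth_nil; first by lia.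
- by lia.
- case: (leqP j x) => //= xj; rewrite add0n; apply/esym/negbTE.
  rewrite -has_count; apply/hasPn => y ym.
  have /allP/(_ _ ym) /= := order_path_min (rev_trans leq_trans) pm.
  by rewrite /geq /= -ltnNge => yx; apply: leq_ltn_trans xj.
rewrite (IH i (path_sorted pm)); case: (leqP j x) => //= xj; rewrite add0n.
have -> : count (leq j) mu = 0%N.
  apply/eqP; rewrite -leqn0 leqNgt -has_count; apply/hasPn => y ym.
  have /allP/(_ _ ym) /= := order_path_min (rev_trans leq_trans) pm.
  by rewrite /geq /= -ltnNge => yx; apply: leq_ltn_trans xj.
by rewrite !ltn0.
Qed.

Lemma rowlen_size mu i : (size mu < i)%N -> rowlen mu i = 0%N.
Proof. by case: i => // i h; rewrite /rowlen nth_default. Qed.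

Lemma collen1 mu : is_diagram mu -> collen mu 1 = size mu.
Proof.
case/andP=> _ n0; apply/eqP; rewrite /collen -all_count; apply/allP => x xm.
by rewrite lt0n; apply: contraNneq n0 => <-.
Qed.

Lemma diagram_eq mu lam : is_diagram mu -> is_diagram lam ->
  (forall i, (0 < i)%N -> rowlen mu i = rowlen lam i) -> mu = lam.
Proof.
move=> dm dl h; have e j : (0 < j)%N -> collen mu j = collen lam j.
  move=> j0; apply/eqP; rewrite eqn_leq; apply/andP; split.
    by case: (posnP (collen mu j)) => [->//|c0]; rewrite -row_col // -h // row_col.
  by case: (posnP (collen lam j)) => [->//|c0]; rewrite -row_col // h // row_col.
have es : size mu = size lam by rewrite -!collen1 // e.
by apply: (@eq_from_nth _ 0%N) => // i _; apply: (h i.+1).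
Qed.

Lemma rowlen_conj mu i : is_diagram mu -> (0 < i)%N -> rowlen (conj_diagram mu) i = collen mu i.
Proof.
move=> dm; case: i => // i _; rewrite /rowlen /conj_diagram /=.
case: (ltnP i (rowlen mu 1)) => h; first by rewrite (nth_map 0%N) ?size_iota // nth_iota.
rewrite nth_default ?size_map ?size_iota //; apply/esym/eqP; rewrite -leqn0 leqNgt -row_col //.
by rewrite -leqNgt.
Qed.

Lemma conj_is_diagram mu : is_diagram mu -> is_diagram (conj_diagram mu).
Proof.
move=> dm; apply/andP; split.
  apply: (homo_sorted_in (e := ltn) (P := [pred j | 0 < j]%N)); last exact: iota_ltn_sorted.
    move=> j j' j0 j0' jj'; apply: (col_anti (R := rowlen mu)) => //; last exact: ltnW.
    by move=> *; apply: row_col.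
  by apply/allP => j; rewrite mem_iota => /andP[].
apply/mapP => -[j]; rewrite mem_iota add1n ltnS => /andP[j0 jr] e.
by move: jr; rewrite row_col // -e.
Qed.

Lemma collen_conj mu j : is_diagram mu -> (0 < j)%N -> collen (conj_diagram mu) j = rowlen mu j.
Proof.
move=> dm j0; have dc := conj_is_diagram dm.
have h i : (0 < i)%N -> (i <= collen (conj_diagram mu) j)%N = (i <= rowlen mu j)%N.
  by move=> i0; rewrite -(row_col dc) // (rowlen_conj dm) // (row_col dm).
apply/eqP; rewrite eqn_leq; apply/andP; split.
  by case: (posnP (collen (conj_diagram mu) j)) => [->//|c0]; rewrite -h.
by case: (posnP (rowlen mu j)) => [->//|c0]; rewrite h.
Qed.

Lemma conjK mu : is_diagram mu -> conj_diagram (conj_diagram mu) = mu.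
Proof.
move=> dm; have dc := conj_is_diagram dm; apply: diagram_eq => //.
  exact: conj_is_diagram.
by move=> i i0; rewrite rowlen_conj // collen_conj.
Qed.

Lemma size_conj mu : is_diagram mu -> size (conj_diagram mu) = rowlen mu 1.
Proof. by move=> _; rewrite size_map size_iota. Qed.

Section BoxProducts.
Variable K : comPzRingType.

Lemma boxprod_conj mu (F : nat -> nat -> K) : is_diagram mu ->
  boxprod (rowlen (conj_diagram mu)) (size (conj_diagram mu)) F =
  boxprod (rowlen mu) (size mu) (fun i j => F j i).
Proof.
move=> dm; rewrite size_conj // /boxprod.
transitivity (\prod_(1 <= b < (rowlen mu 1).+1) \prod_(1 <= a < (collen mu b).+1) F b a).
  by apply: eq_big_nat => b /andP[b0 _]; rewrite rowlen_conj.
apply/esym; apply: (prod_exchange (Cc := collen mu)) => //.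
- by move=> i j i0 j0; apply: row_col.
- move=> a /andP[a0 _]; apply: (row_anti (Cc := collen mu)) => // *; exact: row_col.
- by move=> b /andP[b0 _]; rewrite /collen count_size.
Qed.

Lemma boxprod_bound mu B (F : nat -> nat -> K) : (size mu <= B)%N ->
  boxprod (rowlen mu) B F = boxprod (rowlen mu) (size mu) F.
Proof.
move=> sB; rewrite /boxprod (@big_cat_nat _ _ _ (size mu).+1) //= -[RHS]mulr1; congr (_ * _).
by rewrite big_nat big1 // => i /andP[h _]; rewrite rowlen_size // big_geq.
Qed.

Lemma boxprod_add (R R' : nat -> nat) B r (F : nat -> nat -> K) : (0 < r <= B)%N ->
  (forall i, (0 < i)%N -> R' i = (R i + (i == r))%N) ->
  boxprod R' B F = F r (R r).+1 * boxprod R B F.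
Proof.
move=> rB hR; rewrite /boxprod.
transitivity (\prod_(1 <= i < B.+1) ((if i == r then F i (R i).+1 else 1) *
    \prod_(1 <= j < (R i).+1) F i j)).
  apply: eq_big_nat => i /andP[i0 _]; rewrite hR //; case: eqP => _; last by rewrite addn0 mul1r.
  by rewrite addn1 big_nat_recr //= mulrC.
by rewrite big_split /= prod_pick ltnS rB.
Qed.
End BoxProducts.

Lemma sumn_rowlen mu : sumn mu = (\sum_(1 <= i < (size mu).+1) rowlen mu i)%N.
Proof. by rewrite big_add1 /= sumnE (big_nth 0%N). Qed.

(** Both numbers are the degree of the product of ['X] over all boxes. *)
Lemma sumn_conj mu : is_diagram mu -> sumn (conj_diagram mu) = sumn mu.
Proof.
move=> dm; have h := boxprod_conj (K := {poly int}) (fun _ _ => 'X) dm.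
have e lam : boxprod (rowlen lam) (size lam) (fun _ _ => 'X : {poly int}) = 'X^(sumn lam).
  rewrite /boxprod sumn_rowlen; elim/big_rec2: _ => [|i x y _ ->]; first by rewrite expr0.
  by rewrite prodr_const_nat subn1 /= exprD.
by have /(congr1 (fun p : {poly int} => size p)) := h; rewrite !e !size_polyXn => -[].
Qed.

(** Transposing the boxes exchanges row and column lengths. *)
Lemma D_conj (K : numFieldType) n lam : is_diagram lam ->
  D K n (conj_diagram lam) =
   (boxprod (rowlen lam) (size lam) (hookf K (rowlen lam) (collen lam)))^-1 *
    boxprod (rowlen lam) (size lam) (dfac K n (rowlen lam) (collen lam)).
Proof.
move=> dl; have dc := conj_is_diagram dl; congr (_^-1 * _).
  transitivity (boxprod (rowlen (conj_diagram lam)) (size (conj_diagram lam))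
     (fun i j => (hook (conj_diagram lam) i j)%:R : K)).
    by rewrite /hook_product natr_prod; apply: eq_bigr => i _; rewrite natr_prod.
  rewrite boxprod_conj //; apply: eq_boxprod => i j i0 j0 jR.
  rewrite /hook rowlen_conj // collen_conj // /hookf !natrD !natrB //; last by rewrite -row_col.
  by ring.
have -> : \prod_(1 <= i < (size (conj_diagram lam)).+1)
  \prod_(1 <= j < (rowlen (conj_diagram lam) i).+1)
     ((2 * n)%:Z + 1 + dbox (conj_diagram lam) i j)%:~R =
  boxprod (rowlen (conj_diagram lam)) (size (conj_diagram lam))
     (fun i j => ((2 * n)%:Z + 1 + dbox (conj_diagram lam) i j)%:~R : K) by [].
rewrite boxprod_conj //; apply: eq_boxprod => i j i0 j0 jR.
rewrite /dbox /dfac; case: ifP => _; rewrite ?rowlen_conj ?collen_conj //.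
  by rewrite !(rmorphD, rmorphB, rmorphN) /= ?pmulrn; ring.
by rewrite !(rmorphD, rmorphB, rmorphN) /= ?pmulrn; ring.
Qed.

End Diagrams.

Section NonVanishing.
Variables (K : numFieldType) (mu : seq nat).
Hypothesis dm : is_diagram mu.

Lemma hookf_neq0 : boxprod (rowlen mu) (size mu) (hookf K (rowlen mu) (collen mu)) != 0.
Proof.
rewrite /boxprod prodf_seq_neq0; apply/allP => i.
rewrite mem_index_iota => /andP[i0 _] /=; rewrite prodf_seq_neq0; apply/allP => j.
rewrite mem_index_iota ltnS => /andP[j0 jR] /=.
have -> : hookf K (rowlen mu) (collen mu) i j = (rowlen mu i - j + (collen mu j - i) + 1)%:R.
  by rewrite !natrD !natrB // /hookf -?row_col //; ring.
by rewrite pnatr_eq0 addn1.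
Qed.

Lemma dfac_neq0 n : (rowlen mu 1 <= n)%N ->
  boxprod (rowlen mu) (size mu) (dfac K n (rowlen mu) (collen mu)) != 0.
Proof.
move=> mn; have RC := fun i j => @row_col mu i j dm.
rewrite /boxprod prodf_seq_neq0; apply/allP => i.
rewrite mem_index_iota => /andP[i0 _] /=; rewrite prodf_seq_neq0; apply/allP => j.
rewrite mem_index_iota ltnS => /andP[j0 jR] /=.
have rn a : (0 < a)%N -> (rowlen mu a <= n)%N.
  by move=> a0; apply: leq_trans mn; apply: (row_anti RC).
have jn := leq_trans jR (rn _ i0).
rewrite /dfac; case: ltnP => ij.
  have -> : (2 * n)%:R + 2 + (collen mu i)%:R + (collen mu j)%:R - i%:R - j%:R =
    ((2 * n + 2 - i - j) + collen mu i + collen mu j)%:R :> K.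
    by rewrite !natrD !natrB ?natrD; [ring | lia | lia].
  by rewrite pnatr_eq0; lia.
have r1 := rn _ i0; have r2 := rn _ j0.
have -> : (2 * n)%:R - (rowlen mu i)%:R - (rowlen mu j)%:R + i%:R + j%:R =
    ((2 * n - rowlen mu i - rowlen mu j) + i + j)%:R :> K.
  by rewrite !natrD !natrB; [ring | lia | lia].
by rewrite pnatr_eq0; lia.
Qed.

(** With at most [n] columns all the factors are positive. *)
Lemma D_conj_neq0 n : (rowlen mu 1 <= n)%N -> D K n (conj_diagram mu) != 0.
Proof. by move=> mn; rewrite D_conj // mulf_neq0 ?invr_eq0 ?hookf_neq0 ?dfac_neq0. Qed.
End NonVanishing.

Section AddBoxToSequence.
Variables (mu : seq nat) (k : nat).
Hypotheses (km : (k <= size mu)%N) (dm : is_diagram mu) (dl : is_diagram (incr_nth mu k)).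
Local Notation lam := (incr_nth mu k).
Local Notation r := k.+1.
Local Notation s := (rowlen mu r).+1.

Lemma rowlen_incr i : (0 < i)%N -> rowlen lam i = (rowlen mu i + (i == r))%N.
Proof. by case: i => // i _; rewrite /rowlen nth_incr_nth addnC eqSS eq_sym. Qed.

(** The new box is the first one below the column in which it is placed, because
    the enlarged diagram has weakly decreasing rows. *)
Lemma corner_col : r = (collen mu s).+1.
Proof.
apply/eqP; rewrite eqn_leq; apply/andP; split; last first.
  by rewrite ltnNge -row_col // ltnn.
case: k km dl rowlen_incr => // k' km' dl' ri; rewrite ltnS -row_col //.
have := row_anti (fun i j => @row_col _ i j dl') (isT : 0 < k'.+1)%N (leqnSn k'.+1).
rewrite !ri // eqxx addn1 => /leq_trans; apply.
by rewrite (_ : (_ == _) = false) ?addn0 //; lia.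
Qed.

Lemma collen_incr j : (0 < j)%N -> collen lam j = (collen mu j + (j == s))%N.
Proof.
move=> j0; have h i : (0 < i)%N -> (i <= collen lam j)%N = (i <= collen mu j + (j == s))%N.
  move=> i0; rewrite -row_col // rowlen_incr //; have hr := corner_col.
  case: (eqVneq i r) => [ir|ir]; case: (eqVneq j s) => [js|js]; rewrite ?addn0 ?addn1.
  - by rewrite ir js leqnn -hr leqnn.
  - have -> : (j <= (rowlen mu i).+1)%N = (j <= rowlen mu i)%N.
      by rewrite leq_eqVlt ir (negPf js) /= ltnS.
    by rewrite row_col.
  - rewrite row_col //; have -> : (i <= (collen mu j).+1)%N = (i <= collen mu j)%N.
      by rewrite leq_eqVlt js -hr (negPf ir) /= [X in (_ < X)%N]hr ltnS.
    by [].
  by rewrite row_col.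
have [le1 le2] : (collen lam j <= collen mu j + (j == s))%N /\ (collen mu j + (j == s) <= collen lam j)%N.
  split; first by case: (posnP (collen lam j)) => [->//|c0]; rewrite -h.
  by case: (posnP (collen mu j + (j == s))) => [->//|c0]; rewrite h.
by apply/eqP; rewrite eqn_leq le1 le2.
Qed.

Lemma size_incr : (size mu <= size lam)%N && (r <= size lam)%N.
Proof. by rewrite size_incr_nth; case: ltnP => h; rewrite ?leqnn ?h ?(leqW h) // andbT leqW. Qed.

Lemma box_le_row1 : (s <= rowlen lam 1)%N.
Proof.
have := row_anti (fun i j => @row_col _ i j dl) (isT : 0 < 1)%N (isT : 1 <= r)%N.
by rewrite [rowlen lam r]rowlen_incr // eqxx addn1.
Qed.

Lemma row1_incr : (rowlen mu 1 <= rowlen lam 1)%N.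
Proof. by rewrite rowlen_incr // leq_addr. Qed.

(** The products over the old boxes cancel between [boxprod_dfac] and
    [boxprod_hookf]. *)
Lemma D_ratio (K : numFieldType) n (t := s%:R - r%:R : K) (A := (2 * n)%:R + 1 + r%:R - s%:R : K) :
  (rowlen lam 1 <= n)%N ->
  D K n (conj_diagram lam) / D K n (conj_diagram mu) =
  ((2 * n)%:R + 2 * r%:R - 2 * s%:R) *
    (numf (rowlen mu) (collen mu) r s A / denf (rowlen mu) (collen mu) r s A) /
    (numf (rowlen mu) (collen mu) r s t / denf (rowlen mu) (collen mu) r s t).
Proof.
move=> ln; have sn := leq_trans box_le_row1 ln; have mn := leq_trans row1_incr ln.
have /andP[sz rz] := size_incr.
have RC := fun i j => @row_col mu i j dm; have RB i (h : (size lam < i)%N) : rowlen mu i = 0%N.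
  by apply: rowlen_size; apply: leq_ltn_trans h.
have e1 := boxprod_dfac RC RB (erefl s) corner_col K mn sn.
have e2 := boxprod_hookf RC RB (erefl s) corner_col K.
have d1 (F F' : nat -> nat -> K) : (forall i j, (0 < i)%N -> (0 < j)%N -> F i j = F' i j) ->
    boxprod (rowlen lam) (size lam) F = F' r s * boxprod (rowlen mu) (size lam) F'.
  move=> h; rewrite (boxprod_add (R := rowlen mu) (r := r)) ?rz //; last exact: rowlen_incr.
  by rewrite h //; congr (_ * _); apply: eq_boxprod => i j i0 j0 _; apply: h.
rewrite !D_conj // -!(boxprod_bound _ sz).
have -> : boxprod (rowlen lam) (size lam) (dfac K n (rowlen lam) (collen lam)) =
  boxprod (rowlen mu) (size lam) (dfac K n (rowlen mu) (collen mu)) *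
    (((2 * n)%:R + 2 * r%:R - 2 * s%:R) *
       (numf (rowlen mu) (collen mu) r s A / denf (rowlen mu) (collen mu) r s A)).
  rewrite -numf_denf -e1; apply: d1 => i j i0 j0.
  by rewrite /dfac /add_row /add_col !rowlen_incr ?collen_incr.
have -> : boxprod (rowlen lam) (size lam) (hookf K (rowlen lam) (collen lam)) =
  boxprod (rowlen mu) (size lam) (hookf K (rowlen mu) (collen mu)) *
       (numf (rowlen mu) (collen mu) r s t / denf (rowlen mu) (collen mu) r s t).
  rewrite -numf_denf -e2.
  rewrite (d1 _ (hookf K (add_row (rowlen mu) r) (add_col (collen mu) s))).
    rewrite {1}/hookf /add_row /add_col !eqxx !addn1 -corner_col.
    by rewrite [X in X * _](_ : _ = 1) ?mul1r //; ring.
  by move=> i j i0 j0; rewrite /hookf /add_row /add_col !rowlen_incr ?collen_incr.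
have h0 := hookf_neq0 K dm; have f0 := dfac_neq0 K dm mn; rewrite -!(boxprod_bound _ sz) in h0 f0.
move: (boxprod _ _ _) (boxprod _ _ _) f0 h0 (numf _ _ _ _ t / _) (numf _ _ _ _ A / _) => a b a0 b0 x y.
case: (eqVneq x 0) => [->|x0]; first by rewrite !(mulr0, invr0) !mul0r.
by field; rewrite ?a0 ?b0 ?x0.
Qed.

End AddBoxToSequence.

Lemma adds_boxP mu lam : adds_box mu lam ->
  exists k, [/\ (k <= size mu)%N, lam = incr_nth mu k & added_row mu lam = k.+1].
Proof.
move=> ab; rewrite /added_row; set k := find _ _; exists k.
have kl : (k < (size mu).+1)%N by move: ab; rewrite /adds_box has_find size_iota.
by split=> //; have /eqP := nth_find 0%N ab; rewrite nth_iota.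
Qed.

Section Tableaux.
Variables (lam : seq nat) (T : tableau).
Hypothesis hT : std_tableau lam T.
Local Notation La := (Lambda T).

Lemma Lambda_diagram m : is_diagram (La m).
Proof.
case/and3P: hT => /allP da _ _; rewrite /Lambda; case: (ltnP m (size T).+1) => h.
  by have := mem_nth [::] (h : m < size ([::] :: T))%N; rewrite inE => /orP[/eqP->|/da].
by rewrite nth_default.
Qed.

Lemma Lambda_step m : (m < size T)%N -> exists k,
  [/\ (k <= size (La m))%N, La m.+1 = incr_nth (La m) k & added_row (La m) (La m.+1) = k.+1].
Proof. by case/and3P: hT => _ /(pathP [::]) h _ mT; apply: adds_boxP; apply: h. Qed.

Lemma Lambda_last : La (size T) = lam.
Proof. by case/and3P: hT => _ _ /eqP <-; rewrite /Lambda -nth_last; case: (T). Qed.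

Lemma sumn_Lambda m : (m <= size T)%N -> sumn (La m) = m.
Proof.
elim: m => [|m IH] mT //; have [k [_ -> _]] := Lambda_step mT.
have e : sumn (incr_nth (La m) k) = (sumn (La m)).+1.
  by elim: (La m) k => [|x v IHv] [|k] //=; rewrite ?IHv ?addnS // sumn_ncons mul0n.
by rewrite e IH // ltnW.
Qed.

Lemma size_tableau : size T = sumn lam.
Proof. by rewrite -Lambda_last sumn_Lambda. Qed.

Lemma row1_Lambda m : (m <= size T)%N -> (rowlen (La m) 1 <= rowlen lam 1)%N.
Proof.
rewrite -Lambda_last => mT; rewrite -{1}(subnKC mT).
have : (m + (size T - m) <= size T)%N by rewrite subnKC.
elim: (_ - m)%N => [|d IH] hd; first by rewrite addn0.
rewrite addnS in hd *; have [k [km e _]] := Lambda_step hd.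
by apply: leq_trans (IH (ltnW hd)) _; rewrite e row1_incr.
Qed.

Lemma content_box (F : fieldType) (om : F) m k :
  La m.+1 = incr_nth (La m) k -> added_row (La m) (La m.+1) = k.+1 ->
  content om T m.+1 = kappa om + (rowlen (La m) k.+1).+1%:R - k.+1%:R.
Proof. by move=> e ek; rewrite /content /= ek {1}e rowlen_incr // eqxx addn1. Qed.

(** The boxes filled by the first [m] numbers are those of the [m]-th diagram. *)
Lemma prod_content (F : fieldType) (om : F) (f : F -> F) m B :
  (m <= size T)%N -> (size (La m) <= B)%N ->
  \prod_(0 <= i < m) f (content om T i.+1) =
  boxprod (rowlen (La m)) B (fun i j => f (kappa om + j%:R - i%:R)).
Proof.
elim: m => [|m IH] mT sB.
  rewrite big_geq // /boxprod big1 // => i _; apply: big_geq.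
  by rewrite /Lambda /= /rowlen nth_nil.
have [k [km e ek]] := Lambda_step mT; have := size_incr (La m) k; rewrite -e => /andP[s1 s2].
rewrite big_nat_recr //= IH ?(ltnW mT) ?(leq_trans s1) // (content_box _ e ek).
rewrite (boxprod_add (R := rowlen (La m)) (R' := rowlen (La m.+1)) (r := k.+1)) ?(leq_trans s2) //.
  by rewrite mulrC.
by move=> i i0; rewrite e rowlen_incr.
Qed.

End Tableaux.

(** * The partial trace of a tableau idempotent *)

Section TraceFormula.
Variables (K : numClosedFieldType) (n : nat).
Hypothesis n0 : (0 < n)%N.
Local Notation om := (brauer_omega K n).
Local Notation k := (kappa om).
Variable act : forall m, {linear brauer K m -> 'End(tensor K n m)}.
Hypothesis hact : forall m, tensor_action (act m).
Variables (lam : seq nat) (T : tableau).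
Hypotheses (hT : std_tableau lam T) (ln : (rowlen lam 1 <= n)%N).
Local Notation La := (Lambda T).
Local Notation c := (fun r => content om T r.+1).

Lemma om_neq0 : om != 0.
Proof. by rewrite oppr_eq0 pnatr_eq0; lia. Qed.

(** In a column with number at most [n], the content is at most
    [(- N - 1) / 2 + n - 1 = - 3 / 2]: this is where the bound on the first row is
    used. *)
Lemma content_neg m : (m < size T)%N -> exists d : nat, c m = - (d%:R + 3 / 2).
Proof.
move=> mT; have [b [km e ek]] := Lambda_step hT mT.
have dm := Lambda_diagram hT m; have dm1 := Lambda_diagram hT m.+1.
have sl : ((rowlen (La m) b.+1).+1 <= n)%N.
  apply: leq_trans ln; apply: leq_trans (row1_Lambda hT mT); rewrite e.
  by apply: box_le_row1; rewrite -e.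
exists (n - (rowlen (La m) b.+1).+1 + b)%N; rewrite (content_box om e ek).
rewrite natrD natrB // /kappa /brauer_omega natrM -[b.+1%:R]natr1.
by field.
Qed.

Lemma content_neq0 m : (m < size T)%N -> c m != 0.
Proof.
move=> mT; have [d ->] := content_neg mT; rewrite oppr_eq0 gt_eqF //.
by rewrite ltr_wpDl // ?ler0n // divr_gt0 ?ltr0n.
Qed.

Lemma content_sum i j : (i < size T)%N -> (j < size T)%N -> c i + c j != 0.
Proof.
move=> iT jT; have [d ->] := content_neg iT; have [d' ->] := content_neg jT.
rewrite -opprD oppr_eq0 gt_eqF // addr_gt0 //.
  by rewrite ltr_wpDl // ?ler0n // divr_gt0 ?ltr0n.
by rewrite ltr_wpDl // ?ler0n // divr_gt0 ?ltr0n.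
Qed.

Lemma content_first : (0 < size T)%N -> c 0%N = k.
Proof.
move=> T0; have [b [km e ek]] := Lambda_step hT T0; rewrite (content_box om e ek).
move: km; rewrite leqn0 => /eqP ->; rewrite /Lambda /rowlen /=.
by rewrite addrK.
Qed.

Lemma tab_idem_idem m : (m <= size T)%N -> tab_idem c (idem om T m : Br om m).
Proof.
case: (posnP (size T)) => [T0|T0 mT].
  by rewrite T0 leqn0 => /eqP ->; apply: tab_idem0.
have h i j : (i < j < size T)%N -> c i + c j != 0.
  by case/andP=> ij jT; apply: content_sum => //; apply: ltn_trans jT.
by case: (idem_spec om_neq0 (content_first T0) h mT).
Qed.

(** The closure is a residue of the generating function of the contents, which is
    the ratio of dimensions; the minus sign comes from the definition of the
    closure. *)
Theorem ptrace_idem m : (m < size T)%N ->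
  ptrace (act m.+1 (idem om T m.+1)) =
  (D K n (conj_diagram (La m.+1)) / D K n (conj_diagram (La m))) *: act m (idem om T m).
Proof.
move=> mT; have T0 : (0 < size T)%N by apply: leq_ltn_trans mT.
have h i j : (i < j < size T)%N -> c i + c j != 0.
  by case/andP=> ij jT; apply: content_sum => //; apply: ltn_trans jT.
have spec := idem_spec om_neq0 (content_first T0) h.
have [b [km e ek]] := Lambda_step hT mT.
have dm := Lambda_diagram hT m; have dm1 := Lambda_diagram hT m.+1.
have ln1 := leq_trans (row1_Lambda hT mT) ln.
rewrite e in dm1 ln1 *.
have sn := leq_trans (box_le_row1 dm1) ln1; have mn := leq_trans (row1_incr _ _) ln1.
have RC := fun i j => @row_col (La m) i j dm.
have RB i := @rowlen_size (La m) i.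
have prodc (f : K -> K) : \prod_(0 <= i < m) f (c i) =
   boxprod (rowlen (La m)) (size (La m)) (fun i j => f (k + j%:R - i%:R)).
  exact: (prod_content hT om f (ltnW mT) (leqnn _)).
have := @Ggen_residue _ _ RC _ RB _ _ erefl (corner_col km dm dm1) K n mn sn c m
  prodc (content_box om e ek) (content_neq0 mT).
case=> P [Q [bad [b0 Qc hG res]]].
have hE r : (r <= size T)%N -> tab_idem c (idem om T r : Br om r) by move=> rT; case: (spec r rT).
have hS r (rT : (r < size T)%N) := proj2 (spec r (ltnW rT)) rT.
have := @closure_residue K n act hact c (size T) (fun r => idem om T r) erefl hE hS m P Q bad
  mT (content_neq0 mT) b0 Qc hG.
rewrite /cl (D_ratio km dm dm1 K ln1) -res => h1.
by rewrite -[LHS]opprK h1 -scaleNr.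
Qed.

End TraceFormula.

Lemma idem_eq (F : fieldType) (om : F) T T' m :
  (forall r, (r <= m)%N -> Lambda T r = Lambda T' r) -> idem om T m = idem om T' m.
Proof.
elim: m => [|m IH] h //=; rewrite IH => [|r rm]; last by apply: h; apply: leqW.
case: m {IH} h => // m h.
by rewrite /content !h.
Qed.

Lemma Lambda_take T m r : (r <= m)%N -> Lambda (take m T) r = Lambda T r.
Proof. by case: r => // r rm; rewrite /Lambda /= nth_take. Qed.

(** * Primitivity of the tableau idempotents *)

Section YoungSubalgebra.
Variables (F : fieldType) (om : F) (m : nat).

(** The group algebra of the permutations of the first [k] dots. *)
Inductive young (k : nat) : Br om m -> Prop :=
| young_perm (s : {perm 'I_m}) : (forall i : 'I_m, (k <= i)%N -> s i = i) -> young k (bperm om s)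
| youngD x y : young k x -> young k y -> young k (x + y)
| youngZ a x : young k x -> young k (a *: x).

Lemma young1 k : young k 1.
Proof. by rewrite -bperm1; apply: young_perm => i _; rewrite perm1. Qed.

Lemma young0 k : young k 0.
Proof. by rewrite -(scale0r 1); apply/youngZ/young1. Qed.

Lemma youngM k x y : young k x -> young k y -> young k (x * y).
Proof.
move=> hx hy; elim: hx => [s hs|u v _ hu _ hv|a u _ hu].
- elim: hy => [t ht|u v _ hu _ hv|a u _ hu].
  + by rewrite bpermM; apply: young_perm => i ki; rewrite permM hs ?ht // hs.
  + by rewrite mulrDr; apply: youngD.
  by rewrite -scalerAr; apply: youngZ.
- by rewrite mulrDl; apply: youngD.
by rewrite -scalerAl; apply: youngZ.
Qed.

Lemma young_horner k x p : young k x -> young k (horner_alg x p).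
Proof.
move=> hx; rewrite horner_algE; elim/big_ind: _ => [|u v|i _].
- exact: young0.
- exact: youngD.
apply: youngZ; elim: (i : nat) => [|r IH].
  by rewrite expr0; apply: young1.
by rewrite exprS; apply: youngM.
Qed.

Lemma young_JMs k (b : 'I_m) : (b < k)%N -> young k (JMs om b).
Proof.
move=> bk; rewrite JMsE; elim/big_ind: _ => [|u v|a ab].
- exact: young0.
- exact: youngD.
apply: young_perm => i ki; rewrite tpermD // -(inj_eq val_inj) /=.
  by rewrite neq_ltn (leq_trans _ ki) // (ltn_trans ab).
by rewrite neq_ltn (leq_trans bk ki).
Qed.

Lemma young_comm (b : 'I_m) x : young b x -> JMs om b * x = x * JMs om b.
Proof.
elim=> [s hs|u v _ hu _ hv|a u _ hu].
- have sb : s b = b by apply: hs.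
  apply: JMs_perm => // a; case: (ltnP a b) => ab; last first.
    by rewrite hs // ltnNge ab.
  rewrite ltnNge; apply/negP => bs; have := hs _ bs => /perm_inj e.
  by move: bs; rewrite e leqNgt ab.
- by rewrite mulrDl mulrDr hu hv.
by rewrite -scalerAl -scalerAr hu.
Qed.

Lemma bflip_JMs (b : 'I_m) : bflip (JMs om b) = JMs om b.
Proof. by rewrite JMsE raddf_sum /=; apply: eq_bigr => a _; rewrite bflip_perm tpermV. Qed.

End YoungSubalgebra.

Section Primitive.
Variables (C : numClosedFieldType) (om : C) (c : nat -> C) (m : nat) (E : Br om m).
Hypothesis hE : tab_idem c E.
Local Notation X := (JMs om).
Local Notation al := (fun i => c i - kappa om).

Lemma idem_JMs i : E * X i = al i *: E.
Proof.
have := kills_nonperm (ti_kill hE) (JM_mod_nonperm om i).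
rewrite mulrBr mulrDr -scalerAr mulr1 (ti_JM hE) => /eqP.
by rewrite subr_eq0 scalerBl => /eqP ->; rewrite addrAC subrr add0r.
Qed.

Lemma JMs_idem i : X i * E = al i *: E.
Proof.
have := congr1 (@bflip _ om m) (idem_JMs i).
by rewrite bflipM bflip_JMs (ti_flip hE) linearZ /= (ti_flip hE).
Qed.

(** Otherwise the exchange relation would produce a Jordan block of the
    diagonalizable element [X a]. *)
Lemma adjacent_distinct (a b : 'I_m) (L : Br om m) z : b = a.+1 :> nat ->
  L * X a = z *: L -> L * X b = z *: L -> L = 0.
Proof.
move=> ba La Lb; set t := bperm om (tperm a b).
have tb : t * X b = X a * t + 1.
  have t2 : t * t = 1 by apply: tr2.
  have := JMs_adj om ba; rewrite -/t => /(congr1 (fun x => t * x * t)).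
  by rewrite mulrDr mulrDl mulr1 t2 -!mulrA t2 mulr1 !mulrA t2 mul1r.
pose M := L * t; have Ma : M * (X a - z%:A) = - L.
  have : L * (t * X b) = L * (X a * t + 1) by rewrite tb.
  have := JMs_adj om ba; rewrite -/t => e _.
  have : L * (X b * t) = L * (t * X a + 1) by rewrite e.
  rewrite mulrA Lb -scalerAl mulrDr mulr1 mulrA -/M => e2.
  by rewrite mulrBr -scalerAr mulr1 e2 opprD addrA subrr add0r.
have [rs urs hr] := JMs_semisimple om a.
have Laz : L * (X a - z%:A) = 0 by rewrite mulrBr -scalerAr mulr1 La subrr.
have Mh p : M * horner_alg (X a) p = p.[z] *: M - L * horner_alg (X a) (dquo p z).
  have := horner_dquo (X a) p z => /(congr1 (fun y => M * y)).
  rewrite mulrA Ma mulNr mulrBr -scalerAr mulr1 => e.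
  by rewrite addrC -[LHS](subrK (p.[z] *: M)) -e.
have Lh p : L * horner_alg (X a) p = p.[z] *: L by apply: eigen_horner.
case: (boolP (z \in rs)) => zr; last first.
  have := Lh (\prod_(r <- rs) ('X - r%:P)); rewrite hr mulr0 => /esym/eqP.
  rewrite scaler_eq0 => /orP[|/eqP //]; rewrite horner_prod.
  rewrite prodf_seq_eq0 => /hasP[r rrs /=]; rewrite hornerXsubC subr_eq0 => /eqP e.
  by rewrite e rrs in zr.
have := Mh (\prod_(r <- rs) ('X - r%:P)); rewrite hr mulr0.
rewrite Lh (perm_big _ (perm_to_rem zr)) big_cons hornerM hornerXsubC subrr mul0r scale0r sub0r.
set h := \prod_(r <- rem z rs) _ => /esym/eqP; rewrite oppr_eq0 scaler_eq0.
have -> : dquo (('X - z%:P) * h) z = h.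
  have := dquoE (('X - z%:P) * h) z; rewrite hornerM hornerXsubC subrr mul0r subr0 => e1.
  by apply: (mulfI (negbT (polyXsubC_eq0 z))).
case/orP=> [|/eqP //]; rewrite horner_prod prodf_seq_eq0 => /hasP[r rrs /=].
rewrite hornerXsubC subr_eq0 => /eqP e; move: rrs; rewrite mem_rem_uniq // inE -e eqxx.
by [].
Qed.

(** The eigenvectors of [X a] for the eigenvalue of [X b] on [E] are excluded by
    [adjacent_distinct]: [h] is the annihilating polynomial of [X a] without this
    root. *)
Lemma idem_kill_content (a b : 'I_m) x : b = a.+1 :> nat -> young b x ->
  exists h : {poly C}, h.[al b] != 0 /\ E * x * horner_alg (X a) h = 0.
Proof.
move=> ba hx; have [rs urs hr] := JMs_semisimple om a.
pose h := \prod_(r <- rem (al b) rs) ('X - r%:P); exists h; split.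
  rewrite horner_prod prodf_seq_neq0; apply/allP => r; rewrite mem_rem_uniq // inE => /andP[rb _] /=.
  by rewrite hornerXsubC subr_eq0 eq_sym.
case: (boolP (al b \in rs)) => zr; last by rewrite /h rem_id // hr mulr0.
apply: (@adjacent_distinct a b _ (al b)) => //.
- have : horner_alg (X a) (('X - (al b)%:P) * h) = 0.
    by rewrite -hr (perm_big _ (perm_to_rem zr)) big_cons.
  rewrite rmorphM rmorphB /= horner_algX horner_algC => e0.
  have cm : horner_alg (X a) h * X a = X a * horner_alg (X a) h.
    by rewrite -{2 3}[X a]horner_algX -!rmorphM /= mulrC.
  apply/eqP; rewrite -subr_eq0 -mulrA cm; apply/eqP.
  by rewrite scalerAr -mulrBr; move: e0; rewrite mulrBl -scalerAl mul1r => ->; rewrite mulr0.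
rewrite -mulrA; have yh : young b (horner_alg (X a) h).
  by apply/young_horner/young_JMs; rewrite ba.
rewrite -(young_comm yh) mulrA -[E * x * _]mulrA -(young_comm hx) mulrA idem_JMs.
by rewrite -!scalerAl.
Qed.

(** Since [X b] commutes with [y] and acts on [E] by [al b], the exchange relation
    shows that a factor [al b - X a] in front of the transposition removes it; by
    [idem_kill_content] this factor can be inverted next to [E * x]. *)
Lemma idem_trade (a b : 'I_m) x y : b = a.+1 :> nat -> young b x -> young b y ->
  exists2 z, young b z & E * (x * bperm om (tperm a b) * y) * E = E * z * E.
Proof.
move=> ba hx hy; set t := bperm om (tperm a b).
have tb : t * X b = X a * t + 1.
  have t2 : t * t = 1 by apply: tr2.
  have := JMs_adj om ba; rewrite -/t => /(congr1 (fun x => t * x * t)).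
  by rewrite mulrDr mulrDl mulr1 t2 -!mulrA t2 mulr1 !mulrA t2 mul1r.
have ha : young b (X a) by apply: young_JMs; rewrite ba.
have [h [h0 hk]] := idem_kill_content ba hx.
pose g := dquo h (al b).
have swap x' : young b x' ->
   E * x' * (X a - (al b)%:A) * t * y * E = - (E * x' * y * E).
  move=> hx'; have e : E * x' * (t * X b) * y * E = E * x' * (X a * t + 1) * y * E by rewrite tb.
  have e1 : E * x' * (t * X b) * y * E = al b *: (E * x' * t * y * E).
    rewrite -!mulrA [X b * _]mulrA (young_comm hy) -[y * _ * E]mulrA JMs_idem.
    by rewrite !(scalerAr, mulrA) -!scalerAr.
  rewrite mulrBr !mulrBl -scalerAr mulr1 -!scalerAl -e1 e mulrDr mulr1 !mulrDl mulrA.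
  by rewrite opprD addrA subrr add0r.
exists ((h.[al b])^-1 *: (x * horner_alg (X a) g * y)).
  by apply/youngZ/youngM => //; apply: youngM => //; apply: young_horner.
have yg : young b (horner_alg (X a) g) by apply: young_horner.
have e := swap _ (youngM hx yg); move: e.
have cm : horner_alg (X a) g * (X a - (al b)%:A) = horner_alg (X a) h - (h.[al b])%:A.
  rewrite -horner_dquo -/g; have : GRing.comm (horner_alg (X a) g) (X a).
    by rewrite /GRing.comm -{2 3}[X a]horner_algX -!rmorphM /= mulrC.
  by move=> e; rewrite mulrBr mulrBl e -scalerAr -scalerAl mulr1 mul1r.
move: cm hk; move: (X a - _) (horner_alg _ g) (horner_alg _ h) => A G H cm hk.
have -> : E * (x * G) * A = - (h.[al b] *: (E * x)).
  rewrite -[E * _ * A]mulrA -[x * G * A]mulrA cm [x * (_ - _)]mulrBr mulrBr [E * (x * H)]mulrA hk.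
  by rewrite sub0r -[x * _%:A]scalerAr mulr1 -scalerAr.
rewrite !mulNr => /oppr_inj; rewrite -!scalerAl -scalerAr -scalerAl [E * (x * G * y)]mulrA => <-.
by rewrite scalerA mulVf // scale1r !mulrA.
Qed.

(** Induction along the chain of symmetric groups: a permutation that moves the
    last dot is a product of two smaller ones around an adjacent transposition,
    which [idem_trade] removes. *)
Lemma idem_young k x : (k <= m)%N -> young k x -> exists z, E * x * E = z *: E.
Proof.
elim: k x => [|k IH] x km hx; elim: hx => {x} [s hs|u v _ [a ha] _ [b hb]|a u _ [b hb]].
1,4: idtac.
all: try by exists (a + b); rewrite mulrDr mulrDl ha hb scalerDl.
all: try by exists (a * b); rewrite -scalerAr -scalerAl hb scalerA.
  exists 1; have -> : s = 1%g by apply/permP => i; rewrite hs // perm1.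
  by rewrite bperm1 mulr1 scale1r (ti_idem hE).
pose b : 'I_m := Ordinal km.
case: (eqVneq (s b) b) => sb.
  apply: IH; first exact: ltnW.
  apply: young_perm => i; rewrite leq_eqVlt => /orP[/eqP e|]; last exact: hs.
  by have -> : i = b by apply: val_inj.
have jk : (s b < k)%N.
  rewrite ltn_neqAle -[X in _ != X]/(val b) (inj_eq val_inj) sb leqNgt /=; apply/negP => h.
  by have /perm_inj e := hs _ h; rewrite e eqxx in sb.
have k0 : (0 < k)%N by apply: leq_ltn_trans jk.
have a_lt : (k.-1 < m)%N by apply: leq_ltn_trans (leq_pred k) km.
pose a : 'I_m := Ordinal a_lt.
have ba : b = a.+1 :> nat by rewrite /= prednK.
(* [s = p * tperm a b * q], where [p] and [q] fix [b]. *)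
pose q := tperm a (s b); pose p := (s * q * tperm a b)%g.
have hp : young b (bperm om p).
  apply: young_perm => i; rewrite leq_eqVlt => /orP[/eqP e|bi].
    have -> : i = b by apply: val_inj.
    by rewrite !permM tpermR tpermL.
  have bi' : (k < i)%N := bi.
  have ne (o : 'I_m) : (o <= k)%N -> o != i by rewrite -(inj_eq val_inj) /=; lia.
  by rewrite !permM hs // !tpermD ?ne // ?leq_pred // ltnW.
have hq : young b (bperm om q).
  apply: young_perm => i /= bi; rewrite tpermD // -(inj_eq val_inj) /= neq_ltn.
    by rewrite prednK // bi.
  by rewrite (leq_trans jk bi).
have sE : bperm om s = bperm om p * bperm om (tperm a b) * bperm om q.
  by rewrite !bpermM /p -!mulgA [(_ * (tperm a b * q))%g]mulgA !tperm2 mul1g tperm2 mulg1.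
have [z hz ez] := idem_trade ba hp hq.
by rewrite sE ez; apply: IH => //; apply: ltnW.
Qed.

(** The diagrams with horizontal edges are killed, and the permutations are
    removed one dot after the other. *)
Theorem idem_primitive x : exists z, E * x * E = z *: E.
Proof.
elim/(@bd_ind _ om): x => [|d|a x y [z hz] [z' hz']].
- by exists 0; rewrite mulr0 mul0r scale0r.
- case: (boolP (is_permd d)) => [/is_permdP[s ->]|hd].
    apply: (@idem_young m) => //; apply: young_perm => i.
    by rewrite leqNgt ltn_ord.
  by exists 0; rewrite (ti_kill hE) // mul0r scale0r.
by exists (a * z + z'); rewrite mulrDr mulrDl -scalerAr -scalerAl hz hz' scalerA scalerDl.
Qed.
End Primitive.

(** * Positivity and extension of intertwiners *)

Section Star.
Variables (C : numClosedFieldType) (om : C) (m : nat).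
Hypothesis om_real : om^* = om.
Local Notation B := (Br om m).

Definition bconj (x : B) : B := [ffun d => (x d : C)^*].
(** The conjugate-linear anti-automorphism for which the permutations are
    unitary. *)
Definition star (x : B) : B := bflip (bconj x).

Lemma bconjD x y : bconj (x + y) = bconj x + bconj y.
Proof. by apply/ffunP => d; rewrite !ffunE rmorphD. Qed.

Lemma bconjZ a x : bconj (a *: x) = a^* *: bconj x.
Proof. by apply/ffunP => d; rewrite !ffunE rmorphM. Qed.

Lemma bconj_bd d : bconj (bd om d) = bd om d.
Proof. by apply/ffunP => d'; rewrite !ffunE conjC_nat. Qed.

Lemma bconj0 : bconj 0 = 0.
Proof. by rewrite -[X in bconj X](scale0r 0) bconjZ conjC0 scale0r. Qed.

Lemma bconjM x y : bconj (x * y) = bconj x * bconj y.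
Proof.
elim/(@bd_ind _ om): x => [|d|a x x' hx hx'].
- by rewrite bconj0 !mul0r bconj0.
- elim/(@bd_ind _ om): y => [|d'|a y y' hy hy'].
  + by rewrite bconj0 !mulr0 bconj0.
  + by rewrite !bconj_bd bd_mul bconjZ rmorphXn /= om_real bconj_bd.
  by rewrite mulrDr bconjD -scalerAr bconjZ hy hy' bconjD bconjZ mulrDr -scalerAr.
by rewrite mulrDl bconjD -scalerAl bconjZ hx hx' bconjD bconjZ mulrDl -scalerAl.
Qed.

Lemma bconjK : involutive bconj.
Proof. by move=> x; apply/ffunP => d; rewrite !ffunE conjCK. Qed.

Lemma bconj_flip x : bconj (bflip x) = bflip (bconj x).
Proof. by apply/ffunP => d; rewrite !ffunE. Qed.

Lemma starM x y : star (x * y) = star y * star x.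
Proof. by rewrite /star bconjM bflipM. Qed.

Lemma starZ a x : star (a *: x) = a^* *: star x.
Proof. by rewrite /star bconjZ linearZ. Qed.

Lemma starK : involutive star.
Proof. by move=> x; rewrite /star bconj_flip bflipK bconjK. Qed.

Lemma star_JM i : star (JM om i) = JM om i.
Proof.
have e : bconj (JM om i) = JM om i; last by rewrite /star e bflip_JM.
have two : (2 : C)^* = 2 by rewrite conjC_nat.
rewrite JME bconjD bconjZ; congr (_ + _).
  by rewrite /kappa fmorph_div rmorphB rmorph1 /= om_real two one_bd bconj_bd.
rewrite (big_morph bconj bconjD bconj0); apply: eq_bigr => a ai.
rewrite bconjD -scaleN1r bconjZ rmorphN1 scaleN1r bconj_bd.
by rewrite (bepsE _ (ltn_neq ai)) bconj_bd scaleN1r.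
Qed.

Lemma coef1_mul (x y : B) :
  (x * y) (permd 1) = \sum_(d | is_permd d) (x d : C) * y (dflip d) :> C.
Proof.
rewrite [x * y]bprodE sum_ffunE [RHS]big_mkcond; apply: eq_bigr => d1 _; rewrite sum_ffunE.
have cE d2 : (((x d1 : C) * y d2 * om ^+ loops d1 d2) *: bd om (dcomp d1 d2)) (permd 1) =
  (x d1 : C) * y d2 * om ^+ loops d1 d2 * (permd 1 == dcomp d1 d2)%:R.
  by rewrite !ffunE.
case: (boolP (is_permd d1)) cE => [/is_permdP[s ->]|h1] cE; last first.
  rewrite big1 // => d2 _; rewrite cE (_ : (_ == _) = false) ?mulr0 //.
  by apply: contraNF (not_permd_compl d2 h1) => /eqP <-; apply: is_permd_permd.
rewrite (bigD1 (dflip (permd s))) //= big1 ?addr0.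
  by rewrite cE dflip_permd (dcomp_permd _ _).1 mulgV eqxx loops_permd_l expr0 !mulr1.
move=> d2 d2s; rewrite cE (_ : (_ == _) = false) ?mulr0 //.
apply: contraNF d2s => /eqP e; rewrite dflip_permd -[d2](dcomp1d _).1 -[1%g](mulVg s).
by rewrite -(dcomp_permd _ _).1 (dcompA _ _ _).1 -e (dcompd1 _).1.
Qed.

(** The coefficient of the identity in [star x * x] is the sum of the squared
    moduli of the coefficients of [x] at the permutations. *)
Lemma star_mul_eq0 (x : B) : star x * x = 0 -> nonperm x.
Proof.
move=> e; have := coef1_mul (star x) x; rewrite e ffunE => /esym.
have -> : \sum_(d | is_permd d) (star x d : C) * x (dflip d) =
   \sum_(d : diagram m | is_permd d) `|x (dflip d) : C| ^+ 2.
  by apply: eq_bigr => d _; rewrite !ffunE normCK mulrC.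
move=> /eqP; rewrite psumr_eq0 => [/allP h d hd|d _]; last by rewrite exprn_ge0.
have := h (dflip d) (mem_index_enum _); rewrite is_permd_flip hd /= expf_eq0 /= normr_eq0.
by rewrite dflipK => /eqP.
Qed.

Section Idempotent.
Variables (c : nat -> C) (E : B).
Hypotheses (hE : tab_idem c E) (c_real : forall i, (i < m)%N -> (c i)^* = c i).

(** [star E] is fixed by [E] on the left because the contents are real; hence
    [star E = E * star E] is self-adjoint. *)
Lemma star_idem : star E = E.
Proof.
have [b eE] := ti_one hE.
have JMs_star i : JM om i * star E = c i *: star E.
  by rewrite -(star_JM i) -starM (ti_JM hE) starZ c_real.
have e : E * star E = star E.
  rewrite {1}eE mulrDl mul1r mulr_suml big1 ?addr0 // => i _.
  by rewrite -mulrA mulrBl JMs_star -scalerAl mul1r subrr mulr0.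
by rewrite -[RHS]starK -[in RHS]e starM starK.
Qed.

(** By primitivity [E * star b * b * E] is a multiple of [E]; if this multiple is
    zero, positivity puts [b * E] in the ideal that [E] kills. *)
Lemma idem_recover (b : B) : b * E = 0 \/ exists2 z, z != 0 & E * star b * b * E = z *: E.
Proof.
have [z hz] := idem_primitive hE (star b * b).
case: (eqVneq z 0) => [z0|zn]; last by right; exists z; rewrite // -[E * _ * b]mulrA.
left; have np : nonperm (b * E).
  apply: star_mul_eq0; rewrite starM star_idem mulrA -[E * _ * b]mulrA hz z0.
  by rewrite scale0r.
have bE : b * E * E = b * E by rewrite -mulrA (ti_idem hE).
move: (b * E) np bE => y np <-; have ny : nonperm (bflip y).
  by move=> d hd; rewrite ffunE np // is_permd_flip.
have := congr1 (@bflip _ om m) (kills_nonperm (ti_kill hE) ny).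
by rewrite bflipM bflipK (ti_flip hE) raddf0.
Qed.
End Idempotent.
End Star.

Section Orbit.
Variables (F : fieldType) (m : nat) (V : vectType F) (beta : {linear brauer F m -> 'End(V)}).

Definition orbit_map (v : V) (b : brauer F m) : V := beta b v.
Lemma orbit_map_linear v : linear (orbit_map v).
Proof. by move=> a x y; rewrite /orbit_map linearP lfunE /= lfunE. Qed.
HB.instance Definition _ v := GRing.isLinear.Build F (brauer F m) V _ (orbit_map v) (orbit_map_linear v).
End Orbit.

Section Extension.
Variables (C : numClosedFieldType) (om : C) (m : nat).
Hypothesis om_real : om^* = om.
Variables (c : nat -> C) (E : Br om m).
Hypotheses (hE : tab_idem c E) (c_real : forall i, (i < m)%N -> (c i)^* = c i).
Variables (V W : vectType C).
Variables (beta : {linear brauer C m -> 'End(V)}) (act : {linear brauer C m -> 'End(W)}).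
Hypotheses (bR : brauer_rep om beta) (bI : brauer_irreducible beta) (aR : brauer_rep om act).
Variable v : V.
Hypotheses (v0 : v != 0) (bv : forall i : 'I_m, beta (jm om i) v = c i *: v).

Let betaM (x y : Br om m) u : beta (x * y : Br om m) u = beta x (beta y u).
Proof. by have := bR.2 x y; rewrite bmulE => ->; rewrite comp_lfunE. Qed.
Let actM (x y : Br om m) u : act (x * y : Br om m) u = act x (act y u).
Proof. by have := aR.2 x y; rewrite bmulE => ->; rewrite comp_lfunE. Qed.
Let beta1 u : beta (1 : Br om m) u = u.
Proof. by have := bR.1 => ->; rewrite lfunE. Qed.
Let act1 u : act (1 : Br om m) u = u.
Proof. by have := aR.1 => ->; rewrite lfunE. Qed.

Lemma rep_idem : beta E v = v.
Proof.
have [b ->] := ti_one hE; rewrite linearD lfunE /= beta1 linear_sum sum_lfunE big1 ?addr0 // => i _.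
rewrite /= betaM linearB /= linearZ /= !lfunE /= lfunE /= lfunE.
rewrite -[X in beta (b i) (_ - X)]/(c i *: beta (1 : Br om m) v) beta1.
by rewrite JM_jm bv subrr linear0.
Qed.

Let LvE b : linfun (orbit_map beta v) b = beta b v.
Proof. by rewrite lfunE. Qed.

Lemma rep_cyclic u : exists b : Br om m, u = beta b v.
Proof.
case: bI => _ /(_ (limg (linfun (orbit_map beta v)))).
case=> [x|h|h].
- apply/subvP => w /memv_imgP[w' /memv_imgP[b _ ->] ->].
  by rewrite LvE -(betaM x b) -LvE memv_img ?memvf.
- have := memv_img (linfun (orbit_map beta v)) (memvf (1 : Br om m)).
  by rewrite h memv0 LvE beta1 (negPf v0).
have : u \in limg (linfun (orbit_map beta v)) by rewrite h memvf.
by case/memv_imgP => b _ ->; exists b; rewrite LvE.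
Qed.

(** What kills [v] kills every vector fixed by [E]: otherwise [idem_recover] would
    recover [E], hence [v], from [b]. *)
Lemma rep_annihilator (b : Br om m) w : act E w = w -> beta b v = 0 -> act b w = 0.
Proof.
move=> ew bv0; rewrite -ew -actM.
case: (idem_recover om_real hE c_real b) => [->|[z z0 hz]].
  by rewrite linear0 lfunE.
have := congr1 (fun x : Br om m => beta x v) hz.
rewrite /= !betaM rep_idem bv0 !linear0 linearZ lfunE /= rep_idem => /esym/eqP.
by rewrite scaler_eq0 (negPf z0) (negPf v0).
Qed.

(** The map [beta b v |-> act b w] is well defined by [rep_annihilator]. *)
Lemma intertwiner_exists w : act E w = w -> exists f, intertwiner beta act f /\ f v = w.
Proof.
move=> ew; pose Lv := linfun (orbit_map beta v); pose Lw := linfun (orbit_map act w).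
pose f := (Lw \o Lv^-1)%VF.
have fE (b : Br om m) : f (beta b v) = act b w.
  have e : Lv ((Lv^-1)%VF (beta b v)) = beta b v.
    apply: limg_lfunVK; have := memv_img Lv (memvf b); rewrite lfunE.
    by [].
  rewrite comp_lfunE; move: e; rewrite !lfunE /= /orbit_map; set b' := (Lv^-1)%VF _ => e.
  apply/eqP; rewrite -subr_eq0; apply/eqP.
  have := @rep_annihilator (b' - b : Br om m) w ew.
  rewrite !linearB /= !lfunE /= !lfunE /= e subrr => -> //.
exists f; split; last by rewrite -[in LHS](beta1 v) fE act1.
move=> x; apply/lfunP => u; have [b ->] := rep_cyclic u.
by rewrite [LHS]comp_lfunE [RHS]comp_lfunE -betaM !fE actM.
Qed.
End Extension.

(** * The dimension of the multiplicity space *)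

Section FullTrace.
Variables (F : fieldType) (n : nat).

Definition fulltr m (A : 'End(tensor F n m)) : F := \sum_I entry A I I.

Lemma fulltr_ptrace m (A : 'End(tensor F n m.+1)) : fulltr (ptrace A) = fulltr A.
Proof.
rewrite /fulltr [RHS](sum_extend (fun K => entry A K K)).
by apply: eq_bigr => I _; rewrite entry_ptrace.
Qed.

Lemma fulltrZ m a (A : 'End(tensor F n m)) : fulltr (a *: A) = a * fulltr A.
Proof. by rewrite /fulltr mulr_sumr; apply: eq_bigr => I _; rewrite entryZ. Qed.

(** In terms of a basis [v] of its image, an idempotent [e] is the sum of the
    operators [v_k coord_k e], and [coord_k (e v_k) = 1]. *)
Lemma fulltr_idem m (e : 'End(tensor F n m)) : (e \o e)%VF = e ->
  fulltr e = (\dim (limg e))%:R.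
Proof.
move=> ee; set b := vbasis (limg e).
have ev u : u \in limg e -> e u = u by case/memv_imgP => w _ ->; rewrite -comp_lfunE ee.
transitivity (\sum_I \sum_(i < \dim (limg e)) coord b i (e (tbasis F I)) * (b`_i : tensor F n m) I).
  apply: eq_bigr => I _; rewrite /entry {1}(coord_vbasis (memv_img e (memvf (tbasis F I)))).
  by rewrite sum_ffunE; apply: eq_bigr => i _; rewrite ffunE.
rewrite exchange_big /= -[RHS]mulr1n -[in RHS](card_ord (\dim (limg e))) -sum1_card natr_sum.
apply: eq_bigr => i _; have bi : b`_i \in limg e by apply/vbasis_mem/mem_nth; rewrite size_tuple.
transitivity (coord b i (e b`_i)).
  rewrite [in RHS](tensor_sum b`_i) !linear_sum; apply: eq_bigr => I _ /=.
  by rewrite linearZ linearZ /= mulrC.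
by rewrite ev // coord_free ?eqxx // (basis_free (vbasisP _)).
Qed.
End FullTrace.

Section EvalMap.
Variables (F : fieldType) (X V W : vectType F) (phi : {linear X -> 'Hom(V, W)}).

Definition eval_map (v : V) (x : X) : W := phi x v.
Lemma eval_map_linear v : linear (eval_map v).
Proof. by move=> a x y; rewrite /eval_map linearP lfunE /= lfunE. Qed.
HB.instance Definition _ v := GRing.isLinear.Build F X W _ (eval_map v) (eval_map_linear v).
End EvalMap.

Section Dimension.
Variables (K : numClosedFieldType) (n : nat).
Hypothesis n0 : (0 < n)%N.
Local Notation om := (brauer_omega K n).
Variable act : forall m, {linear brauer K m -> 'End(tensor K n m)}.
Hypothesis hact : forall m, tensor_action (act m).

Lemma om_real : om^* = om.
Proof. by rewrite /brauer_omega rmorphN rmorph_nat. Qed.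

Lemma content_real T r : (content om T r)^* = content om T r.
Proof. by rewrite /content rmorphB rmorphD fmorph_div rmorphB /= om_real !rmorph_nat rmorph1. Qed.

Lemma D_empty : D K n (conj_diagram [::]) = 1.
Proof. by rewrite /D /hook_product /= !big_geq // invr1 mulr1. Qed.

Lemma fulltr_tableau lam T m : std_tableau lam T -> (rowlen lam 1 <= n)%N -> (m <= size T)%N ->
  fulltr (act m (idem om T m)) = D K n (conj_diagram (Lambda T m)).
Proof.
move=> hT ln; elim: m => [|m IH] mT.
  rewrite /= (hact 0).1.1 /Lambda /= D_empty /fulltr.
  under eq_bigr do rewrite entry_id eqxx.
  by rewrite sumr_const card_ffun !card_ord expn0.
rewrite -fulltr_ptrace (ptrace_idem n0 hact hT ln mT) fulltrZ IH ?(ltnW mT) //.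
rewrite divfK //; apply: D_conj_neq0; first exact: (Lambda_diagram hT).
by apply: leq_trans ln; apply: (row1_Lambda hT); apply: ltnW.
Qed.

(** Evaluation at the vector [v_T] identifies the intertwiners with the image of
    [E_T]: it is injective since [v_T] generates the irreducible representation,
    and surjective by [intertwiner_exists].  The dimension is then the trace of
    the idempotent, the product of the successive ratios. *)
Theorem dim_multiplicity (rho : seq nat) (X : vectType K) (r : 'M[K]_(2 * n) -> 'End(X)) :
  is_diagram rho -> (size rho <= n)%N -> is_L act rho r -> (\dim {:X})%:R = D K n rho.
Proof.
move=> dr rn [_ _ [V [beta [phi [[bR bI [tabs [v [_ tabsE bas bv]]]] phi_inj phiP _]]]]].
have dc := conj_is_diagram dr; have ln : (rowlen (conj_diagram rho) 1 <= n)%N.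
  by rewrite rowlen_conj // collen1.
have [T Tt] : exists T, T \in tabs.
  case: (tabs) bas => [|T ts] bas; last by exists T; rewrite inE eqxx.
  by case: bI; rewrite -(span_basis bas) span_nil eqxx.
have hT : std_tableau (conj_diagram rho) T by rewrite -tabsE.
have sT : size T = sumn rho by rewrite (size_tableau hT) sumn_conj.
have v0 : v T != 0.
  apply: contraTneq (basis_free bas) => e; apply/negP => /free_not0.
  by move=> /(_ (v T) (map_f v Tt)); rewrite e eqxx.
set E := idem om T (sumn rho).
have hE : tab_idem (fun i => content om T i.+1) (E : Br om (sumn rho)).
  by apply: (tab_idem_idem K n0 hT ln); rewrite sT.
have c_real i : (i < sumn rho)%N -> (content om T i.+1)^* = content om T i.+1.
  by move=> _; apply: content_real.
have bvT := bv T Tt; have aR := (hact (sumn rho)).1.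
pose e := act (sumn rho) E.
have ee : (e \o e)%VF = e.
  by rewrite /e -aR.2 bmulE (ti_idem hE).
have <- : fulltr e = D K n rho.
  by have := fulltr_tableau hT ln (leqnn _); rewrite (Lambda_last hT) conjK // sT.
rewrite fulltr_idem //; congr (_ %:R).
pose psi := linfun (eval_map phi (v T)).
have psiE x : psi x = phi x (v T) by rewrite lfunE.
have inter x : intertwiner beta (act (sumn rho)) (phi x) by apply/phiP; exists x.
have fE x b : phi x (beta b (v T)) = act (sumn rho) b (phi x (v T)).
  by rewrite -!comp_lfunE inter.
have <- : limg psi = limg e.
  apply/vspaceP => w; apply/memv_imgP/memv_imgP => [[x _ ->]|[w' _ ->]].
    exists (psi x); rewrite ?memvf // psiE /e -fE.
    by rewrite (rep_idem hE bR bvT).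
  have ew : e (e w') = e w' by rewrite -comp_lfunE ee.
  have [f [fi fv]] := intertwiner_exists om_real hE c_real bR bI aR v0 bvT ew.
  have [x xf] := (phiP f).1 fi; exists x; rewrite ?memvf // psiE xf fv.
  by [].
rewrite -(limg_ker_dim psi fullv) capfv (_ : lker psi = 0%VS) ?dimv0 //.
apply/eqP; rewrite -subv0; apply/subvP => x; rewrite memv_ker psiE memv0 => /eqP px.
apply/eqP/phi_inj; rewrite linear0; apply/lfunP => u.
by have [b ->] := rep_cyclic bR bI v0 u; rewrite fE px linear0 lfunE.
Qed.

End Dimension.

From mathcomp Require Import reals complex.

Theorem proposition3p3 (R : realType) (n : nat) (hn : (1 <= n)%N)
    (act : forall m : nat, {linear brauer R[i] m -> 'End(tensor R[i] n m)})
    (hact : forall m : nat, tensor_action (act m)) :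
  (forall (m : nat) (lam : seq nat) (T : tableau),
     is_diagram lam -> sumn lam = m.+1 -> (rowlen lam 1 <= n)%N ->
     std_tableau lam T ->
     let U := take m T in
     let mu := last [::] U in
     ptrace (act m.+1 (idem (brauer_omega R[i] n) T m.+1)) =
     (D R[i] n (conj_diagram lam) / D R[i] n (conj_diagram mu)) *:
       act m (idem (brauer_omega R[i] n) U m)) /\
  (forall (rho : seq nat) (X : vectType R[i]) (r : 'M[R[i]]_(2 * n) -> 'End(X)),
     is_diagram rho -> (size rho <= n)%N -> is_L act rho r ->
     (\dim {:X})%:R = D R[i] n rho).
Proof.
split=> [m lam T _ slam ln hT U mu|rho X r]; last exact: (dim_multiplicity hn hact).
have sT : size T = m.+1 by rewrite (size_tableau hT).
have mT : (m < size T)%N by rewrite sT.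
have sU : size U = m by rewrite size_take mT.
have -> : mu = Lambda T m.
  by rewrite -(@Lambda_take T m m (leqnn m)) /mu -/U -nth_last sU /Lambda; case: (m) sU; case: (U).
rewrite (@idem_eq _ _ U T m) => [|r rm]; last exact: Lambda_take.
by rewrite (ptrace_idem hn hact hT ln mT) -sT (Lambda_last hT).
Qed.
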